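(* Let $\lambda\in(-\sqrt2,\sqrt2)$. Then the only solution $f\in L_2(\mathbb{R}_+)$ of the integro-functional equation $$f(x)+\frac2\pi\,PV\int_0^\infty\frac{x f(t)}{x^2-t^2}\,dt=\frac\lambda x f\left(\frac1x\right),\quad x>0,$$ is the trivial one $f=0$, and the only solution $f\in L_2(\mathbb{R}_+)$ of the integro-functional equation $$f(x)+\frac2\pi\,PV\int_0^\infty\frac{t f(t)}{t^2-x^2}\,dt=\frac\lambda x f\left(\frac1x\right),\quad x>0,$$ is the trivial one $f=0$.
   Context: $\mathbb{R}_+=(0,\infty)$. $PV$ denotes the Cauchy principal value at $t=x$. Equalities between $L_2$ functions are understood almost everywhere. *)

(* Defs.v *)
From mathcomp Require Import all_boot all_order all_algebra.
From mathcomp Require Import all_classical all_reals all_analysis.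
From mathcomp Require Import complex.
Set Implicit Arguments.
Unset Strict Implicit.
Unset Printing Implicit Defensive.
Import Order.TTheory GRing.Theory Num.Theory.
Import numFieldNormedType.Exports.
Local Open Scope classical_set_scope.
Local Open Scope ring_scope.
Local Open Scope complex_scope.

(* Elements of L_2(R_+), R_+ = ]0, +oo[, are represented by complex-valued
   functions on the whole line; their values outside R_+ are never used. *)
Definition L2pos (R : realType) (f : R -> R[i]) : Prop :=
  [/\ measurable_fun (`]0, +oo[ : set R) (fun x : R => complex.Re (f x)),
      measurable_fun (`]0, +oo[ : set R) (fun x : R => complex.Im (f x)) &
      (\int[@lebesgue_measure R]_(x in `]0%R, +oo[)
         (complex.Re (f x) ^+ 2 + complex.Im (f x) ^+ 2)%:E < +oo)%E].

Definition ae_zero_pos (R : realType) (f : R -> R[i]) : Prop :=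
  {ae @lebesgue_measure R, forall x, 0 < x -> f x = 0}.

(* R_+ minus the closed e-neighbourhood of x. *)
Definition punctured_pos (R : realType) (x e : R) : set R :=
  [set t | 0 < t /\ e < `|t - x|].

(* PV int_0^oo g(t) dt exists, with singular point t = x, and equals v.
   Integrability of the truncations excludes the default values taken by
   Rintegral. *)
Definition is_PV (R : realType) (x : R) (g : R -> R) (v : R) : Prop :=
  (forall e : R, 0 < e ->
    (@lebesgue_measure R).-integrable (punctured_pos x e) (EFin \o g)) /\
  (Rintegral (@lebesgue_measure R) (punctured_pos x e) g) @[e --> 0^'+] --> v.

Definition is_PVC (R : realType) (x : R) (g : R -> R[i]) (v : R[i]) : Prop :=
  is_PV x (fun t => complex.Re (g t)) (complex.Re v) /\
  is_PV x (fun t => complex.Im (g t)) (complex.Im v).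

(* For almost every x > 0, the principal value exists and
   f(x) + 2/pi PV int_0^oo k(x,t) f(t) dt = lambda/x f(1/x). *)
Definition solves_PV_eq (R : realType) (k : R -> R -> R) (lambda : R)
    (f : R -> R[i]) : Prop :=
  {ae @lebesgue_measure R, forall x, 0 < x ->
    exists2 v : R[i],
      is_PVC x (fun t => (k x t)%:C * f t) v &
      f x + (2 / pi)%:C * v = (lambda / x)%:C * f (1 / x)}.

(* Main.v *)
From HB Require Import structures.
Require Import Defs.
From mathcomp Require Import all_boot all_order all_algebra.
From mathcomp Require Import all_classical all_reals all_analysis.
From mathcomp Require Import measurable_realfun complex ring lra.
Set Implicit Arguments.
Unset Strict Implicit.
Unset Printing Implicit Defensive.
Import Order.TTheory GRing.Theory Num.Theory.
Import numFieldNormedType.Exports.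
Local Open Scope classical_set_scope.
Local Open Scope ring_scope.

(** Both kernels are covered by (sg / (x - t) + 1 / (x + t)) / 2, with sg = 1
    for the first equation and sg = -1 for the second, so both equations read
    f + Q f = h with
      Q f x = 1/pi PV int_0^oo (sg / (x - t) + 1 / (x + t)) f t dt
    and h x = lambda / x * f (1 / x).  Up to sign, Q is the Hilbert transform
    of the even (sg = 1) or odd (sg = -1) extension of f; it is therefore an
    isometry of L_2(R_+).  Moreover <f, Q f> >= 0: the kernel sg / (x - t) is
    antisymmetric, and 1 / (x + t) = int_0^oo exp (- s x) exp (- s t) ds is
    positive definite.  Hence, |.| being the norm of L_2(R_+),
      |f + Q f|^2 = |f|^2 + 2 <f, Q f> + |Q f|^2 >= 2 |f|^2,
    while |h|^2 = lambda^2 |f|^2, because x -> 1 / x turns dx into x^-2 dx.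
    As lambda^2 < 2, this leaves f = 0.  The kernels and lambda are real, so
    real and imaginary parts of f may be treated separately.

    To make this rigorous, 1 / u is regularised to u / (u^2 + a^2), the
    conjugate Poisson kernel; this turns Q into an integral operator Q_a,
    written Q_n for a = 1 / (n + 1).  Replacing u / (u^2 + a^2) by the Poisson
    kernel a / (u^2 + a^2) gives a companion P_a, and the isometry becomes
    <Q_a phi, Q_b phi> = <P_a phi, P_b phi> (op_isometry), which reflects that
    1 / ((x - s + i a) (x - t + i b)) has integral 0 over the line
    (kernels_isometry).  The P_a are contractions (opP_contraction) with
    P_a phi -> phi in L_2 (opP_cvg_L2), and <phi, Q_a phi> >= - C a^2
    (inner_opQ_ge).  These facts are established for bounded phi with compact
    support in R_+, and truncation with Fatou's lemma carries what is needed
    over to L_2(R_+) (opQ_contraction).  The outcome is energy_inequality: if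
    f + Q_a f -> h almost everywhere, then 2 |f|^2 <= |h|^2.

    The principal value enters through Abel means (abel_fubini): an integral
    regularised by the factor u^2 / (u^2 + a^2), u = t - x, is an average,
    over r > 0 and with a fixed weight, of the integrals truncated at
    |t - x| > a r.  Hence Q_a f x -> Q f x at every x where the principal
    value exists (PV_op); the same averages of means over small balls give
    P_a phi -> phi at the Lebesgue points of phi (opP_cvg_ae). *)

(** * The half-line as a measure space *)

Section half_line_measure.
Context {R : realType}.
Local Notation mu := (@lebesgue_measure R).

Fact measurable_pos : measurable (`]0, +oo[ : set (measurableTypeR R)).
Proof. exact: measurable_itv. Qed.

Definition muP : set (measurableTypeR R) -> \bar R := mrestr mu measurable_pos.

HB.instance Definition _ := Measure.copy muP (mrestr mu measurable_pos).

Lemma muPE (A : set (measurableTypeR R)) : muP A = mu (A `&` `]0, +oo[).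
Proof. by []. Qed.

Lemma muP_sigma_finite : sigma_finite setT muP.
Proof.
have [F UF mF] := @sigma_finiteT _ _ R mu.
exists F => // i; split; first exact: (mF i).1.
rewrite muPE; apply: le_lt_trans (mF i).2; apply: le_measure => //.
- by rewrite inE; apply: measurableI => //; exact: (mF i).1.
- by rewrite inE; exact: (mF i).1.
Qed.
HB.instance Definition _ := @Measure_isSigmaFinite.Build _ _ _ muP muP_sigma_finite.

#[global] Instance muP_ae_filter : Filter (nbhs (almost_everywhere muP)).
Proof. exact: ae_filter_ringOfSetsType. Qed.

Lemma muP_ae (P : R -> Prop) :
  {ae mu, forall x, 0 < x -> P x} <-> {ae muP, forall x, P x}.
Proof.
split => -[N [mN N0 sN]].
  exists (N `|` `]-oo, 0]); split.
  - exact: measurableU.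
  - rewrite muPE setIUl.
    rewrite (_ : `]-oo, 0] `&` _ = set0) ?setU0; last first.
      by apply/seteqP; split=> // x /= []; rewrite !in_itv/= andbT; lra.
    by apply: (subset_measure0 (B := N)) => //; exact: measurableI.
  - move=> x /= nP; have [x0|x0] := leP x 0; first by right; rewrite /= in_itv.
    by left; apply: sN => /= /(_ x0).
exists (N `&` `]0, +oo[); split => //; first exact: measurableI.
by move=> x /= /not_implyP[x0 nP]; split; [exact: sN|rewrite /= in_itv/= x0].
Qed.

Lemma muP_pos : {ae muP, forall x, 0 < x}.
Proof. by apply/muP_ae; apply: aeW. Qed.

Lemma ge0_integral_muP (f : R -> \bar R) : measurable_fun setT f ->
  (forall x, 0 <= f x)%E ->
  (\int[muP]_x f x = \int[mu]_(x in `]0%R, +oo[) f x)%E.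
Proof.
move=> mf f0.
rewrite [RHS](eq_measure_integral (muP : {measure set (measurableTypeR R) -> \bar R})); last first.
  by move=> A mA AD /=; rewrite muPE setIidl.
rewrite [RHS]integral_mkcond/=.
apply: ge0_ae_eq_integral => //.
- by apply: (proj1 (measurable_restrictT f measurable_pos)); exact: measurable_funTS.
- by move=> x _; apply: erestrict_ge0 => y _.
- have H := muP_pos. move: H; apply: filterS  => x x0 _.
  by rewrite patchE mem_set//= in_itv/= x0.
Qed.

Lemma integral_muP (f : R -> \bar R) : measurable_fun setT f ->
  (\int[muP]_x f x = \int[mu]_(x in `]0%R, +oo[) f x)%E.
Proof.
move=> mf; rewrite [LHS]integralE [RHS]integralE; congr (_ - _)%E; apply: ge0_integral_muP => //.
- exact: measurable_funepos.
- exact: measurable_funeneg.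
Qed.

Lemma integrable_muP (f : R -> \bar R) : measurable_fun setT f ->
  mu.-integrable `]0, +oo[ f -> muP.-integrable setT f.
Proof.
move=> mf /integrableP[_ fi]; apply/integrableP; split => //.
by rewrite ge0_integral_muP//; exact: measurableT_comp.
Qed.

End half_line_measure.

Section FTC.
Context {R : realType}.
Local Notation muP := (@muP R).

Lemma integral_muP_derivative (f F : R -> R) (l : R) :
  (forall x, 0 <= f x) -> continuous f ->
  (forall x : R, is_derive x 1 F (f x)) -> F x @[x --> +oo] --> l ->
  (\int[muP]_x (f x)%:E = (l - F 0)%:E)%E.
Proof.
move=> f0 cf dF Fl.
have mf : measurable_fun setT f by exact: continuous_measurable_fun.
rewrite ge0_integral_muP//; last exact/measurable_EFinP.
rewrite integral_itv_obnd_cbnd; last first.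
  exact/measurable_EFinP/measurable_funTS.
rewrite (@ge0_continuous_FTC2y _ f F 0 l)//.
- by apply: continuous_subspaceT.
- apply: cvg_at_right_filter. apply: differentiable_continuous.
  by apply/derivable1_diffP; exact: ex_derive.
- by move=> x _; rewrite derive1E; exact: derive_val.
Qed.

(** Adding C / (1 + x^2), whose primitive is C atan x, reduces to nonnegative
    integrands. *)
Lemma integral_muP_derivative_dominated (f F : R -> R) (C l : R) :
  (forall x, `|f x| <= C / (1 + x ^+ 2)) -> continuous f ->
  (forall x : R, is_derive x 1 F (f x)) -> F x @[x --> +oo] --> l ->
  muP.-integrable setT (EFin \o f) /\
  (\int[muP]_x f x = l - F 0)%R.
Proof.
move=> fC cf dF Fl.
pose h x : R := C / (1 + x ^+ 2).
have pos x : 0 < 1 + x ^+ 2 :> R by rewrite ltr_pwDl// sqr_ge0.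
have ch : continuous h.
  move=> x; apply: cvgM; first exact: cvg_cst.
  apply: cvgV; first by rewrite gt_eqF.
  by apply: cvgD; [exact: cvg_cst|exact: exprn_continuous].
have C0 : 0 <= C by have := fC 0; rewrite expr0n addr0 divr1; exact: le_trans.
have dh (x : R) : is_derive x 1 (fun x => C * atan x) (h x).
  by apply: is_derive_eq.
have lh : (fun x => C * atan x) x @[x --> +oo] --> C * (pi / 2).
  by apply: cvgM; [exact: cvg_cst|exact: cvgy_atan].
have h0 x : 0 <= h x by rewrite /h divr_ge0// ltW.
have hE := integral_muP_derivative h0 ch dh lh.
have mh : measurable_fun setT h by exact: continuous_measurable_fun.
have ih : muP.-integrable setT (EFin \o h).
  apply/integrableP; split; first exact/measurable_EFinP.
  under eq_integral do rewrite /= ger0_norm//.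
  by rewrite hE ltry.
have fh0 x : 0 <= f x + h x.
  have := fC x; rewrite ler_norml -/(h x); lra.
have cfh : continuous (fun x => f x + h x).
  by move=> x; apply: cvgD; [exact: cf|exact: ch].
have dfh (x : R) : is_derive x 1 (fun x => F x + C * atan x) (f x + h x).
  by apply: is_deriveD.
have lfh : F x + C * atan x @[x --> +oo] --> l + C * (pi / 2) by exact: cvgD.
have fhE := integral_muP_derivative fh0 cfh dfh lfh.
have mf : measurable_fun setT f by exact: continuous_measurable_fun.
have if_ : muP.-integrable setT (EFin \o f).
  apply: (le_integrable _ _ _ ih) => //; first exact/measurable_EFinP.
  move=> x _ /=; rewrite lee_fin (ger0_norm (h0 x)); exact: fC.
split => //.
have := fhE; rewrite (integralD_EFin _ if_ ih)//=.
rewrite hE /Rintegral.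
have /fineK <- := integrable_fin_num measurableT if_.
rewrite /= -EFinD => -[] /=; rewrite atan0; lra.
Qed.

End FTC.

(** * Conjugate Poisson and Poisson kernels *)

Section kernels.
Context {R : realType}.
Implicit Types (a b c s t u x sg : R).

(** conj_poisson and poisson are the real part and the opposite of the
    imaginary part of 1 / (u + i a); conj_poisson regularises 1 / u. *)
Definition conj_poisson a u := u / (u ^+ 2 + a ^+ 2).
Definition poisson a u := a / (u ^+ 2 + a ^+ 2).
Local Notation q := conj_poisson.
Local Notation p := poisson.

(** If g is the even (sg = 1) or odd (sg = -1) extension of f to the line,
    then Pk sg applied to f is the convolution of poisson with g, and Qk sg
    applied to f is sg times the convolution of conj_poisson with g. *)
Definition Qk sg a x t := sg * q a (x - t) + q a (x + t).
Definition Pk sg a x t := p a (x - t) + sg * p a (x + t).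

Lemma sqrD_gt0 a u : 0 < a -> 0 < u ^+ 2 + a ^+ 2.
Proof. by move=> a0; rewrite ltr_wpDl ?sqr_ge0// exprn_gt0. Qed.

Lemma continuous_conj_poisson a : 0 < a -> continuous (q a).
Proof.
move=> a0 u; apply: cvgM; first exact: cvg_id.
apply: cvgV; first by rewrite gt_eqF// sqrD_gt0.
by apply: cvgD; [exact: exprn_continuous|exact: cvg_cst].
Qed.

Lemma continuous_poisson a : 0 < a -> continuous (p a).
Proof.
move=> a0 u; apply: cvgM; first exact: cvg_cst.
apply: cvgV; first by rewrite gt_eqF// sqrD_gt0.
by apply: cvgD; [exact: exprn_continuous|exact: cvg_cst].
Qed.

Lemma poisson_ge0 a u : 0 < a -> 0 <= p a u.
Proof. by move=> a0; rewrite divr_ge0// ltW// sqrD_gt0. Qed.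

Lemma poissonN a u : p a (- u) = p a u.
Proof. by rewrite /p sqrrN. Qed.

Lemma conj_poissonN a u : q a (- u) = - q a u.
Proof. by rewrite /q sqrrN mulNr. Qed.

Lemma kernel_decay a u : 0 < a ->
  (`|u| + a) / (u ^+ 2 + a ^+ 2) <= 2 / (`|u| + a).
Proof.
move=> a0; have h := sqrD_gt0 u a0; have u0 := normr_ge0 u.
rewrite ler_pdivrMr// mulrAC ler_pdivlMr; last by rewrite ltr_wpDl.
rewrite -(@real_normK _ u) ?num_real//. have : 0 <= (`|u| - a) ^+ 2 by exact: sqr_ge0. rewrite !expr2. nra.
Qed.

Lemma conj_poisson_decay a u : 0 < a -> `|q a u| <= 2 / (`|u| + a).
Proof.
move=> a0; apply: le_trans (kernel_decay u a0).
rewrite normrM normfV [X in _ / X]ger0_norm; last exact/ltW/sqrD_gt0.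
by rewrite ler_pM2r ?invr_gt0 ?sqrD_gt0// lerDl ltW.
Qed.

Lemma poisson_decay a u : 0 < a -> `|p a u| <= 2 / (`|u| + a).
Proof.
move=> a0; apply: le_trans (kernel_decay u a0).
rewrite normrM normfV [X in _ / X]ger0_norm; last exact/ltW/sqrD_gt0.
by rewrite ler_pM2r ?invr_gt0 ?sqrD_gt0// gtr0_norm// lerDr.
Qed.

(** Absorbs the scale a and a translation by at most c, so that all kernels
    can be compared with 1 / (1 + |x|). *)
Definition decay_cst a c := 2 * (1 + (1 + c) / a).

Lemma decay_shift a c x u : 0 < a -> 0 <= c -> `|x| <= `|u| + c ->
  2 / (`|u| + a) <= decay_cst a c / (1 + `|x|).
Proof.
move=> a0 c0 xu; have u0 := normr_ge0 u; have x0 := normr_ge0 x.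
have ua : 0 < `|u| + a by rewrite ltr_wpDl.
have x1 : 0 < 1 + `|x| by rewrite ltr_pwDl.
rewrite ler_pdivrMr// mulrAC ler_pdivlMr// /decay_cst.
have -> : 2 * (1 + (1 + c) / a) * (`|u| + a) =
  2 * (`|u| + a + (1 + c) * (`|u| / a) + (1 + c)).
  by field; rewrite gt_eqF.
have : 0 <= `|u| / a by rewrite divr_ge0// ltW.
nra.
Qed.

Lemma decay_cst_ge0 a c : 0 < a -> 0 <= c -> 0 <= decay_cst a c.
Proof.
by move=> a0 c0; rewrite mulr_ge0// addr_ge0// divr_ge0 ?addr_ge0// ltW.
Qed.

Lemma Qk_decay sg a c x t : `|sg| = 1 -> 0 < a -> 0 <= c -> `|t| <= c ->
  `|Qk sg a x t| <= 2 * decay_cst a c / (1 + `|x|).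
Proof.
move=> sg1 a0 c0 tc; rewrite -mulrA mulr2n mulrDl mul1r.
apply: le_trans (ler_normD _ _) _.
rewrite [`|sg * _|]normrM sg1 mul1r; apply: lerD.
- apply: le_trans (conj_poisson_decay _ a0) (decay_shift a0 c0 _).
  by rewrite -lerBlDr (le_trans _ (lerB_dist _ _))// lerB.
- apply: le_trans (conj_poisson_decay _ a0) (decay_shift a0 c0 _).
  rewrite -[x in `|x|](addrK t) (le_trans (ler_normB _ _))//.
  by rewrite lerD2l.
Qed.

Lemma Pk_decay sg a c x t : `|sg| = 1 -> 0 < a -> 0 <= c -> `|t| <= c ->
  `|Pk sg a x t| <= 2 * decay_cst a c / (1 + `|x|).
Proof.
move=> sg1 a0 c0 tc; rewrite -mulrA mulr2n mulrDl mul1r.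
apply: le_trans (ler_normD _ _) _.
rewrite [`|sg * _|]normrM sg1 mul1r; apply: lerD.
- apply: le_trans (poisson_decay _ a0) (decay_shift a0 c0 _).
  by rewrite -lerBlDr (le_trans _ (lerB_dist _ _))// lerB.
- apply: le_trans (poisson_decay _ a0) (decay_shift a0 c0 _).
  rewrite -[x in `|x|](addrK t) (le_trans (ler_normB _ _))//.
  by rewrite lerD2l.
Qed.

Lemma is_derive_ln_sqr a s x : 0 < a ->
  is_derive x 1 (fun x => ln ((x - s) ^+ 2 + a ^+ 2)) (2 * q a (x - s)).
Proof.
move=> a0.
have h := sqrD_gt0 (x - s) a0.
have dl := is_derive1_ln h.
have dg : is_derive x 1 (fun x => (x - s) ^+ 2 + a ^+ 2) (2 * (x - s)).
  apply: is_derive_eq. rewrite /GRing.scale/=; ring.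
have H := @is_derive1_comp _ (@ln R) (fun x => (x - s) ^+ 2 + a ^+ 2) x _ _ dl dg. rewrite /comp in H. apply: (@is_derive_eq _ _ _ _ _ _ _ _ H).
by rewrite /q; field; rewrite gt_eqF.
Qed.

Lemma is_derive_atan_div a s x : 0 < a ->
  is_derive x 1 (fun x => atan ((x - s) / a)) (p a (x - s)).
Proof.
move=> a0.
have dl := is_derive1_atan ((x - s) / a).
have dg : is_derive x 1 (fun x => (x - s) / a) a^-1.
  apply: is_derive_eq; rewrite /GRing.scale/=; ring.
have H := @is_derive1_comp _ (@atan R) (fun x => (x - s) / a) x _ _ dl dg. rewrite /comp in H. apply: (@is_derive_eq _ _ _ _ _ _ _ _ H).
have h := sqrD_gt0 (x - s) a0.
by rewrite /p; field; rewrite !gt_eqF.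
Qed.

Lemma cvg_pinfty_inv : x^-1 @[x --> +oo] --> (0 : R).
Proof.
apply/gtr0_cvgV0; first exact: nbhs_pinfty_gt.
exact: cvg_id.
Qed.

(** Subtracting 2 ln x makes each logarithm of the primitive below converge on
    its own. *)
Lemma ln_sqr_asymptotic a s : 0 < a ->
  ln ((x - s) ^+ 2 + a ^+ 2) - 2 * ln x @[x --> +oo] --> 0.
Proof.
move=> a0.
have h : ln ((1 - s * x^-1) ^+ 2 + (a * x^-1) ^+ 2) @[x --> +oo] --> 0.
  rewrite -(@ln1 R); apply: continuous_cvg; first exact: continuous_ln.
  rewrite [X in _ --> X](_ : 1 = (1 - s * 0) ^+ 2 + (a * 0) ^+ 2); last ring.
  have hs : 1 - s * x^-1 @[x --> +oo] --> 1 - s * 0.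
    by apply: cvgB; [exact: cvg_cst|apply: cvgM; [exact: cvg_cst|exact: cvg_pinfty_inv]].
  have ha : a * x^-1 @[x --> +oo] --> a * 0.
    by apply: cvgM; [exact: cvg_cst|exact: cvg_pinfty_inv].
  by apply: cvgD; rewrite expr2; under eq_fun do rewrite expr2; exact: cvgM.
apply: cvg_trans h; apply: near_eq_cvg; near=> x.
have x0 : 0 < x by near: x; exact: nbhs_pinfty_gt.
rewrite (_ : 2 * ln x = ln (x ^+ 2)); last by rewrite lnXn// mulr_natl.
rewrite -ln_div ?posrE ?sqrD_gt0 ?exprn_gt0//; congr ln.
by field; rewrite gt_eqF.
Unshelve. all: by end_near. Qed.

Lemma cvg_atan_div a s : 0 < a -> atan ((x - s) / a) @[x --> +oo] --> pi / 2.
Proof.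
move=> a0; apply: (cvg_comp _ _ _ (@cvgy_atan R)).
by apply: gt0_cvgMly; [rewrite invr_gt0|exact: cvg_addrr].
Qed.

Lemma cvg_conj_poisson a : 0 < a -> q a x @[x --> +oo] --> 0.
Proof.
move=> a0; apply: (squeeze_cvgr _ (cvg_cst (0 : R)) cvg_pinfty_inv).
near=> x; have x0 : 0 < x by near: x; exact: nbhs_pinfty_gt.
apply/andP; split; first by apply: divr_ge0; apply: ltW => //; exact: sqrD_gt0.
rewrite /q ler_pdivrMr ?sqrD_gt0// mulrDr expr2 mulKf ?gt_eqF//.
by rewrite lerDl mulr_ge0 ?invr_ge0 ?sqr_ge0// ltW.
Unshelve. all: by end_near. Qed.

(** The real part of 1 / ((x - s + i a) (x - t + i b)), which extends to a
    holomorphic function of the upper half-plane with decay of order 2 at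
    infinity; its integral over the line is 0. *)
Definition herglotz a b s t x := q a (x - s) * q b (x - t) - p a (x - s) * p b (x - t).

(** Reflecting x replaces (s, t) by (- s, - t) and conjugates, so the
    integrals of the two functions over the half-line add up to the integral
    over the line. The primitives come from partial fractions; G 0 + H 0 = 0
    is the cancellation of the logarithms and arc tangents under the
    reflection. *)
Lemma herglotz_primitive a b s t : 0 < a -> 0 < b ->
  exists G H, [/\ forall x, is_derive x 1 G (herglotz a b s t x),
    forall x, is_derive x 1 H (herglotz a b (- s) (- t) x),
    G x @[x --> +oo] --> 0, H x @[x --> +oo] --> 0 & G 0 + H 0 = 0].
Proof.
move=> a0 b0.
pose d := s - t; pose e := b - a.
(* If the poles s - i a and t - i b coincide, the primitive is rational. *)
have [de0|de0] := eqVneq (d ^+ 2 + e ^+ 2) 0.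
  have d0 : d = 0 by apply/eqP; rewrite -sqrf_eq0; apply/eqP; have := sqr_ge0 d; have := sqr_ge0 e; lra.
  have e0 : e = 0 by apply/eqP; rewrite -sqrf_eq0; apply/eqP; have := sqr_ge0 d; have := sqr_ge0 e; lra.
  have -> : t = s by move: d0; rewrite /d; lra.
  have -> : b = a by move: e0; rewrite /e; lra.
  have dq u x : is_derive x 1 (fun x => - q a (x - u)) (herglotz a a u u x).
    have h := sqrD_gt0 (x - u) a0.
    have dd : is_derive x 1 (fun x => (x - u) ^+ 2 + a ^+ 2) (2 * (x - u)).
      by apply: is_derive_eq; rewrite /GRing.scale/=; ring.
    have h0 : (x - u) ^+ 2 + a ^+ 2 != 0 by rewrite gt_eqF.
    have dv := @is_deriveV _ (fun x => (x - u) ^+ 2 + a ^+ 2) x _ 1 h0 dd.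
    rewrite /q; apply: is_derive_eq.
    by rewrite /GRing.scale/= /herglotz /p /q; field.
  have lq u : - q a (x - u) @[x --> +oo] --> 0.
    have xu : x - u @[x --> +oo] --> +oo by exact: cvg_addrr.
    rewrite -[X in _ --> X]oppr0; apply: cvgN.
    apply: (cvg_comp _ _ xu); exact: cvg_conj_poisson.
  exists (fun x => - q a (x - s)), (fun x => - q a (x - - s)); split => //.
  by rewrite !sub0r !opprK conj_poissonN; ring.
pose G (s t : R) x := (s - t) / 2 * (ln ((x - s) ^+ 2 + a ^+ 2) - ln ((x - t) ^+ 2 + b ^+ 2)) +
   (b - a) * (atan ((x - t) / b) - atan ((x - s) / a)).
(* The squared distance of the two poles. *)
pose D (s t : R) := (s - t) ^+ 2 + (b - a) ^+ 2.
have dG u v x : D u v != 0 ->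
  is_derive x 1 (fun x => (D u v)^-1 * G u v x) (herglotz a b u v x).
  move=> D0.
  have d1 := is_derive_ln_sqr u x a0.
  have d2 := is_derive_ln_sqr v x b0.
  have d3 := is_derive_atan_div u x a0.
  have d4 := is_derive_atan_div v x b0.
  have h1 := sqrD_gt0 (x - u) a0.
  have h2 := sqrD_gt0 (x - v) b0.
  rewrite /G; apply: is_derive_eq.
  rewrite /GRing.scale/= /herglotz /p /q.
  move: D0; rewrite /D => D0.
  by field; rewrite D0 !gt_eqF.
have lG u v : (D u v)^-1 * G u v x @[x --> +oo] --> 0.
  rewrite -[X in _ --> X](mulr0 (D u v)^-1); apply: cvgM; first exact: cvg_cst.
  rewrite [X in _ --> X](_ : 0 = (u - v) / 2 * (0 - 0) +
    (b - a) * (pi / 2 - pi / 2)); last by ring.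
  apply: cvgD; last first.
    by apply: cvgM; [exact: cvg_cst|apply: cvgB; exact: cvg_atan_div].
  apply: cvgM; first exact: cvg_cst.
  apply: cvg_trans (cvgB (ln_sqr_asymptotic u a0) (ln_sqr_asymptotic v b0)).
  apply: near_eq_cvg; apply: nearW => x /=.
  by rewrite !fctE; ring.
have DN : D (- s) (- t) = D s t by rewrite /D; ring.
exists (fun x => (D s t)^-1 * G s t x), (fun x => (D (-s) (-t))^-1 * G (-s) (-t) x).
split.
- by move=> x; apply: dG.
- by move=> x; apply: dG; rewrite DN.
- exact: lG.
- exact: lG.
- rewrite DN /G !sub0r !opprK !sqrrN !mulNr !atanN; ring.
Qed.

Lemma continuous_Qk sg a t : 0 < a -> continuous (Qk sg a ^~ t).
Proof.
move=> a0 x; apply: cvgD; first (apply: cvgM; first exact: cvg_cst).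
- apply: continuous_cvg; first exact: continuous_conj_poisson.
  by apply: cvgB; [exact: cvg_id|exact: cvg_cst].
- apply: continuous_cvg; first exact: continuous_conj_poisson.
  by apply: cvgD; [exact: cvg_id|exact: cvg_cst].
Qed.

Lemma continuous_Pk sg a t : 0 < a -> continuous (Pk sg a ^~ t).
Proof.
move=> a0 x; apply: cvgD; last (apply: cvgM; first exact: cvg_cst).
- apply: continuous_cvg; first exact: continuous_poisson.
  by apply: cvgB; [exact: cvg_id|exact: cvg_cst].
- apply: continuous_cvg; first exact: continuous_poisson.
  by apply: cvgD; [exact: cvg_id|exact: cvg_cst].
Qed.

(** Expanding the products leaves herglotz at (s, t) and (- s, - t), and sg
    times herglotz at (s, - t) and (- s, t). Each of the two pairs integrates
    to 0 by herglotz_primitive. *)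
Lemma kernels_isometry sg a b s t : sg ^+ 2 = 1 -> 0 < a -> 0 < b ->
  \int[@muP R]_x (Qk sg a x s * Qk sg b x t - Pk sg a x s * Pk sg b x t) = 0.
Proof.
move=> sg2 a0 b0.
have sg1 : `|sg| = 1 by apply/eqP; rewrite -sqr_norm_eq1 sg2.
have [G [H [dG dH lG lH GH]]] := herglotz_primitive s t a0 b0.
have [G' [H' [dG' dH' lG' lH' GH']]] := herglotz_primitive s (- t) a0 b0.
pose f x := Qk sg a x s * Qk sg b x t - Pk sg a x s * Pk sg b x t.
pose c := `|s| + `|t|.
have c0 : 0 <= c by rewrite addr_ge0.
have [sc tc] : `|s| <= c /\ `|t| <= c by split; rewrite ?lerDl ?lerDr.
pose C := 2 * (2 * decay_cst a c) * (2 * decay_cst b c).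
have [] := @integral_muP_derivative_dominated R f
  (fun x => (G x + H x) + sg * (G' x + H' x)) C 0.
- move=> x; rewrite /f; apply: le_trans (ler_normB _ _) _; rewrite !normrM.
  have y0 : 0 < 1 + `|x| by rewrite ltr_pwDl.
  have h1 := Qk_decay x sg1 a0 c0 sc; have h2 := Qk_decay x sg1 b0 c0 tc.
  have h3 := Pk_decay x sg1 a0 c0 sc; have h4 := Pk_decay x sg1 b0 c0 tc.
  have D1 := decay_cst_ge0 a0 c0. have D2 := decay_cst_ge0 b0 c0.
  apply: (@le_trans _ _ (C / (1 + `|x|) ^+ 2)).
    have := ler_pM (normr_ge0 _) (normr_ge0 _) h1 h2.
    have := ler_pM (normr_ge0 _) (normr_ge0 _) h3 h4.
    rewrite [X in _ -> _ -> _ <= X](_ : _ = 2 * decay_cst a c / (1 + `|x|) * (2 * decay_cst b c / (1 + `|x|)) + 2 * decay_cst a c / (1 + `|x|) * (2 * decay_cst b c / (1 + `|x|))); first by lra.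
    by rewrite /C; field; rewrite gt_eqF.
  apply: ler_wpM2l; first by have := mulr_ge0 D1 D2; rewrite /C; lra.
  rewrite lef_pV2 ?posrE ?exprn_gt0//; last by rewrite ltr_pwDl ?sqr_ge0.
  by rewrite -(@real_normK _ x) ?num_real//; have := normr_ge0 x; nra.
- move=> x; rewrite /f; apply: cvgB; apply: cvgM; (exact: continuous_Qk || exact: continuous_Pk).
- move=> x; have h1 := dG x; have h2 := dH x; have h3 := dG' x; have h4 := dH' x.
  apply: is_derive_eq; rewrite /GRing.scale/= /f /herglotz /Qk /Pk !opprK.
  have [->|->] : sg = 1 \/ sg = -1
    by move/eqP: sg2; rewrite sqrf_eq1 => /orP[]/eqP; [left|right].
  - ring.
  - ring.
- have -> : 0 = (0 + 0) + sg * (0 + 0) :> R by ring.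
  by apply: cvgD; [exact: cvgD|apply: cvgM; [exact: cvg_cst|exact: cvgD]].
by move=> _ ->; rewrite GH GH' mulr0 addr0 subr0.
Qed.

End kernels.

(** * Fubini and dominated convergence for real-valued integrals *)

Lemma fine_integral d (T : measurableType d) (R : realType)
    (m : {measure set T -> \bar R}) (g : T -> \bar R) :
  m.-integrable setT g -> fine (\int[m]_x g x)%E = \int[m]_x fine (g x).
Proof.
move=> ig; rewrite /Rintegral; congr fine; apply: ae_eq_integral => //.
- exact: measurable_int ig.
- by apply: measurableT_comp => //; apply: measurableT_comp; [exact: fine_measurable|exact: measurable_int ig].
- by have := integrable_ae measurableT ig; apply: filterS => x /(_ I) gx _; rewrite fineK.
Qed.

Section real_fubini.
Context d1 d2 (T1 : measurableType d1) (T2 : measurableType d2) (R : realType).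
Variable m1 : {sigma_finite_measure set T1 -> \bar R}.
Variable m2 : {sigma_finite_measure set T2 -> \bar R}.

Lemma measurable_Rintegral1 (F : T1 * T2 -> R) : measurable_fun setT F ->
  measurable_fun setT (fun x => \int[m2]_y F (x, y)).
Proof.
move=> mF; apply: measurableT_comp; first exact: fine_measurable.
have mE : measurable_fun setT (EFin \o F) by exact/measurable_EFinP.
rewrite (_ : (fun x => _) = (fun x => (\int[m2]_y (EFin \o F)^\+ (x, y) -
    \int[m2]_y (EFin \o F)^\- (x, y))%E)); last first.
  apply/funext => x; rewrite [LHS]integralE; congr (_ - _)%E; apply: eq_integral => y _; first by rewrite !funeposE. by rewrite !funenegE.
apply: emeasurable_funB.
- apply: (measurable_fun_fubini_tonelli_F ((EFin \o F)^\+)%E) => //.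
  exact: measurable_funepos.
- apply: (measurable_fun_fubini_tonelli_F ((EFin \o F)^\-)%E) => //.
  exact: measurable_funeneg.
Qed.

Lemma Rintegral_Fubini (F : T1 * T2 -> R) :
  (m1 \x m2)%E.-integrable setT (EFin \o F) ->
  \int[m1]_x \int[m2]_y F (x, y) = \int[m2]_y \int[m1]_x F (x, y).
Proof.
move=> iF.
transitivity (fine (\int[m1]_x fubini_F m2 (EFin \o F) x)).
  by rewrite fine_integral//; exact: integrable_fubini_F.
transitivity (fine (\int[m2]_y fubini_G m1 (EFin \o F) y)).
  by congr fine; exact: Fubini.
rewrite fine_integral//.
have mE := measurable_int _ iF.
pose F' z := (EFin \o F) (z.2, z.1).
have mF' : measurable_fun setT F'.
  by apply: (measurableT_comp mE); exact: measurable_fun_pair.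
apply: (@integrable_fubini_F _ _ _ _ _ m2 m1 F').
by apply/integrable12ltyP => //; exact: ((integrable21ltyP m1 m2 mE).1 iF).
Qed.

Lemma integrable_prod_dominated (F : T1 * T2 -> R) (M : T1 -> R) (B : T2 -> R) :
  measurable_fun setT F ->
  m1.-integrable setT (EFin \o M) -> m2.-integrable setT (EFin \o B) ->
  (forall x y, `|F (x, y)| <= M x * B y) ->
  (m1 \x m2)%E.-integrable setT (EFin \o F).
Proof.
move=> mF iM iB FMB; apply/integrable12ltyP; first exact/measurable_EFinP.
have [mM Moo] := integrableP _ _ _ iM. have [mB Boo] := integrableP _ _ _ iB.
apply: (@le_lt_trans _ _ (\int[m1]_x (`|(M x)%:E| * \int[m2]_y `|(B y)%:E|))%E).
  apply: ge0_le_integral => //.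
  - by move=> x _; exact: integral_ge0.
  - apply: (measurable_fun_fubini_tonelli_F (abse \o (EFin \o F))) => //.
      by apply: measurableT_comp => //; exact/measurable_EFinP.
    by move=> z; exact: abse_ge0.
  - by apply: emeasurable_funM => //; exact: measurableT_comp.
  move=> x _.
  rewrite -ge0_integralZl//; last exact: measurableT_comp.
  apply: ge0_le_integral => //.
  - by apply: measurableT_comp => //; apply/measurable_EFinP; exact: measurableT_comp.
  - by apply: measurable_funeM; exact: measurableT_comp.
  - by move=> y _; rewrite -abseM -EFinM lee_fin (le_trans (FMB x y)) ?ler_norm.
rewrite ge0_integralZr//; last 2 first.
- exact: measurableT_comp.
- exact: integral_ge0.
by apply: lte_mul_pinfty => //; [exact: integral_ge0|rewrite ge0_fin_numE ?integral_ge0].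
Qed.

End real_fubini.

Section double_form.
Context d1 d2 (T1 : measurableType d1) (T2 : measurableType d2) (R : realType).
Variable m : {sigma_finite_measure set T1 -> \bar R}.
Variable n : {sigma_finite_measure set T2 -> \bar R}.

(** Square integrability of M makes the triple integral converge absolutely,
    which justifies both exchanges of integrals. *)
Lemma Rintegral_mul_Rintegral (k h : T1 * T2 -> R) (M : T1 -> R) (B : T2 -> R) :
  measurable_fun setT k -> measurable_fun setT h -> measurable_fun setT M ->
  m.-integrable setT (fun x => (M x ^+ 2)%:E) -> n.-integrable setT (EFin \o B) ->
  (forall x s, `|k (x, s)| <= M x * B s) ->
  (forall x s, `|h (x, s)| <= M x * B s) ->
  \int[m]_x ((\int[n]_s k (x, s)) * (\int[n]_t h (x, t))) =
  \int[n]_s \int[n]_t \int[m]_x (k (x, s) * h (x, t)).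
Proof.
move=> mk mh mM iM iB kB hB.
have sec (g : T1 * T2 -> R) : measurable_fun setT g ->
    (forall x s, `|g (x, s)| <= M x * B s) ->
    forall x, n.-integrable setT (EFin \o (fun s => g (x, s))).
  move=> mg gB x.
  apply: (le_integrable measurableT _ _ (integrableZl measurableT (M x) iB)).
    by apply/measurable_EFinP; exact: measurableT_comp.
  by move=> s _; rewrite lee_fin (le_trans (gB x s)) ?ler_norm.
pose H x := \int[n]_t h (x, t).
have mH : measurable_fun setT H by exact: measurable_Rintegral1.
have HM x : `|H x| <= M x * \int[n]_t B t.
  rewrite -RintegralZl//; apply: le_trans (le_normr_Rintegral measurableT (sec _ mh hB x)) _.
  apply: le_Rintegral => //.
  - by apply: integrable_norm; exact: sec.
  - exact: (integrableZl measurableT (M x) iB).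
transitivity (\int[m]_x \int[n]_s (k (x, s) * H x)).
  by apply: eq_Rintegral => x _; rewrite RintegralZr//; exact: sec.
rewrite (@Rintegral_Fubini _ _ _ _ _ m n (fun z => k z * H z.1)); last first.
  apply: (@integrable_prod_dominated _ _ _ _ _ m n _ (fun x => M x ^+ 2)
    (fun s => B s * \int[n]_t B t)) => //.
  - by apply: measurable_funM => //; exact: measurableT_comp.
  - exact: (integrableZr measurableT _ iB).
  - move=> x s; rewrite normrM expr2 mulrACA.
    exact: ler_pM.
apply: eq_Rintegral => s _ /=.
transitivity (\int[m]_x \int[n]_t (k (x, s) * h (x, t))).
  by apply: eq_Rintegral => x _; rewrite RintegralZl//; exact: sec.
apply: (@Rintegral_Fubini _ _ _ _ _ m n (fun z => k (z.1, s) * h z)).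
apply: (@integrable_prod_dominated _ _ _ _ _ m n _ (fun x => M x ^+ 2)
    (fun t => B s * B t)) => //.
- apply: measurable_funM => //.
  by apply: (measurableT_comp mk); exact: measurable_fun_pair.
- exact: (integrableZl measurableT _ iB).
- move=> x t; rewrite normrM expr2 mulrACA.
  exact: ler_pM.
Qed.

End double_form.

Section Rdominated.
Context d (T : measurableType d) (R : realType) (m : {measure set T -> \bar R}).

Lemma Rintegral_dominated (g_ : nat -> T -> R) (g M : T -> R) :
  (forall n, measurable_fun setT (g_ n)) -> measurable_fun setT g ->
  {ae m, forall x, g_ n x @[n --> \oo] --> g x} ->
  m.-integrable setT (EFin \o M) ->
  {ae m, forall x, forall n, `|g_ n x| <= M x} ->
  m.-integrable setT (EFin \o g) /\
  (\int[m]_x g_ n x) @[n --> \oo] --> \int[m]_x g x.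
Proof.
move=> mg_ mg gg iM gM.
have h1 n : measurable_fun setT (EFin \o g_ n) by exact/measurable_EFinP.
have h2 : measurable_fun setT (EFin \o g) by exact/measurable_EFinP.
have h3 : {ae m, forall x, setT x -> (EFin \o g_ n) x @[n --> \oo] --> (EFin \o g) x}.
  by apply: filterS gg => x gx _; apply: cvg_EFin => //; exact: nearW.
have h5 : {ae m, forall x n, setT x -> (`|(EFin \o g_ n) x| <= (EFin \o M) x)%E}.
  by apply: filterS gM => x gx n _; rewrite lee_fin.
have [ig _ cg] := dominated_convergence measurableT h1 h2 h3 iM h5.
split => //; apply: fine_cvg; rewrite fineK//.
exact: (integrable_fin_num measurableT ig).
Qed.

End Rdominated.

(** * The isometry on bounded functions of compact support *)

Section operators.
Context {R : realType}.
Local Notation muP := (@muP R).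
Implicit Types (a b c s t u x sg : R) (f g phi : R -> R).

Lemma measurable_Qk sg a : 0 < a -> measurable_fun setT (fun z : R * R => Qk sg a z.1 z.2).
Proof.
move=> a0; have mq := continuous_measurable_fun (continuous_conj_poisson a0).
apply: measurable_funD; first apply: measurable_funM => //.
- by apply: (measurableT_comp mq); exact: measurable_funB.
- by apply: (measurableT_comp mq); exact: measurable_funD.
Qed.

Lemma measurable_Pk sg a : 0 < a -> measurable_fun setT (fun z : R * R => Pk sg a z.1 z.2).
Proof.
move=> a0; have mp := continuous_measurable_fun (continuous_poisson a0).
apply: measurable_funD; last apply: measurable_funM => //.
- by apply: (measurableT_comp mp); exact: measurable_funB.
- by apply: (measurableT_comp mp); exact: measurable_funD.
Qed.

(** Square integrable but not integrable: enough for inner products. *)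
Definition decay (D x : R) := D / (1 + `|x|).

Lemma measurable_decay D : measurable_fun setT (decay D).
Proof.
apply: continuous_measurable_fun => x; apply: cvgM; first exact: cvg_cst.
apply: cvgV; first by rewrite gt_eqF// ltr_pwDl.
by apply: cvgD; [exact: cvg_cst|exact: norm_continuous].
Qed.

Lemma integrable_decay_sqr D : muP.-integrable setT (fun x => (decay D x ^+ 2)%:E).
Proof.
have mD := measurable_decay D.
pose f x : R := D ^+ 2 / (1 + x ^+ 2).
have pos x : 0 < 1 + x ^+ 2 :> R by rewrite ltr_pwDl// sqr_ge0.
have cf : continuous f.
  move=> x; apply: cvgM; first exact: cvg_cst.
  apply: cvgV; first by rewrite gt_eqF.
  by apply: cvgD; [exact: cvg_cst|exact: exprn_continuous].
have fb x : `|f x| <= D ^+ 2 / (1 + x ^+ 2).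
  by rewrite ger0_norm// divr_ge0 ?sqr_ge0// ltW.
have df (x : R) : is_derive x 1 (fun x => D ^+ 2 * atan x) (f x).
  by apply: is_derive_eq.
have lf : D ^+ 2 * atan x @[x --> +oo] --> D ^+ 2 * (pi / 2).
  by apply: cvgM; [exact: cvg_cst|exact: cvgy_atan].
have [if_ _] := integral_muP_derivative_dominated fb cf df lf.
apply: (le_integrable measurableT _ _ if_).
  by apply/measurable_EFinP; exact: measurable_funX.
move=> x _; rewrite lee_fin ger0_norm ?sqr_ge0// ger0_norm; last first.
  by rewrite divr_ge0 ?sqr_ge0// ltW.
rewrite /decay expr_div_n; apply: ler_wpM2l; first exact: sqr_ge0.
have y0 : 0 < 1 + `|x| by rewrite ltr_pwDl.
rewrite lef_pV2 ?posrE ?exprn_gt0//.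
by rewrite -(@real_normK _ x) ?num_real//; have := normr_ge0 x; nra.
Qed.

(** Bounded functions with compact support in R_+, a dense class in L_2(R_+);
    one parameter serves both the bound and the support. *)
Definition nice c phi := [/\ 1 <= c, measurable_fun setT phi,
  forall x, `|phi x| <= c & forall x, phi x != 0 -> c^-1 <= x <= c].

Definition box c t : R := c * \1_`[0, c] t.

Lemma integrable_box c : muP.-integrable setT (EFin \o box c).
Proof.
apply: integrable_muP.
  by apply/measurable_EFinP; apply: measurable_funM => //; exact: measurable_indic.
apply: (integrableS measurableT) => //.
exact: (integrableZl measurableT c (integrable_indic_itv 0 c _ _)).
Qed.

Lemma nice_box c phi t : nice c phi -> `|phi t| <= box c t.
Proof.
move=> [c1 _ phic supp]; have c0 : 0 < c by rewrite (lt_le_trans _ c1).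
have [->|/supp/andP[t0 tc]] := eqVneq (phi t) 0.
  by rewrite normr0 mulr_ge0// ltW.
rewrite /box indicE mem_set ?mulr1//= in_itv/= tc andbT (le_trans _ t0)//.
by rewrite invr_ge0 ltW.
Qed.

Lemma nice_supp c phi t : nice c phi -> t <= 0 -> phi t = 0.
Proof.
move=> [c1 _ _ supp] t0; apply/eqP; apply: contraT => /supp/andP[ct _].
have := lt_le_trans (_ : 0 < c^-1) ct; rewrite invr_gt0 (lt_le_trans _ c1)//.
by move=> /(_ isT); rewrite ltNge t0.
Qed.

Lemma nice_decay c phi x : nice c phi -> `|phi x| <= decay (c * (1 + c)) x.
Proof.
move=> [c1 _ phic supp]; have c0 : 0 <= c by rewrite (le_trans _ c1).
have x1 : 0 < 1 + `|x| by rewrite ltr_pwDl.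
rewrite /decay ler_pdivlMr//; have [->|/supp/andP[x0 xc]] := eqVneq (phi x) 0.
  by rewrite normr0 mul0r mulr_ge0// addr_ge0.
apply: ler_pM => //.
by rewrite lerD2l ger0_norm// (le_trans _ x0)// invr_ge0.
Qed.

Lemma nice_integrable c phi : nice c phi -> muP.-integrable setT (EFin \o phi).
Proof.
move=> np; have [_ mphi _ _] := np.
apply: (le_integrable measurableT _ _ (integrable_box c)); first exact/measurable_EFinP.
by move=> t _; rewrite lee_fin (le_trans (nice_box t np))// ler_norm.
Qed.

Lemma box_ge0 c t : 0 <= c -> 0 <= box c t.
Proof. by move=> c0; exact: mulr_ge0. Qed.

Lemma nice_kernel c phi (K : R -> R -> R) D x t : nice c phi ->
  (forall x t, `|t| <= c -> `|K x t| <= decay D x) ->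
  `|K x t * phi t| <= decay D x * box c t.
Proof.
move=> np KD; have := np => -[c1 _ phic supp].
have c0 : 0 < c by rewrite (lt_le_trans _ c1).
have [pt0|nz] := eqVneq (phi t) 0.
  rewrite pt0 mulr0 normr0; apply: mulr_ge0; last by rewrite (le_trans _ (nice_box t np)).
  by apply: le_trans (KD x 0 _) => //; rewrite normr0 ltW.
have /andP[t0 tc] := supp _ nz.
rewrite normrM ler_pM//; last exact: nice_box.
by apply: KD; rewrite ger0_norm// (le_trans _ t0)// invr_ge0 ltW.
Qed.

(** With the factor 1 / pi the Poisson operators have norm at most 1. *)
Definition op (K : R -> R -> R) f x := pi^-1 * \int[muP]_t (K x t * f t).

Lemma measurable_op (K : R -> R -> R) f : measurable_fun setT (fun z : R * R => K z.1 z.2) ->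
  measurable_fun setT f -> measurable_fun setT (op K f).
Proof.
move=> mK mf; apply: measurable_funM => //.
apply: (@measurable_Rintegral1 _ _ _ _ R muP (fun z => K z.1 z.2 * f z.2)).
by apply: measurable_funM => //; exact: measurableT_comp.
Qed.

Lemma measurable_section (K : R -> R -> R) x :
  measurable_fun setT (fun z : R * R => K z.1 z.2) -> measurable_fun setT (K x).
Proof.
move=> mK; have mx : measurable_fun setT (fun t : R => (x, t)) by exact: measurable_fun_pair.
exact: (measurableT_comp mK mx).
Qed.

Lemma integrable_nice_kernel c phi (K : R -> R -> R) D x : nice c phi ->
  measurable_fun setT (fun z : R * R => K z.1 z.2) ->
  (forall x t, `|t| <= c -> `|K x t| <= decay D x) ->
  muP.-integrable setT (fun t => (K x t * phi t)%:E).
Proof.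
move=> np mK KD; have [_ mphi _ _] := np.
apply: (le_integrable measurableT _ _ (integrableZl measurableT (decay D x) (integrable_box c))).
  apply/measurable_EFinP; apply: measurable_funM => //.
  exact: measurable_section.
move=> t _; rewrite lee_fin (le_trans (nice_kernel x t np KD))//.
exact: ler_norm.
Qed.

Lemma op_decay c phi (K : R -> R -> R) D x : nice c phi ->
  measurable_fun setT (fun z : R * R => K z.1 z.2) ->
  (forall x t, `|t| <= c -> `|K x t| <= decay D x) ->
  `|op K phi x| <= decay (pi^-1 * D * \int[muP]_t box c t) x.
Proof.
move=> np mK KD; have ik := integrable_nice_kernel x np mK KD.
rewrite /op normrM ger0_norm ?invr_ge0 ?pi_ge0//.
rewrite /decay -!mulrA ler_wpM2l ?invr_ge0 ?pi_ge0//.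
rewrite [X in D * X]mulrC mulrA -/(decay D x).
apply: le_trans (le_normr_Rintegral measurableT ik) _.
rewrite -RintegralZl//; last exact: integrable_box.
apply: le_Rintegral => //.
- exact: integrable_norm.
- exact: (integrableZl measurableT _ (integrable_box c)).
- by move=> t _; exact: nice_kernel.
Qed.

Lemma integrableM_decay f g D : measurable_fun setT f -> measurable_fun setT g ->
  (forall x, `|f x| <= decay D x) -> (forall x, `|g x| <= decay D x) ->
  muP.-integrable setT (fun x => (f x * g x)%:E).
Proof.
move=> mf mg fD gD; apply: (le_integrable measurableT _ _ (integrable_decay_sqr D)).
  by apply/measurable_EFinP; exact: measurable_funM.
by move=> x _; rewrite lee_fin normrM [leRHS]ger0_norm ?sqr_ge0// expr2 ler_pM.
Qed.

(** Fubini reduces an inner product of two operators to inner products of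
    their kernels. *)
Lemma double_form c phi (K L : R -> R -> R) D : nice c phi ->
  measurable_fun setT (fun z : R * R => K z.1 z.2) ->
  measurable_fun setT (fun z : R * R => L z.1 z.2) ->
  (forall x t, `|t| <= c -> `|K x t| <= decay D x) ->
  (forall x t, `|t| <= c -> `|L x t| <= decay D x) ->
  \int[muP]_x (op K phi x * op L phi x) =
  pi ^- 2 * \int[muP]_s \int[muP]_t \int[muP]_x (K x s * phi s * (L x t * phi t)).
Proof.
move=> np mK mL KD LD; have [_ mphi _ _] := np.
have mKp (K' : R -> R -> R) : measurable_fun setT (fun z : R * R => K' z.1 z.2) ->
    measurable_fun setT (fun z : R * R => K' z.1 z.2 * phi z.2).
  by move=> mK'; apply: measurable_funM => //; exact: measurableT_comp.
rewrite -(@Rintegral_mul_Rintegral _ _ _ _ R muP muP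
  (fun z => K z.1 z.2 * phi z.2) (fun z => L z.1 z.2 * phi z.2) (decay D) (box c)); first last.
- by move=> x s; exact: nice_kernel.
- by move=> x s; exact: nice_kernel.
- exact: integrable_box.
- exact: integrable_decay_sqr.
- exact: measurable_decay.
- exact: mKp.
- exact: mKp.
pose D' := pi^-1 * D * \int[muP]_t box c t.
have iKL := integrableM_decay (measurable_op mK mphi) (measurable_op mL mphi)
  (fun x => op_decay x np mK KD) (fun x => op_decay x np mL LD).
have e x : op K phi x * op L phi x = pi ^- 2 *
    ((\int[muP]_s (K x s * phi s)) * (\int[muP]_s (L x s * phi s))).
  by rewrite /op -exprVn expr2; ring.
rewrite -RintegralZl//; first by apply: eq_Rintegral => x _; rewrite e.
have := integrableZl measurableT (pi ^+ 2) iKL; apply: eq_integrable => //.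
by move=> x _; rewrite /= -EFinM e mulrA mulfV ?mul1r// expf_neq0// gt_eqF// pi_gt0.
Qed.

Lemma decay_le D D' x : D' <= D -> decay D' x <= decay D x.
Proof. by move=> DD; rewrite ler_pM2r// invr_gt0 ltr_pwDl. Qed.

(** This is kernels_isometry integrated against phi s * phi t. *)
Lemma op_isometry sg a b c phi : sg ^+ 2 = 1 -> 0 < a -> 0 < b -> nice c phi ->
  \int[muP]_x (op (Qk sg a) phi x * op (Qk sg b) phi x) =
  \int[muP]_x (op (Pk sg a) phi x * op (Pk sg b) phi x).
Proof.
move=> sg2 a0 b0 np; have := np => -[c1 mphi phic supp].
have sg1 : `|sg| = 1 by apply/eqP; rewrite -sqr_norm_eq1 sg2.
have c0 : 0 <= c by rewrite (le_trans _ c1).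
pose D := 2 * decay_cst a c + 2 * decay_cst b c.
have Da : 2 * decay_cst a c <= D by have := decay_cst_ge0 b0 c0; rewrite /D; lra.
have Db : 2 * decay_cst b c <= D by have := decay_cst_ge0 a0 c0; rewrite /D; lra.
have QD e x t : 0 < e -> 2 * decay_cst e c <= D -> `|t| <= c -> `|Qk sg e x t| <= decay D x.
  by move=> e0 eD tc; apply: le_trans (decay_le _ eD); exact: Qk_decay.
have PD e x t : 0 < e -> 2 * decay_cst e c <= D -> `|t| <= c -> `|Pk sg e x t| <= decay D x.
  by move=> e0 eD tc; apply: le_trans (decay_le _ eD); exact: Pk_decay.
rewrite (double_form np (measurable_Qk sg a0) (measurable_Qk sg b0)
  (fun x t => @QD a x t a0 Da) (fun x t => @QD b x t b0 Db)).
rewrite (double_form np (measurable_Pk sg a0) (measurable_Pk sg b0)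
  (fun x t => @PD a x t a0 Da) (fun x t => @PD b x t b0 Db)).
apply: (congr1 (fun z => pi ^- 2 * z)).
apply: eq_Rintegral => s _.
apply: eq_Rintegral => t _.
have [->|ps] := eqVneq (phi s) 0.
  by under eq_Rintegral do rewrite mulr0 mul0r; under [RHS]eq_Rintegral do rewrite mulr0 mul0r.
have [->|pt] := eqVneq (phi t) 0.
  by under eq_Rintegral do rewrite !mulr0; under [RHS]eq_Rintegral do rewrite !mulr0.
have bd u : phi u != 0 -> `|u| <= c.
  by move=> /supp /andP[u0 uc]; rewrite ger0_norm// (le_trans _ u0)// invr_ge0.
have iQ : muP.-integrable setT (fun x => (Qk sg a x s * Qk sg b x t)%:E).
  apply: (@integrableM_decay _ _ D); do ?(apply: continuous_measurable_fun; exact: continuous_Qk).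
  - by move=> x; apply: QD => //; exact: bd.
  - by move=> x; apply: QD => //; exact: bd.
have iP : muP.-integrable setT (fun x => (Pk sg a x s * Pk sg b x t)%:E).
  apply: (@integrableM_decay _ _ D); do ?(apply: continuous_measurable_fun; exact: continuous_Pk).
  - by move=> x; apply: PD => //; exact: bd.
  - by move=> x; apply: PD => //; exact: bd.
have := kernels_isometry s t sg2 a0 b0; rewrite RintegralB// => /eqP.
rewrite subr_eq0 => /eqP QP.
transitivity (phi s * phi t * \int[muP]_x (Qk sg a x s * Qk sg b x t)).
  by rewrite -RintegralZl//; apply: eq_Rintegral => x _; ring.
by rewrite QP -RintegralZl//; apply: eq_Rintegral => x _; ring.
Qed.

End operators.

(** * Poisson operators are contractions *)

Section poisson_operator.
Context {R : realType}.
Local Notation muP := (@muP R).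
Implicit Types (a b c s t u x sg : R) (f g phi : R -> R).

Lemma PkC sg a x t : Pk sg a x t = Pk sg a t x.
Proof. by rewrite /Pk -opprB poissonN [x + t]addrC. Qed.

Lemma Pk1_ge0 a x t : 0 < a -> 0 <= Pk 1 a x t.
Proof. by move=> a0; rewrite /Pk mul1r addr_ge0// poisson_ge0. Qed.

Lemma Pk_le1 sg a x t : `|sg| = 1 -> 0 < a -> `|Pk sg a x t| <= Pk 1 a x t.
Proof.
move=> sg1 a0; rewrite /Pk mul1r; apply: le_trans (ler_normD _ _) _.
by rewrite [`|sg * _|]normrM sg1 mul1r !ger0_norm// poisson_ge0.
Qed.

(** Reflecting t turns this into the integral of the Poisson kernel over the
    line. *)
Lemma integral_Pk1 a x : 0 < a -> (\int[muP]_t (Pk 1 a x t)%:E = pi%:E)%E.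
Proof.
move=> a0.
pose F t : R := atan ((t - x) / a) + atan ((t - - x) / a).
have cP : continuous (Pk 1 a x).
  have -> : Pk 1 a x = Pk 1 a ^~ x by apply/funext => t; rewrite PkC.
  exact: continuous_Pk.
have dF t : is_derive t 1 F (Pk 1 a x t).
  have d1 := is_derive_atan_div x t a0; have d2 := is_derive_atan_div (- x) t a0.
  rewrite PkC /Pk mul1r -[X in _ + poisson a (_ + X)]opprK.
  exact: is_deriveD.
have lF : F t @[t --> +oo] --> pi / 2 + pi / 2.
  by apply: cvgD; exact: cvg_atan_div.
rewrite (integral_muP_derivative (fun t => Pk1_ge0 x t a0) cP dF lF).
by rewrite /F !sub0r opprK mulNr atanN; congr EFin; field.
Qed.

Lemma measurable_Pk_section sg a x : 0 < a -> measurable_fun setT (Pk sg a x).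
Proof. by move=> a0; apply: measurable_section; exact: measurable_Pk. Qed.

Lemma integrable_Pk1 a x : 0 < a -> muP.-integrable setT (EFin \o Pk 1 a x).
Proof.
move=> a0; apply/integrableP; split.
  by apply/measurable_EFinP; exact: measurable_Pk_section.
under eq_integral do rewrite /= ger0_norm ?Pk1_ge0//.
by rewrite integral_Pk1// ltry.
Qed.

Lemma Rintegral_Pk1 a x : 0 < a -> \int[muP]_t Pk 1 a x t = pi.
Proof. by move=> a0; rewrite /Rintegral integral_Pk1. Qed.

(** Squared norm of L_2(R_+), with value +oo outside that space. *)
Definition sqn f := (\int[muP]_x (f x ^+ 2)%:E)%E.

Lemma integrable_Pk1_bounded a c x f : 0 < a -> measurable_fun setT f ->
  (forall t, `|f t| <= c) -> muP.-integrable setT (fun t => (Pk 1 a x t * f t)%:E).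
Proof.
move=> a0 mf fc; apply: (le_integrable measurableT _ _ (integrableZr measurableT c (integrable_Pk1 x a0))).
  by apply/measurable_EFinP; apply: measurable_funM => //; exact: measurable_Pk_section.
move=> t _ /=; rewrite lee_fin !normrM ler_wpM2l// (le_trans (fc t))//.
exact: ler_norm.
Qed.

Lemma normr_opP_le sg a c phi x : `|sg| = 1 -> 0 < a -> nice c phi ->
  `|op (Pk sg a) phi x| <= pi^-1 * \int[muP]_t (Pk 1 a x t * `|phi t|).
Proof.
move=> sg1 a0 np; have [c1 mphi phic supp] := np.
have c0 : 0 <= c by rewrite (le_trans _ c1).
have mn : measurable_fun setT (fun t => `|phi t|) by exact: measurableT_comp.
have ik := integrable_nice_kernel x np (measurable_Pk sg a0)
  (fun x t => @Pk_decay _ sg a c x t sg1 a0 c0).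
rewrite /op normrM ger0_norm ?invr_ge0 ?pi_ge0// ler_wpM2l ?invr_ge0 ?pi_ge0//.
apply: le_trans (le_normr_Rintegral measurableT ik) _.
apply: le_Rintegral => //.
- exact: integrable_norm.
- by apply: (integrable_Pk1_bounded (c := c)) => // t; rewrite normr_id.
- by move=> t _; rewrite normrM ler_wpM2r//; exact: Pk_le1.
Qed.

(** Jensen's inequality for the probability density Pk 1 a x / pi: integrate
    (|phi t| - m)^2 >= 0, where m is the mean of |phi|. *)
Lemma sqr_opP_le sg a c phi x : `|sg| = 1 -> 0 < a -> nice c phi ->
  op (Pk sg a) phi x ^+ 2 <= pi^-1 * \int[muP]_t (Pk 1 a x t * phi t ^+ 2).
Proof.
move=> sg1 a0 np; have [c1 mphi phic supp] := np.
have c0 : 0 <= c by rewrite (le_trans _ c1).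
have mn : measurable_fun setT (fun t => `|phi t|) by exact: measurableT_comp.
have pi0 := pi_gt0 R.
have i1 : muP.-integrable setT (fun t => (Pk 1 a x t * `|phi t|)%:E).
  by apply: (integrable_Pk1_bounded (c := c)) => // t; rewrite normr_id.
have i2 : muP.-integrable setT (fun t => (Pk 1 a x t * phi t ^+ 2)%:E).
  apply: (integrable_Pk1_bounded (c := c ^+ 2)) => //.
    exact: measurable_funX.
  by move=> t; rewrite normrX ler_pXn2r ?nnegrE.
pose m := pi^-1 * \int[muP]_t (Pk 1 a x t * `|phi t|).
have := normr_opP_le x sg1 a0 np; rewrite -/m => hm.
apply: (@le_trans _ _ (m ^+ 2)).
  by rewrite -real_normK ?num_real// ler_pXn2r ?nnegrE// (le_trans _ hm).
have i3 : muP.-integrable setT (fun t => (2 * m * (Pk 1 a x t * `|phi t|))%:E).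
  exact: (integrableZl measurableT (2 * m) i1).
have i4 : muP.-integrable setT (fun t => (m ^+ 2 * Pk 1 a x t)%:E).
  exact: (integrableZl measurableT (m ^+ 2) (integrable_Pk1 x a0)).
have : \int[muP]_t (2 * m * (Pk 1 a x t * `|phi t|) - m ^+ 2 * Pk 1 a x t) <=
    \int[muP]_t (Pk 1 a x t * phi t ^+ 2).
  apply: le_Rintegral => //; first exact: (integrableB measurableT i3 i4).
  move=> t _; rewrite -(@real_normK _ (phi t)) ?num_real//.
  rewrite -subr_ge0 (_ : _ - _ = Pk 1 a x t * (`|phi t| - m) ^+ 2); last by ring.
  by rewrite mulr_ge0 ?sqr_ge0// Pk1_ge0.
rewrite RintegralB// RintegralZl// RintegralZl//; last exact: integrable_Pk1.
rewrite Rintegral_Pk1//.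
rewrite (_ : \int[muP]_t (Pk 1 a x t * `|phi t|) = pi * m); last first.
  by rewrite /m mulrA mulfV ?mul1r// gt_eqF.
move=> H; rewrite [leRHS]mulrC ler_pdivlMr// expr2; move: H; rewrite expr2; lra.
Qed.

(** Integrate sqr_opP_le in x: the kernel Pk 1 is symmetric, so its integral
    in x is again pi. *)
Lemma opP_contraction sg a c phi : `|sg| = 1 -> 0 < a -> nice c phi ->
  (sqn (op (Pk sg a) phi) <= sqn phi)%E.
Proof.
move=> sg1 a0 np; have [c1 mphi phic supp] := np.
have pi0 := pi_gt0 R.
pose F (z : R * R) : R := pi^-1 * (Pk 1 a z.1 z.2 * phi z.2 ^+ 2).
have F0 z : 0 <= F z.
  by rewrite /F mulr_ge0 ?invr_ge0 ?pi_ge0// mulr_ge0 ?sqr_ge0// Pk1_ge0.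
have mF : measurable_fun setT F.
  apply: measurable_funM => //; apply: measurable_funM; first exact: measurable_Pk.
  by apply: measurable_funX; exact: measurableT_comp.
have mE : measurable_fun setT (EFin \o F) by exact/measurable_EFinP.
apply: (@le_trans _ _ (\int[muP]_x \int[muP]_t (EFin \o F) (x, t))%E).
  apply: ge0_le_integral => //.
  - by move=> x _; rewrite lee_fin sqr_ge0.
  - apply/measurable_EFinP; apply: measurable_funX.
    by apply: measurable_op => //; exact: measurable_Pk.
  - apply: measurable_fun_fubini_tonelli_F => //.
  move=> x _; have := sqr_opP_le x sg1 a0 np.
  have i2 : muP.-integrable setT (fun t => (Pk 1 a x t * phi t ^+ 2)%:E).
    apply: (integrable_Pk1_bounded (c := c ^+ 2)) => //.
      exact: measurable_funX.
    by move=> t; rewrite normrX ler_pXn2r ?nnegrE// (le_trans _ c1).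
  rewrite -lee_fin => /le_trans; apply.
  rewrite -RintegralZl// /Rintegral fineK//.
  exact: (integrable_fin_num measurableT (integrableZl measurableT pi^-1 i2)).
have F0E z : (0 <= (EFin \o F) z)%E by rewrite /= lee_fin.
rewrite (@fubini_tonelli _ _ _ _ R muP muP (EFin \o F) mE F0E).
apply: ge0_le_integral => //.
- by move=> t _; apply: integral_ge0 => x _; rewrite lee_fin.
- exact: (@measurable_fun_fubini_tonelli_G _ _ _ _ R muP (EFin \o F) mE F0E).
- by apply/measurable_EFinP; exact: measurable_funX.
move=> t _; rewrite /F/=.
under eq_integral do rewrite mulrA mulrAC EFinM PkC.
rewrite ge0_integralZl//; last 3 first.
- by apply/measurable_EFinP; exact: measurable_Pk_section.
- by move=> x _; rewrite lee_fin Pk1_ge0.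
- by rewrite lee_fin mulr_ge0 ?invr_ge0 ?pi_ge0// sqr_ge0.
by rewrite integral_Pk1// -EFinM lee_fin mulrAC mulVf ?mul1r// gt_eqF.
Qed.

(** The bound does not depend on a, as the passage to the limit a -> 0
    requires. It rests on |u| * poisson a u <= 1/2, used with u = x - t and u
    = x + t, where |x| <= |u| + c on the support of phi. *)
Lemma opP_decay_uniform c phi : nice c phi -> exists D, forall sg a x,
  `|sg| = 1 -> 0 < a -> `|op (Pk sg a) phi x| <= decay D x.
Proof.
move=> np; have [c1 mphi phic supp] := np.
have pi0 := pi_gt0 R. have c0 : 0 <= c by rewrite (le_trans _ c1).
exists ((1 + c) * c + pi^-1 * \int[muP]_t box c t) => sg a x sg1 a0.
have x1 : 0 < 1 + `|x| by rewrite ltr_pwDl.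
rewrite /decay ler_pdivlMr// mulrC.
have mn : measurable_fun setT (fun t => `|phi t|) by exact: measurableT_comp.
have i1 : muP.-integrable setT (fun t => (Pk 1 a x t * `|phi t|)%:E).
  by apply: (integrable_Pk1_bounded (c := c)) => // t; rewrite normr_id.
have up (u : R) : `|u| * poisson a u <= 2^-1.
  have h := sqrD_gt0 u a0.
  rewrite /poisson mulrA ler_pdivrMr// -(@real_normK _ u) ?num_real//.
  by have := sqr_ge0 (`|u| - a); rewrite !expr2; lra.
apply: le_trans (ler_wpM2l (ltW x1) (normr_opP_le x sg1 a0 np)) _.
rewrite mulrCA -[X in _ <= X + _](@mulKf _ pi) ?gt_eqF// -mulrDr.
rewrite ler_wpM2l ?invr_ge0 ?pi_ge0// -RintegralZl//.
rewrite -(Rintegral_Pk1 x a0) mulrC -RintegralZl//; last exact: integrable_Pk1.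
rewrite -RintegralD//; last 2 first.
- exact: (integrableZl measurableT _ (integrable_Pk1 x a0)).
- exact: integrable_box.
apply: le_Rintegral => //.
- exact: (integrableZl measurableT _ i1).
- exact: (integrableD measurableT (integrableZl measurableT ((1 + c) * c)
    (integrable_Pk1 x a0)) (integrable_box c)).
move=> t _; have P0 := Pk1_ge0 x t a0.
have [->|nz] := eqVneq (phi t) 0.
  rewrite normr0 !mulr0; apply: addr_ge0; last exact: mulr_ge0.
  by apply: mulr_ge0 => //; apply: mulr_ge0 => //; exact: addr_ge0.
have /andP[t0 tc] := supp _ nz.
have {}t0 : 0 <= t by rewrite (le_trans _ t0)// invr_ge0.
have -> : box c t = c by rewrite /box indicE mem_set ?mulr1//= in_itv/= t0.
have h : (1 + `|x|) * Pk 1 a x t <= (1 + c) * Pk 1 a x t + 1.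
  have n1 : `|x| <= `|x - t| + c.
    by rewrite -lerBlDr (le_trans _ (lerB_dist _ _))// lerB// ger0_norm.
  have n2 : `|x| <= `|x + t| + c.
    by rewrite -[x in `|x|](addrK t) (le_trans (ler_normB _ _))// lerD2l ger0_norm.
  have := up (x - t); have := up (x + t); rewrite /Pk mul1r.
  have := ler_wpM2r (poisson_ge0 (x - t) a0) n1.
  have := ler_wpM2r (poisson_ge0 (x + t) a0) n2.
  by rewrite !mulrDl; lra.
rewrite mulrA; apply: le_trans (ler_wpM2r (normr_ge0 _) h) _.
rewrite -[leRHS](_ : ((1 + c) * Pk 1 a x t + 1) * c = _); last by ring.
apply: ler_wpM2l => //; apply: addr_ge0 => //; apply: mulr_ge0 => //.
exact: addr_ge0.
Qed.

End poisson_operator.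

(** * Abel means of truncated integrals *)

Section abel.
Context {R : realType}.
Local Notation mu := (@lebesgue_measure R).
Local Notation muP := (@muP R).

Lemma measurable_invr : measurable_fun setT (fun x : R => x^-1).
Proof.
pose h n (x : R) := x / (x ^+ 2 + harmonic n).
apply: (@measurable_fun_cvg _ _ _ _ h).
  move=> n; apply: continuous_measurable_fun => x.
  have : 0 < x ^+ 2 + harmonic n by rewrite ltr_wpDl ?sqr_ge0// harmonic_gt0.
  move=> h0; apply: cvgM; first exact: cvg_id.
  apply: cvgV; first by rewrite gt_eqF.
  by apply: cvgD; [exact: exprn_continuous|exact: cvg_cst].
move=> x _ /=; rewrite /h.
have [->|x0] := eqVneq x 0.
  by under eq_fun do rewrite mul0r; rewrite invr0; exact: cvg_cst.
rewrite (_ : x^-1 = x / (x ^+ 2 + 0)); last by rewrite addr0; field.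
apply: cvgM; first exact: cvg_cst.
apply: cvgV; first by rewrite addr0 sqrf_eq0.
by apply: cvgD; [exact: cvg_cst|exact: cvg_harmonic].
Qed.

Implicit Types (a b c s t u x sg r e : R) (f g phi psi : R -> R).

(** On the half-line abel_weight is the derivative of abel_mass, a factor that
    regularises integrals singular at 0. *)
Definition abel_weight r : R := 2 * `|r| / (1 + r ^+ 2) ^+ 2.
Definition abel_mass r : R := r ^+ 2 / (1 + r ^+ 2).
Local Notation w := abel_weight.
Local Notation W := abel_mass.

Let pos r : 0 < 1 + r ^+ 2 :> R.
Proof. by rewrite ltr_pwDl// sqr_ge0. Qed.

Lemma abel_weight_ge0 r : 0 <= w r.
Proof. by rewrite divr_ge0 ?sqr_ge0// mulr_ge0. Qed.

Lemma continuous_abel_weight : continuous w.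
Proof.
move=> r; apply: cvgM; first by apply: cvgM; [exact: cvg_cst|exact: norm_continuous].
apply: cvgV; first by rewrite expf_neq0// gt_eqF.
have h : 1 + y ^+ 2 @[y --> r] --> 1 + r ^+ 2.
  by apply: cvgD; [exact: cvg_cst|exact: exprn_continuous].
by under eq_fun do rewrite expr2; rewrite expr2; exact: cvgM.
Qed.

Lemma measurable_abel_weight : measurable_fun setT w.
Proof. apply: continuous_measurable_fun; exact: continuous_abel_weight. Qed.

Lemma is_derive_abel_mass r : is_derive r 1 W (2 * r / (1 + r ^+ 2) ^+ 2).
Proof.
have dd : is_derive r 1 (fun r => 1 + r ^+ 2) (2 * r).
  by apply: is_derive_eq; rewrite /GRing.scale/=; ring.
have h0 : 1 + r ^+ 2 != 0 by rewrite gt_eqF.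
have dv := @is_deriveV _ (fun r => 1 + r ^+ 2) r _ 1 h0 dd.
have dn : is_derive r 1 (fun r : R => r ^+ 2) (2 * r).
  by apply: is_derive_eq; rewrite /GRing.scale/=; ring.
by apply: is_derive_eq; rewrite /GRing.scale/=; field.
Qed.

Lemma continuous_abel_mass : continuous W.
Proof.
move=> r; apply: differentiable_continuous; apply/derivable1_diffP.
by have dr := is_derive_abel_mass r; exact: ex_derive.
Qed.

Lemma integral_abel_weight_lt (rho : R) : 0 <= rho ->
  (\int[muP]_r ((w r * (r < rho)%R%:R)%R)%:E = (W rho)%:E)%E.
Proof.
move=> rho0.
have mI : measurable_fun setT (fun r : R => (r < rho)%R%:R : R).
  rewrite (_ : (fun r => _) = \1_`]-oo, rho[); first exact: measurable_indic.
  by apply/funext => r; rewrite indicE mem_setE in_itv.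
rewrite ge0_integral_muP//; last 2 first.
- by apply/measurable_EFinP; apply: measurable_funM => //; exact: measurable_abel_weight.
- by move=> r; rewrite lee_fin mulr_ge0// abel_weight_ge0.
have [->|rho_neq0] := eqVneq rho 0.
  rewrite integral0_eq; first by rewrite /W expr0n mul0r.
  by move=> r /=; rewrite in_itv/= andbT => r0; rewrite ltNge ltW//= mulr0.
have {rho_neq0}rho0 : 0 < rho by rewrite lt_neqAle eq_sym rho_neq0.
pose f r : R := 2 * r / (1 + r ^+ 2) ^+ 2.
transitivity (\int[mu]_(r in `]0%R, rho[) (f r)%:E)%E.
  rewrite integral_mkcond [RHS]integral_mkcond; apply: eq_integral => r _.
  rewrite !patchE !mem_setE !in_itv/= andbT; case: ltP => //= r0.
  by case: ltP => _; rewrite ?mulr1 ?mulr0// /w /f gtr0_norm.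
have cf : continuous f.
  move=> r; apply: cvgM; first by apply: cvgM; [exact: cvg_cst|exact: cvg_id].
  apply: cvgV; first by rewrite expf_neq0// gt_eqF.
  have h : 1 + y ^+ 2 @[y --> r] --> 1 + r ^+ 2.
    by apply: cvgD; [exact: cvg_cst|exact: exprn_continuous].
  by under eq_fun do rewrite expr2; rewrite expr2; exact: cvgM.
have mf : measurable_fun setT f by exact: continuous_measurable_fun.
rewrite integral_itv_obnd_cbnd; last exact/measurable_EFinP/measurable_funTS.
rewrite integral_itv_bndo_bndc; last exact/measurable_EFinP/measurable_funTS.
rewrite (@continuous_FTC2 _ f W 0 rho)//.
- by rewrite /W expr0n/= mul0r oppr0 adde0.
- exact: continuous_subspaceT.
- split.
  + by move=> r _; have dr := is_derive_abel_mass r; exact: ex_derive.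
  + by apply: cvg_at_right_filter; exact: continuous_abel_mass.
  + by apply: cvg_at_left_filter; exact: continuous_abel_mass.
- by move=> r _; rewrite derive1E; have dr := is_derive_abel_mass r; exact: derive_val.
Qed.

End abel.

Section abel_fubini.
Context {R : realType}.
Local Notation muP := (@muP R).
Implicit Types (a b c s t u x sg r e : R) (f g phi psi : R -> R).
Local Notation w := abel_weight.
Local Notation W := abel_mass.

Definition far x e t : R := (e < `|t - x|)%R%:R.

Lemma far01 x e t : 0 <= far x e t <= 1.
Proof. by rewrite /far; case: (_ < _); rewrite ?lexx ?ler01. Qed.

Lemma measurable_far a x : measurable_fun setT (fun z : R * R => far x (a * z.1) z.2).
Proof.
pose S := [set z : R * R | (a * z.1 < `|z.2 - x|)%R].
rewrite (_ : (fun z => _) = \1_S); last first.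
  by apply/funext => z; rewrite indicE /far /S mem_setE.
apply: measurable_indic; rewrite -[S]setTI.
have -> : S = (fun z : R * R => (a * z.1 < `|z.2 - x|)%R) @^-1` [set true].
  by apply/seteqP; split.
apply: (measurable_fun_ltr _ _ measurableT) => //.
- by apply: measurable_funM => //.
- by apply: measurableT_comp => //; exact: measurable_funB.
Qed.

(** Since W (u / a) is the integral of w over the r > 0 with a r < |u|,
    exchanging the integrals turns the smooth regularisation into an average
    of the sharp truncations |t - x| > a r. *)
Lemma abel_fubini psi x a : 0 < a -> measurable_fun setT psi ->
  muP.-integrable setT (fun t => (psi t * W ((t - x) / a))%:E) ->
  \int[muP]_t (psi t * W ((t - x) / a)) =
  \int[muP]_r \int[muP]_t (w r * (psi t * far x (a * r) t)).
Proof.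
move=> a0 mpsi ipsi.
pose F (z : R * R) : R := w z.1 * (psi z.2 * far x (a * z.1) z.2).
have mF : measurable_fun setT F.
  apply: measurable_funM; first by apply: (measurableT_comp measurable_abel_weight).
  by apply: measurable_funM; [exact: measurableT_comp|exact: measurable_far].
have farE r t : far x (a * r) t = (r < `|t - x| / a)%R%:R.
  by rewrite /far ltr_pdivlMr// mulrC.
have WE t : W (`|t - x| / a) = W ((t - x) / a).
  by rewrite /W !expr_div_n real_normK ?num_real.
have t0 t : 0 <= `|t - x| / a by rewrite divr_ge0// ltW.
have wE t := integral_abel_weight_lt (t0 t).
have mw t : measurable_fun setT (fun r => w r * (r < `|t - x| / a)%R%:R).
  apply: measurable_funM; first exact: measurable_abel_weight.
  rewrite (_ : (fun r => _) = \1_`]-oo, (`|t - x| / a)[); first exact: measurable_indic.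
  by apply/funext => r; rewrite indicE mem_setE in_itv.
have w0 t r : 0 <= w r * (r < `|t - x| / a)%R%:R.
  by rewrite mulr_ge0// abel_weight_ge0.
have iw t : muP.-integrable setT (fun r => (w r * (r < `|t - x| / a)%R%:R)%:E).
  apply/integrableP; split; first by apply/measurable_EFinP; exact: mw.
  by under eq_integral do rewrite /= ger0_norm//; rewrite wE ltry.
have inner t : \int[muP]_r F (r, t) = psi t * W ((t - x) / a).
  transitivity (\int[muP]_r (psi t * (w r * (r < `|t - x| / a)%R%:R))).
    by apply: eq_Rintegral => r _; rewrite /F/= farE mulrCA.
  rewrite RintegralZl//; last exact: iw.
  by rewrite /Rintegral wE/= WE.
have mFE : measurable_fun setT (EFin \o F) by exact/measurable_EFinP.
have iF : (muP \x muP)%E.-integrable setT (EFin \o F).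
  apply: (integrable21ltyP muP muP mFE).2.
  have /integrableP[_] := ipsi; apply: le_lt_trans.
  apply: ge0_le_integral => //.
  - by move=> t _; exact: integral_ge0.
  - have mA : measurable_fun setT (abse \o (EFin \o F)) by exact: measurableT_comp.
    exact: (@measurable_fun_fubini_tonelli_G _ _ _ _ R muP _ mA (fun z => abse_ge0 _)).
  - apply: measurableT_comp => //; exact: measurable_int ipsi.
  move=> t _; rewrite -WE /= normrM (ger0_norm (x := W _)); last first.
    by rewrite divr_ge0 ?sqr_ge0// addr_ge0 ?sqr_ge0.
  rewrite EFinM -wE -ge0_integralZl//; last 2 first.
  - by apply/measurable_EFinP; exact: mw.
  - by move=> r _; rewrite lee_fin.
  rewrite le_eqVlt; apply/orP; left; apply/eqP; apply: eq_integral => r _.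
  by rewrite /F/= farE mulrCA normrM (ger0_norm (w0 t r)).
rewrite (_ : \int[muP]_t _ = \int[muP]_t \int[muP]_r F (r, t)); last first.
  by apply: eq_Rintegral => t _; rewrite inner.
by rewrite -(Rintegral_Fubini iF).
Qed.

Lemma measurable_abel psi x a : measurable_fun setT psi ->
  measurable_fun setT (fun r => \int[muP]_t (w r * (psi t * far x (a * r) t))).
Proof.
move=> mpsi; pose F (z : R * R) : R := w z.1 * (psi z.2 * far x (a * z.1) z.2).
apply: (@measurable_Rintegral1 _ _ _ _ R muP F).
apply: measurable_funM; first by apply: (measurableT_comp measurable_abel_weight).
by apply: measurable_funM; [exact: measurableT_comp|exact: measurable_far].
Qed.

Lemma integral_abel_weight :
  muP.-integrable setT (EFin \o (w : R -> R)) /\ \int[muP]_r w r = 1 :> R.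
Proof.
pose f r : R := 2 * r / (1 + r ^+ 2) ^+ 2.
have pos r : 0 < 1 + r ^+ 2 :> R by rewrite ltr_pwDl// sqr_ge0.
have cf : continuous f.
  move=> r; apply: cvgM; first by apply: cvgM; [exact: cvg_cst|exact: cvg_id].
  apply: cvgV; first by rewrite expf_neq0// gt_eqF.
  have h : 1 + y ^+ 2 @[y --> r] --> 1 + r ^+ 2.
    by apply: cvgD; [exact: cvg_cst|exact: exprn_continuous].
  by under eq_fun do rewrite expr2; rewrite expr2; exact: cvgM.
have fb r : `|f r| <= 2 / (1 + r ^+ 2).
  rewrite /f normrM normfV normrM (ger0_norm (x := 2))//.
  rewrite (ger0_norm (x := (1 + r ^+ 2) ^+ 2)) ?sqr_ge0//.
  rewrite ler_pdivrMr ?exprn_gt0//.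
  rewrite (_ : _ / _ * _ = 2 * (1 + r ^+ 2)); last by field; rewrite gt_eqF.
  rewrite -(@real_normK _ r) ?num_real//.
  by have := sqr_ge0 (`|r| - 1); rewrite !expr2; have := normr_ge0 r; nra.
have df r : is_derive r 1 W (f r) by exact: is_derive_abel_mass.
have lf : W r @[r --> +oo] --> (1 : R).
  have : 1 - cst 1 r * (r ^-1) * conj_poisson 1 r @[r --> +oo] --> (1 - 1 * 0 * 0 : R).
    apply: cvgB; first exact: cvg_cst.
    apply: cvgM; last exact: cvg_conj_poisson.
    by apply: cvgM; [exact: cvg_cst|exact: cvg_pinfty_inv].
  rewrite mulr0 subr0; apply: cvg_trans; apply: near_eq_cvg; near=> r.
  have r0 : 0 < r by near: r; exact: nbhs_pinfty_gt.
  rewrite /W /conj_poisson /cst; field.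
  by rewrite !gt_eqF.
have [if_ fE] := integral_muP_derivative_dominated fb cf df lf.
have fw : {ae muP, forall r, setT r -> (EFin \o f) r = (EFin \o (w : R -> R)) r}.
  by apply: filterS (@muP_pos R) => r r0 _; rewrite /= /f /w gtr0_norm.
have mw : measurable_fun setT (EFin \o (w : R -> R)).
  by apply/measurable_EFinP; exact: measurable_abel_weight.
have mf : measurable_fun setT (EFin \o f) by exact: measurable_int if_.
have iE : (\int[muP]_r (w r)%:E = \int[muP]_r (f r)%:E)%E.
  by apply/esym; exact: ae_eq_integral.
split.
  apply/integrableP; split => //.
  under eq_integral do rewrite /= ger0_norm ?abel_weight_ge0//.
  by rewrite iE; exact: integrable_lty.
by rewrite /Rintegral iE -[LHS]/(\int[muP]_r f r) fE /W expr0n/= mul0r subr0.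
Unshelve. all: by end_near. Qed.

(** Averaging the means over intervals of radius a r with density 2 r w r
    yields the Poisson integral, whence the total mass pi. *)
Lemma integral_abel_moment :
  muP.-integrable setT (fun r => (2 * `|r| * w r)%:E) /\
  \int[muP]_r (2 * `|r| * w r) = pi :> R.
Proof.
have pos r : 0 < 1 + r ^+ 2 :> R by rewrite ltr_pwDl// sqr_ge0.
have w0 r : 0 <= 2 * `|r| * w r by apply: mulr_ge0; [exact: mulr_ge0|exact: abel_weight_ge0].
have cf : continuous (fun r => 2 * `|r| * w r).
  move=> r; apply: cvgM; last exact: continuous_abel_weight.
  by apply: cvgM; [exact: cvg_cst|exact: norm_continuous].
pose F r : R := 2 * (atan r - conj_poisson 1 r).
have df r : is_derive r 1 F (2 * `|r| * w r).
  have dq : is_derive r 1 (conj_poisson 1) ((1 - r ^+ 2) / (1 + r ^+ 2) ^+ 2).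
    have h0 : r ^+ 2 + 1 ^+ 2 != 0 by rewrite addrC expr1n gt_eqF.
    have dd : is_derive r 1 (fun r : R => r ^+ 2 + 1 ^+ 2) (2 * r).
      by apply: is_derive_eq; rewrite /GRing.scale/=; ring.
    have dv := @is_deriveV _ (fun r : R => r ^+ 2 + 1 ^+ 2) r _ 1 h0 dd.
    rewrite /conj_poisson; apply: is_derive_eq; rewrite /GRing.scale/=.
    by field; rewrite gt_eqF.
  rewrite /F; apply: is_derive_eq; rewrite /GRing.scale/= /w.
  rewrite (_ : 2 * `|r| * (2 * `|r| / (1 + r ^+ 2) ^+ 2) = 4 * `|r| ^+ 2 / (1 + r ^+ 2) ^+ 2); last by ring.
  by rewrite real_normK ?num_real//; field; rewrite gt_eqF.
have lf : F r @[r --> +oo] --> 2 * (pi / 2 - 0).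
  apply: cvgM; first exact: cvg_cst.
  by apply: cvgB; [exact: cvgy_atan|exact: cvg_conj_poisson].
have wE := integral_muP_derivative w0 cf df lf.
have F0 : F 0 = 0 by rewrite /F atan0 /conj_poisson mul0r subr0 mulr0.
rewrite F0 !subr0 in wE; split; last by rewrite /Rintegral wE/=; field.
apply/integrableP; split.
  by apply/measurable_EFinP; exact: continuous_measurable_fun.
by under eq_integral do rewrite /= ger0_norm//; rewrite wE ltry.
Qed.

(** For each r > 0 the scale harmonic n * r tends to 0, and the bound on A
    gives domination. *)
Lemma abel_mean_cvg (om A : R -> R) C v (G : nat -> R -> R) :
  (forall n, measurable_fun setT (G n)) -> measurable_fun setT om ->
  (forall n r, 0 < r -> G n r = om r * A (harmonic n * r)) ->
  (forall r, 0 <= om r) -> muP.-integrable setT (EFin \o om) ->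
  (forall e, 0 < e -> `|A e| <= C) -> A e @[e --> 0^'+] --> v ->
  (\int[muP]_r G n r) @[n --> \oo] --> (\int[muP]_r om r) * v.
Proof.
move=> mG mom GA om0 iom AC Av.
rewrite -RintegralZr//.
apply: (@Rintegral_dominated _ _ _ muP G _ (fun r => om r * C) _ _ _ _ _).2 => //.
- by apply: measurable_funM.
- apply: filterS (@muP_pos R) => r r0.
  under eq_fun do rewrite GA//.
  apply: cvgM; first exact: cvg_cst.
  apply: (cvg_at_rightP A 0 v).1 => //; split.
    by move=> n; rewrite mulr_gt0// harmonic_gt0.
  rewrite -[X in _ --> X](mul0r r); apply: cvgM; last exact: cvg_cst.
  exact: cvg_harmonic.
- exact: (integrableZr measurableT _ iom).
- apply: filterS (@muP_pos R) => r r0 n; rewrite GA// normrM ger0_norm//.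
  by rewrite ler_wpM2l// AC// mulr_gt0// harmonic_gt0.
Qed.

(** The truncations are bounded for small e because they converge and for
    large e by integrability away from x, so that abel_mean_cvg applies. *)
Lemma pv_abel psi x (v : R) : measurable_fun setT psi ->
  (forall e, 0 < e -> muP.-integrable setT (fun t => (psi t * far x e t)%:E)) ->
  (\int[muP]_t (psi t * far x e t)) @[e --> 0^'+] --> v ->
  (forall n, muP.-integrable setT (fun t => (psi t * W ((t - x) / harmonic n))%:E)) ->
  (\int[muP]_t (psi t * W ((t - x) / harmonic n))) @[n --> \oo] --> v.
Proof.
move=> mpsi ifar Av iW.
pose A e := \int[muP]_t (psi t * far x e t).
have [C AC] : exists C, forall e, 0 < e -> `|A e| <= C.
  have [d /= d0 dA] : exists2 d : R, 0 < d & forall e, 0 < e -> e < d -> `|A e| <= `|v| + 1.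
    have := Av; move/cvgrPdist_lt => /(_ 1 ltr01) [d /= d0 dA].
    exists d => // e e0 ed; have := dA e; rewrite /= sub0r normrN gtr0_norm// => /(_ ed e0).
    rewrite distrC => h.
    by rewrite -lerBlDl (le_trans (lerB_dist _ _))// ltW.
  have d20 : 0 < d / 2 by rewrite divr_gt0.
  pose B := \int[muP]_t `|psi t * far x (d / 2) t|.
  exists (`|v| + 1 + B) => e e0.
  have B0 : 0 <= B by apply: Rintegral_ge0 => t _.
  have [ed|de] := ltP e d; first by rewrite (le_trans (dA e e0 ed))// lerDl.
  apply: (@le_trans _ _ B); last by rewrite lerDr addr_ge0.
  apply: le_trans (le_normr_Rintegral measurableT (ifar e e0)) _.
  apply: le_Rintegral => //.
  - exact: integrable_norm (ifar e e0).
  - exact: integrable_norm (ifar _ d20).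
  move=> t _; rewrite !normrM ler_wpM2l// /far.
  have [et|] := ltP e `|t - x|; last by rewrite normr0.
  by rewrite (_ : (d / 2 < `|t - x|) = true)//; lra.
have := @abel_mean_cvg w A C v (fun n r => \int[muP]_t (w r * (psi t * far x (harmonic n * r) t))).
have [iw ->] := integral_abel_weight; rewrite mul1r.
under [X in _ -> X @ _ --> _]eq_fun do rewrite abel_fubini ?harmonic_gt0//.
apply => //.
- by move=> n; exact: measurable_abel.
- exact: measurable_abel_weight.
- move=> n r r0; rewrite RintegralZl//; apply: ifar.
  by rewrite mulr_gt0// harmonic_gt0.
- exact: abel_weight_ge0.
Qed.

End abel_fubini.

(** * Principal values as limits of regularised operators *)

Section L2.
Context {R : realType}.
Local Notation mu := (@lebesgue_measure R).
Local Notation muP := (@muP R).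
Implicit Types (a b c s t u x sg r e : R) (f g phi psi : R -> R).
Local Notation W := abel_mass.
Local Notation q := conj_poisson.

(** Real elements of L_2(R_+), extended by 0 so that integrals over the line
    and over the half-line coincide. *)
Record L2p f : Prop := L2P {
  L2_measurable : measurable_fun setT f ;
  L2_fin : (sqn f < +oo)%E ;
  L2_supp : forall t, t <= 0 -> f t = 0 }.

Lemma L2_integrable_sqr f : L2p f -> muP.-integrable setT (fun t => (f t ^+ 2)%:E).
Proof.
move=> [mf fo _]; apply/integrableP; split.
  by apply/measurable_EFinP; exact: measurable_funX.
by under eq_integral do rewrite /= ger0_norm ?sqr_ge0//.
Qed.

Lemma L2_mul_decay f (D : R) (K : R -> R) : L2p f -> measurable_fun setT K ->
  (forall t, 0 < t -> `|K t| <= decay D t) ->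
  muP.-integrable setT (fun t => (K t * f t)%:E).
Proof.
move=> Lf mK KD; have [mf _ f0] := Lf.
have i2 := integrableD measurableT (integrable_decay_sqr D) (L2_integrable_sqr Lf).
apply: (le_integrable measurableT _ _ i2).
  by apply/measurable_EFinP; exact: measurable_funM.
move=> t _; rewrite lee_fin normrM (ger0_norm (x := _ + _)) ?addr_ge0 ?sqr_ge0//.
have [t0|/f0 ->] := ltP 0 t; last by rewrite normr0 mulr0 addr_ge0 ?sqr_ge0.
have h := KD _ t0; rewrite -(@real_normK _ (f t)) ?num_real//.
apply: le_trans (ler_wpM2r (normr_ge0 _) h) _.
have := sqr_ge0 (decay D t - `|f t|).
have : 0 <= decay D t by rewrite (le_trans _ h).
by have := normr_ge0 (f t); rewrite !expr2; nra.
Qed.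

Lemma QkC sg a x t : Qk sg a x t = Qk (- sg) a t x.
Proof. by rewrite /Qk -(opprB t x) conj_poissonN [x + t]addrC mulrN mulNr. Qed.

Lemma integrable_Qk_L2 sg a x f : `|sg| = 1 -> 0 < a -> L2p f ->
  muP.-integrable setT (fun t => (Qk sg a x t * f t)%:E).
Proof.
move=> sg1 a0 Lf; apply: (L2_mul_decay Lf (D := 2 * decay_cst a `|x|)).
  by apply: measurable_section; exact: measurable_Qk.
by move=> t _; rewrite QkC; apply: Qk_decay => //; rewrite normrN.
Qed.

Lemma Rintegral_muP_supp g : measurable_fun setT g -> (forall t, t <= 0 -> g t = 0) ->
  \int[muP]_t g t = \int[mu]_t g t.
Proof.
move=> mg g0; rewrite /Rintegral integral_muP; last exact/measurable_EFinP.
congr fine; rewrite [LHS]integral_mkcond; apply: eq_integral => t _.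
rewrite patchE mem_setE in_itv/= andbT; case: ltP => // t0.
by rewrite g0.
Qed.

Lemma muP_neq x : {ae muP, forall t, t != x}.
Proof.
have mx : measurable ([set x] : set (measurableTypeR R)).
  by rewrite -set_itv1; exact: measurable_itv.
exists [set x]; split => //.
  rewrite muPE; apply: (@subset_measure0 _ _ _ mu _ ([set x] : set (measurableTypeR R))) => //; first exact: measurableI.
  exact: lebesgue_measure_set1.
by move=> t /= /negP; rewrite negbK => /eqP.
Qed.

Lemma cvg_conj_poisson_harmonic u : u != 0 -> q (harmonic n) u @[n --> \oo] --> u^-1.
Proof.
move=> u0; rewrite (_ : u^-1 = u / (u ^+ 2 + 0 ^+ 2)); last by field.
apply: cvgM; first exact: cvg_cst.
apply: cvgV; first by rewrite expr0n/= addr0 sqrf_eq0.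
apply: cvgD; first exact: cvg_cst.
rewrite !expr2; under eq_fun do rewrite expr2.
by apply: cvgM; exact: cvg_harmonic.
Qed.

Lemma abel_massE a u : 0 < a -> W (u / a) = u * q a u.
Proof.
move=> a0; have h := sqrD_gt0 u a0.
have h1 : 0 < 1 + (u / a) ^+ 2 by rewrite ltr_pwDl ?sqr_ge0.
rewrite /W /q; by field; rewrite !gt_eqF.
Qed.

Lemma measurable_punctured x e :
  measurable (punctured_pos x e : set (measurableTypeR R)).
Proof.
have -> : punctured_pos x e = [set t | (0 < t)%R && (e < `|t - x|)%R].
  by apply/seteqP; split => t /= => [[-> ->]|/andP[]].
rewrite -[X in measurable X]setTI.
have -> : [set t | (0 < t)%R && (e < `|t - x|)%R] =
    (fun t : R => (0 < t)%R && (e < `|t - x|)%R) @^-1` [set true].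
  by apply/seteqP; split.
suff : measurable_fun setT (fun t : R => (0 < t)%R && (e < `|t - x|)%R).
  by move=> /(_ measurableT [set true]); apply.
apply: measurable_and; apply: measurable_fun_ltr => //.
by apply: measurableT_comp => //; exact: measurable_funB.
Qed.

Lemma patch_punctured psi x e t : (forall t, t <= 0 -> psi t = 0) ->
  (psi \_ (punctured_pos x e)) t = psi t * far x e t.
Proof.
move=> psi0; rewrite patchE /far; case: ifPn => [|].
  by rewrite inE => -[_ ->]; rewrite mulr1.
rewrite notin_setE => h; have [t0|/psi0 ->] := ltP 0 t; last by rewrite mul0r.
have [et|_] := ltP e `|t - x|; last by rewrite mulr0.
by exfalso; exact: h.
Qed.

Lemma PV_far psi x e : measurable_fun setT psi -> (forall t, t <= 0 -> psi t = 0) ->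
  mu.-integrable (punctured_pos x e) (EFin \o psi) ->
  muP.-integrable setT (fun t => (psi t * far x e t)%:E) /\
  Rintegral mu (punctured_pos x e) psi = \int[muP]_t (psi t * far x e t).
Proof.
move=> mpsi psi0 ipsi.
have pE : psi \_ (punctured_pos x e) = (fun t => psi t * far x e t).
  by apply/funext => t; exact: patch_punctured.
have mp := measurable_punctured x e.
have mg : measurable_fun setT (fun t => psi t * far x e t).
  by rewrite -pE; apply: (measurable_restrictT psi mp).1; exact: measurable_funTS.
have ig : mu.-integrable setT (fun t => (psi t * far x e t)%:E).
  move: ipsi => /(integrable_mkcond _ mp).
  apply: eq_integrable => // t _; rewrite -patch_punctured//.
  by rewrite /= !patchE; case: ifP.
split.
  apply: integrable_muP; first exact/measurable_EFinP.
  exact: integrableS ig.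
rewrite Rintegral_muP_supp//; last by move=> t /psi0 ->; rewrite mul0r.
by rewrite Rintegral_mkcond pE.
Qed.

(** By partial fractions, x / (x^2 - t^2) is the case sg = 1 and t / (t^2 -
    x^2) the case sg = -1. *)
Definition pv_kernel sg x t := (sg / (x - t) + 1 / (x + t)) / 2.

Lemma measurable_pv_kernel sg x : measurable_fun setT (pv_kernel sg x).
Proof.
apply: measurable_funM => //; apply: measurable_funD; apply: measurable_funM => //.
- by apply: (measurableT_comp (@measurable_invr R)); exact: measurable_funB.
- by apply: (measurableT_comp (@measurable_invr R)); exact: measurable_funD.
Qed.

(** With psi the singular integrand, 2 psi W((t - x) / a) = Qk sg a x t * f t
    + E, where E / f is the difference of two bounded terms that both tend to
    1 / (x + t). So E disappears in the limit, and pv_abel gives the rest. *)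
Lemma PV_op sg f x (v : R) : `|sg| = 1 -> L2p f -> 0 < x ->
  is_PV x (fun t => pv_kernel sg x t * f t) v ->
  op (Qk sg (harmonic n)) f x @[n --> \oo] --> 2 / pi * v.
Proof.
move=> sg1 Lf x0 [ipv cpv]; have [mf _ f0] := Lf.
pose psi t := pv_kernel sg x t * f t.
have mpsi : measurable_fun setT psi.
  by apply: measurable_funM => //; exact: measurable_pv_kernel.
have psi0 t : t <= 0 -> psi t = 0 by move=> /f0 ft; rewrite /psi ft mulr0.
pose D := 1 + x^-1.
have Dt t : 0 < t -> (x + t)^-1 <= decay D t.
  move=> t0; have xt : 0 < x + t by rewrite addr_gt0.
  rewrite /decay (gtr0_norm t0) -[leLHS]mul1r.
  rewrite ler_pdivrMr// mulrAC ler_pdivlMr ?addr_gt0// mul1r /D.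
  rewrite (_ : _ * _ = 1 + t + x + x^-1 * t); last by field; rewrite gt_eqF.
  have : 0 <= x^-1 * t by apply: mulr_ge0; rewrite ?invr_ge0 ltW.
  lra.
(* By abel_massE this is W((t - x) / a) / (x + t). *)
pose V a t := (t - x) * q a (t - x) / (x + t).
have q1 a u : 0 < a -> 0 <= u * q a u <= 1.
  move=> a0; have h := sqrD_gt0 u a0; rewrite /q mulrA -expr2.
  rewrite divr_ge0 ?sqr_ge0 ?(ltW h)//= ler_pdivrMr// mul1r lerDl sqr_ge0//.
have VD a t : 0 < a -> 0 < t -> `|V a t| <= decay D t.
  move=> a0 t0; rewrite /V normrM ger0_norm; last by case/andP: (q1 a (t - x) a0).
  have xt : 0 < x + t by rewrite addr_gt0.
  rewrite gtr0_norm ?invr_gt0//; apply: le_trans (Dt _ t0).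
  by rewrite ler_piMl ?invr_ge0 ?(ltW xt)//; case/andP: (q1 a (t - x) a0).
have qD a t : 0 < a -> 0 < t -> `|q a (x + t)| <= decay D t.
  move=> a0 t0; have xt : 0 < x + t by rewrite addr_gt0.
  have /andP[h1 h2] := q1 a (x + t) a0.
  apply: le_trans (Dt _ t0); rewrite ger0_norm; last first.
    by rewrite divr_ge0// ltW// sqrD_gt0.
  by rewrite -[leRHS]mul1r ler_pdivlMr// mulrC.
have mq a (g : R -> R) : 0 < a -> measurable_fun setT g -> measurable_fun setT (fun t => q a (g t)).
  move=> a0 mg; apply: (measurableT_comp _ mg).
  by apply: continuous_measurable_fun; exact: continuous_conj_poisson.
have mV a : 0 < a -> measurable_fun setT (V a).
  move=> a0; apply: measurable_funM; first apply: measurable_funM.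
  - exact: measurable_funB.
  - by apply: mq => //; exact: measurable_funB.
  - by apply: (measurableT_comp (@measurable_invr R)); exact: measurable_funD.
have psiW a t : 0 < a -> psi t * W ((t - x) / a) =
    2^-1 * (Qk sg a x t * f t + (V a t - q a (x + t)) * f t).
  move=> a0; have [/f0 ft|t0] := leP t 0; first by rewrite /psi ft; ring.
  have xt : 0 < x + t by rewrite addr_gt0.
  rewrite abel_massE// /psi /pv_kernel /V /Qk.
  rewrite -(opprB t x) conj_poissonN; have [->|tx] := eqVneq t x.
    by rewrite subrr oppr0 invr0 /q !mul0r; ring.
  have tx0 : t - x != 0 by rewrite subr_eq0.
  rewrite invrN [q a (t - x)]/q.
  have h := sqrD_gt0 (t - x) a0.
  rewrite mulrDl mulrDl !mulrA.
  by field; rewrite tx0 !gt_eqF.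
pose E n t := (V (harmonic n) t - q (harmonic n) (x + t)) * f t.
have h0 n : 0 < harmonic n :> R by exact: harmonic_gt0.
have ED n t : 0 < t -> `|V (harmonic n) t - q (harmonic n) (x + t)| <= decay (2 * D) t.
  move=> t0; apply: le_trans (ler_normB _ _) _.
  rewrite /decay -mulrA mulr2n mulrDl mul1r -/(decay D t).
  by apply: lerD; [exact: VD|exact: qD].
have mE0 n : measurable_fun setT (fun t => V (harmonic n) t - q (harmonic n) (x + t)).
  by apply: measurable_funB; [exact: mV|apply: mq => //; exact: measurable_funD].
have iE n : muP.-integrable setT (EFin \o E n).
  exact: (L2_mul_decay Lf (mE0 n) (ED n)).
have iQ n : muP.-integrable setT (fun t => (Qk sg (harmonic n) x t * f t)%:E).
  exact: integrable_Qk_L2.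
have iW n : muP.-integrable setT (fun t => (psi t * W ((t - x) / harmonic n))%:E).
  under eq_fun do rewrite psiW// EFinM.
  exact: (integrableZl measurableT _ (integrableD measurableT (iQ n) (iE n))).
have lW : (\int[muP]_t (psi t * W ((t - x) / harmonic n))) @[n --> \oo] --> v.
  apply: pv_abel => //.
  - by move=> e e0; have [] := PV_far mpsi psi0 (ipv e e0).
  - apply: cvg_trans cpv; apply: near_eq_cvg; near=> e.
    have e0 : 0 < e by near: e; exact: nbhs_right_gt.
    by have [_] := PV_far mpsi psi0 (ipv e e0).
have lE : (\int[muP]_t E n t) @[n --> \oo] --> (0 : R).
  rewrite -[X in _ --> X](_ : \int[muP]_t (fun=> 0) t = 0); last first.
    by rewrite /Rintegral integral0_eq.
  apply: (@Rintegral_dominated _ _ _ muP E _ (fun t => decay (2 * D) t ^+ 2 + f t ^+ 2) _ _ _ _ _).2 => //.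
  - by move=> n; exact: (measurable_funM (mE0 n) mf).
  - have := muP_neq x; apply: filterS2 (@muP_pos R) => t t0 tx.
    have xt : 0 < x + t by rewrite addr_gt0.
    have tx0 : t - x != 0 by rewrite subr_eq0.
    rewrite -[X in _ --> X](_ : ((t - x) * (t - x)^-1 / (x + t) - (x + t)^-1) * f t = 0).
      apply: cvgM; last exact: cvg_cst.
      apply: cvgB; last by apply: cvg_conj_poisson_harmonic; rewrite gt_eqF.
      apply: cvgM; last exact: cvg_cst.
      by apply: cvgM; [exact: cvg_cst|exact: cvg_conj_poisson_harmonic].
    by rewrite mulfV// mul1r subrr mul0r.
  - exact: (integrableD measurableT (integrable_decay_sqr _) (L2_integrable_sqr Lf)).
  - apply: filterS (@muP_pos R) => t t0 n; rewrite /E normrM.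
    have h := ED n _ t0; rewrite -(@real_normK _ (f t)) ?num_real//.
    apply: le_trans (ler_wpM2r (normr_ge0 _) h) _.
    have := sqr_ge0 (decay (2 * D) t - `|f t|).
    have : 0 <= decay (2 * D) t by rewrite (le_trans _ h).
    by have := normr_ge0 (f t); rewrite !expr2; nra.
have opE n : op (Qk sg (harmonic n)) f x =
    pi^-1 * (2 * \int[muP]_t (psi t * W ((t - x) / harmonic n)) - \int[muP]_t E n t).
  rewrite /op; congr (_ * _).
  have -> : \int[muP]_t (psi t * W ((t - x) / harmonic n)) =
      2^-1 * (\int[muP]_t (Qk sg (harmonic n) x t * f t) + \int[muP]_t E n t).
    rewrite -(RintegralD measurableT (iQ n) (iE n)) -RintegralZl//; last exact: (integrableD measurableT (iQ n) (iE n)).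
    by apply: eq_Rintegral => t _; rewrite psiW.
  by field.
rewrite (_ : 2 / pi * v = pi^-1 * (2 * v - 0)); last by rewrite subr0 mulrA (mulrC 2).
under eq_fun do rewrite opE.
apply: cvgM; first exact: cvg_cst.
by apply: cvgB => //; apply: cvgM => //; exact: cvg_cst.
Unshelve. all: by end_near. Qed.

End L2.

(** * The Poisson operators form an approximate identity *)

Section approximate_identity.
Context {R : realType}.
Local Notation mu := (@lebesgue_measure R).
Local Notation muP := (@muP R).
Implicit Types (a b c s t u x sg r e : R) (f g phi psi : R -> R).
Local Notation w := abel_weight.
Local Notation W := abel_mass.
Local Notation p := poisson.

#[local] Instance mu_ae_filter : Filter (nbhs (almost_everywhere mu)).
Proof. exact: ae_filter_ringOfSetsType. Qed.

Lemma nice_integrable_mu c phi : nice c phi -> mu.-integrable setT (EFin \o phi).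
Proof.
move=> np; have [_ mphi _ _] := np.
apply: (le_integrable measurableT _ _ (integrableZl measurableT c (integrable_indic_itv 0 c true false))).
  exact/measurable_EFinP.
by move=> t _; rewrite lee_fin (le_trans (nice_box t np))// ler_norm.
Qed.

Definition near_avg phi x e := (2 * e)^-1 * \int[muP]_t (phi t * (1 - far x e t)).

Lemma farC x e t : 1 - far x e t = \1_`[x - e, x + e] t.
Proof.
rewrite indicE mem_setE in_itv/= -ler_distl distrC /far ltNge.
by rewrite distrC; case: (_ <= _); rewrite ?subr0 ?subrr.
Qed.

Lemma measurable_far1 x e : measurable_fun setT (far x e).
Proof.
rewrite (_ : far x e = (fun t => 1 - \1_`[x - e, x + e] t)).
  by apply: measurable_funB => //; exact: measurable_indic.
by apply/funext => t; rewrite -farC subKr.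
Qed.

Lemma near_avg_mu c phi x e : nice c phi ->
  near_avg phi x e = (2 * e)^-1 * \int[mu]_t (phi t * \1_`[x - e, x + e] t).
Proof.
move=> np; have [_ mphi _ _] := np.
rewrite /near_avg; congr (_ * _).
rewrite (_ : (fun t => _) = (fun t => phi t * \1_`[x - e, x + e] t)); last first.
  by apply/funext => t; rewrite farC.
apply: Rintegral_muP_supp.
  by apply: measurable_funM => //; exact: measurable_indic.
by move=> t /(nice_supp np) ->; rewrite mul0r.
Qed.

Lemma Rintegral_near_indic x e : 0 < e ->
  \int[mu]_t (\1_`[x - e, x + e] t) = 2 * e :> R.
Proof.
move=> e0; rewrite /Rintegral integral_indic//= setIT lebesgue_measure_itv/=.
rewrite lte_fin ltrD2l gtrN// -EFinD/=; lra.
Qed.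

Lemma near_avg_bounded c phi x e : nice c phi -> 0 < e -> `|near_avg phi x e| <= c.
Proof.
move=> np e0; have [c1 mphi phic _] := np.
have c0 : 0 <= c by rewrite (le_trans _ c1).
rewrite (near_avg_mu _ _ np) normrM gtr0_norm ?invr_gt0 ?mulr_gt0//.
rewrite ler_pdivrMl ?mulr_gt0// mulrC.
have ii := integrable_indic_itv (x - e) (x + e) true false.
have i1 : mu.-integrable setT (fun t => (phi t * \1_`[x - e, x + e] t)%:E).
  apply: (le_integrable measurableT _ _ (integrableZl measurableT c ii)).
    by apply/measurable_EFinP; apply: measurable_funM => //; exact: measurable_indic.
  move=> t _; rewrite lee_fin !normrM ler_wpM2r// (le_trans (phic t))//.
  exact: ler_norm.
apply: le_trans (le_normr_Rintegral measurableT i1) _.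
rewrite -(Rintegral_near_indic x e0) -RintegralZl//.
apply: le_Rintegral => //.
- exact: integrable_norm i1.
- exact: (integrableZl measurableT c ii).
by move=> t _; rewrite normrM (ger0_norm (x := \1__ _)) ?ler_wpM2r// indicE.
Qed.

(** The radius doubles because davg averages over open balls and near_avg over
    closed intervals. *)
Lemma near_avg_davg c phi x e : nice c phi -> 0 < e ->
  (`|near_avg phi x e - phi x|%:E <= 2%:E * davg phi x (2 * e)%R)%E.
Proof.
move=> np e0; have [c1 mphi phic _] := np.
have c0 : 0 <= c by rewrite (le_trans _ c1).
have ii := integrable_indic_itv (x - e) (x + e) true false.
have i1 : mu.-integrable setT (fun t => (phi t * \1_`[x - e, x + e] t)%:E).
  apply: (le_integrable measurableT _ _ (integrableZl measurableT c ii)).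
    by apply/measurable_EFinP; apply: measurable_funM => //; exact: measurable_indic.
  move=> t _; rewrite lee_fin !normrM ler_wpM2r// (le_trans (phic t))//.
  exact: ler_norm.
have i2 : mu.-integrable setT (fun t => (phi x * \1_`[x - e, x + e] t)%:E).
  exact: (integrableZl measurableT (phi x) ii).
have -> : near_avg phi x e - phi x = (2 * e)^-1 *
    \int[mu]_t (phi t * \1_`[x - e, x + e] t - phi x * \1_`[x - e, x + e] t).
  rewrite RintegralB// RintegralZl// Rintegral_near_indic// (near_avg_mu _ _ np).
  by field; rewrite gt_eqF.
rewrite normrM gtr0_norm ?invr_gt0 ?mulr_gt0// EFinM.
have iB := integrableB measurableT i1 i2.
apply: (@le_trans _ _ (((2 * e)^-1)%:E * \int[mu]_(t in ball x (2 * e)%R) `|(phi t - phi x)%:E|)%E).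
  apply: lee_wpmul2l; first by rewrite lee_fin invr_ge0 mulr_ge0// ltW.
  rewrite /Rintegral; apply: (@le_trans _ _ (\int[mu]_t
      `|(phi t * \1_`[(x - e)%R, (x + e)%R] t - phi x * \1_`[(x - e)%R, (x + e)%R] t)%:E|)%E).
    have := le_abse_integral mu measurableT (measurable_int _ iB).
    apply: le_trans; rewrite -[X in (_ <= `|X|)%E]fineK//.
    exact: integrable_fin_num iB.
  rewrite [leRHS]integral_mkcond; apply: ge0_le_integral => //.
  - by apply: measurableT_comp => //; exact: measurable_int iB.
  - apply: (measurable_restrictT _ (measurable_ball _ _)).1; apply: measurable_funTS.
    apply: measurableT_comp => //; apply/measurable_EFinP.
    exact: measurable_funB.
  move=> t _; rewrite patchE -mulrBl /= normrM indicE mem_setE in_itv/=.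
  rewrite -ler_distl; case: ifPn => [_|].
    by rewrite lee_fin ler_piMr//; case: (`|_| <= e); rewrite ?normr1 ?normr0.
  rewrite notin_setE /ball/= => /negP; rewrite -leNgt => h.
  rewrite (_ : (`|t - x| <= e) = false) ?normr0 ?mulr0//.
  by apply/negbTE; rewrite -ltNge distrC; apply: lt_le_trans h; lra.
rewrite /davg /iavg lebesgue_measure_ball; last by rewrite mulr_ge0// ltW.
rewrite inver gt_eqF; last by rewrite pmulrn_lgt0// mulr_gt0.
rewrite muleA -EFinM (_ : 2 / _ = (2 * e)^-1)//.
by field; rewrite gt_eqF.
Qed.

Lemma near_avg_cvg c phi x : nice c phi -> lebesgue_pt phi x ->
  near_avg phi x e @[e --> 0^'+] --> phi x.
Proof.
move=> np; rewrite /lebesgue_pt => /fine_cvgP[[d1 /= d10 fd]].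
move=> /cvgrPdist_lt cd; apply/cvgrPdist_lt => eps eps0.
have [d2 /= d20 hd] := cd _ (divr_gt0 eps0 (ltr0Sn R 1)).
near=> e.
have e0 : 0 < e by near: e; exact: nbhs_right_gt.
have e1 : 2 * e < d1.
  by rewrite mulrC -ltr_pdivlMr//; near: e; apply: nbhs_right_lt; rewrite divr_gt0.
have e2 : 2 * e < d2.
  by rewrite mulrC -ltr_pdivlMr//; near: e; apply: nbhs_right_lt; rewrite divr_gt0.
have e20 : 0 < 2 * e by rewrite mulr_gt0.
have fin2 : davg phi x (2 * e) \is a fin_num.
  by apply: fd => //=; rewrite sub0r normrN gtr0_norm.
have := hd (2 * e); rewrite /= !sub0r normrN gtr0_norm// => /(_ e2 e20).
rewrite normrN => h.
have := near_avg_davg x np e0; rewrite -(fineK fin2) -EFinM lee_fin => h2.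
rewrite distrC (le_lt_trans h2)// mulrC -ltr_pdivlMr// (le_lt_trans _ h)//.
exact: ler_norm.
Unshelve. all: by end_near. Qed.

(** At a Lebesgue point the means over small intervals converge, and the part
    I of the Poisson integral in x - t is an Abel average of such means. The
    reflected part J is O(a), since x + t stays away from 0. *)
Lemma opP_cvg_ae sg c phi : `|sg| = 1 -> nice c phi ->
  {ae muP, forall x, op (Pk sg (harmonic n)) phi x @[n --> \oo] --> phi x}.
Proof.
move=> sg1 np; have [c1 mphi phic _] := np.
have c0 : 0 <= c by rewrite (le_trans _ c1).
have h0 n : 0 < harmonic n :> R by exact: harmonic_gt0.
have loc : locally_integrable setT phi.
  by apply: open_integrable_locally; [exact: openT|exact: nice_integrable_mu np].
have leb : {ae muP, forall x, lebesgue_pt phi x}.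
  by apply/muP_ae; apply: filterS (lebesgue_differentiation loc) => x px _.
apply: filterS2 (@muP_pos R) leb => x x0 px.
pose I n := \int[muP]_t (poisson (harmonic n) (x - t) * phi t).
pose J n := \int[muP]_t (poisson (harmonic n) (x + t) * phi t).
have iphi := nice_integrable np.
have mp a (g : R -> R) : 0 < a -> measurable_fun setT g -> measurable_fun setT (fun t => p a (g t)).
  move=> a0 mg; apply: (measurableT_comp _ mg).
  by apply: continuous_measurable_fun; exact: continuous_poisson.
have pa a u : 0 < a -> `|p a u| <= a^-1.
  move=> a0; rewrite ger0_norm ?poisson_ge0// /p ler_pdivrMr ?sqrD_gt0//.
  by rewrite ler_pdivlMl// -expr2 lerDr sqr_ge0.
have iIJ a (g : R -> R) : 0 < a -> measurable_fun setT g ->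
    muP.-integrable setT (fun t => (p a (g t) * phi t)%:E).
  move=> a0 mg; apply: (le_integrable measurableT _ _ (integrableZl measurableT a^-1 iphi)).
    by apply/measurable_EFinP; apply: measurable_funM => //; exact: mp.
  move=> t _; rewrite lee_fin [leLHS]normrM [leRHS]normrM ler_wpM2r// (le_trans (pa a _ a0))//.
  exact: ler_norm.
have iI n : muP.-integrable setT (fun t => (p (harmonic n) (x - t) * phi t)%:E).
  by apply: iIJ => //; exact: measurable_funB.
have iJ n : muP.-integrable setT (fun t => (p (harmonic n) (x + t) * phi t)%:E).
  by apply: iIJ => //; exact: measurable_funD.
have opE n : op (Pk sg (harmonic n)) phi x = pi^-1 * (I n + sg * J n).
  rewrite /op; congr (_ * _); rewrite /I /J -(RintegralZl sg measurableT (iJ n)).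
  rewrite -(RintegralD measurableT (iI n) (integrableZl measurableT sg (iJ n))).
  by apply: eq_Rintegral => t _; rewrite /Pk; ring.
have J0 : J n @[n --> \oo] --> (0 : R).
  pose B := x ^- 2 * \int[muP]_t box c t.
  have JB n : `|J n| <= harmonic n * B.
    apply: le_trans (le_normr_Rintegral measurableT (iJ n)) _.
    rewrite /B mulrA -RintegralZl//; last exact: integrable_box.
    apply: le_Rintegral => //.
    - exact: integrable_norm (iJ n).
    - exact: (integrableZl measurableT _ (integrable_box c)).
    move=> t _; rewrite normrM; have [/(nice_supp np) ->|t0] := leP t 0.
      rewrite normr0 mulr0; apply: mulr_ge0; last exact: mulr_ge0.
      by apply: mulr_ge0; [exact: ltW|rewrite invr_ge0 sqr_ge0].
    apply: ler_pM => //; last exact: nice_box.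
    rewrite ger0_norm ?poisson_ge0// /p ler_wpM2l ?(ltW (h0 n))// lef_pV2 ?posrE ?sqrD_gt0 ?exprn_gt0//.
    by have := h0 n; move: x0 t0; clear; rewrite !expr2; nra.
  apply/norm_cvg0P; apply: (squeeze_cvgr _ (cvg_cst (0 : R)) _ (h := fun n => harmonic n * B)).
    by near=> n; rewrite normr_ge0 JB.
  by rewrite -[X in _ --> X](mul0r B); apply: cvgM; [exact: cvg_harmonic|exact: cvg_cst].
have I1 : I n @[n --> \oo] --> pi * phi x.
  have [im <-] := @integral_abel_moment R.
  have [iw w1] := @integral_abel_weight R.
  pose H n r := \int[muP]_t (w r * (phi t * far x (harmonic n * r) t)).
  have Wx n t : W ((t - x) / harmonic n) = 1 - harmonic n * p (harmonic n) (x - t).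
    rewrite abel_massE// -(opprB x t) conj_poissonN mulrNN /conj_poisson /p.
    have h := sqrD_gt0 (x - t) (h0 n); rewrite expr2.
    by field; rewrite -expr2 gt_eqF.
  have ipW n : muP.-integrable setT (fun t => (phi t * W ((t - x) / harmonic n))%:E).
    have := integrableB measurableT iphi (integrableZl measurableT (harmonic n) (iI n)).
    apply: eq_integrable => // t _; by rewrite Wx /=; congr EFin; ring.
  have abel n := abel_fubini (x := x) (h0 n) mphi (ipW n).
  have ifar r : muP.-integrable setT (fun t => (phi t * far x r t)%:E).
    apply: (le_integrable measurableT _ _ iphi).
      by apply/measurable_EFinP; apply: measurable_funM => //; exact: measurable_far1.
    move=> t _; rewrite lee_fin normrM ler_piMr//.
    by have /andP[f0 f1] := far01 x r t; rewrite ger0_norm.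
  have mH n : measurable_fun setT (H n) by exact: measurable_abel.
  have iH n : muP.-integrable setT (EFin \o H n).
    have ic := integrableZr measurableT (\int[muP]_t box c t) iw.
    apply: (le_integrable measurableT _ _ ic); first by apply/measurable_EFinP; exact: mH.
    move=> r _; rewrite lee_fin; apply: le_trans (ler_norm _).
    have iwr := integrableZl measurableT (w r) (ifar (harmonic n * r)).
    apply: le_trans (le_normr_Rintegral measurableT iwr) _.
    rewrite -RintegralZl//; last exact: integrable_box.
    apply: le_Rintegral => //.
    - exact: integrable_norm iwr.
    - exact: (integrableZl measurableT _ (integrable_box c)).
    move=> t _; rewrite normrM (ger0_norm (abel_weight_ge0 r)).
    rewrite ler_wpM2l ?abel_weight_ge0//.
    apply: le_trans (nice_box t np); rewrite normrM ler_piMr//.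
    by have /andP[f0 f1] := far01 x (harmonic n * r) t; rewrite ger0_norm.
  have HE n : I n = \int[muP]_r ((harmonic n)^-1 * (w r * (\int[muP]_t phi t) - H n r)).
    have iwz := integrableZr measurableT (\int[muP]_t phi t) iw.
    rewrite (RintegralZl _ measurableT (integrableB measurableT iwz (iH n))).
    rewrite (RintegralB measurableT iwz (iH n)) (RintegralZr _ measurableT iw).
    rewrite w1 mul1r /H -abel -(RintegralB measurableT iphi (ipW n)).
    rewrite -(RintegralZl _ measurableT (integrableB measurableT iphi (ipW n))).
    apply: eq_Rintegral => t _; rewrite Wx; field.
    by rewrite gt_eqF.
  under eq_fun do rewrite HE.
  apply: (abel_mean_cvg (A := near_avg phi x) (C := c)) => //.
  - move=> n; apply: measurable_funM => //; apply: measurable_funB => //.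
    by apply: measurable_funM => //; exact: measurable_abel_weight.
  - by apply: measurable_funM; [exact: measurable_funM|exact: measurable_abel_weight].
  - move=> n r r0 /=; rewrite (gtr0_norm r0) /H (RintegralZl _ measurableT (ifar _)) /near_avg.
    have -> : \int[muP]_t (phi t * (1 - far x (harmonic n * r) t)) =
       \int[muP]_t phi t - \int[muP]_t (phi t * far x (harmonic n * r) t).
      rewrite -(RintegralB measurableT iphi (ifar _)).
      by apply: eq_Rintegral => t _; ring.
    by field; rewrite !gt_eqF.
  - by move=> r; apply: mulr_ge0; [exact: mulr_ge0|exact: abel_weight_ge0].
  - by move=> e e0; exact: near_avg_bounded.
  - exact: (near_avg_cvg np px).
under eq_fun do rewrite opE.
rewrite (_ : phi x = pi^-1 * (pi * phi x + sg * 0)); last first.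
  by rewrite mulr0 addr0 mulKf// gt_eqF// pi_gt0.
apply: cvgM; first exact: cvg_cst.
by apply: cvgD => //; apply: cvgM => //; exact: cvg_cst.
Unshelve. all: by end_near. Qed.

(** Almost everywhere convergence, with the domination of opP_decay_uniform.
    *)
Lemma opP_cvg_L2 sg c phi : `|sg| = 1 -> nice c phi ->
  (\int[muP]_x (op (Pk sg (harmonic n)) phi x ^+ 2)) @[n --> \oo] --> \int[muP]_x (phi x ^+ 2) /\
  (\int[muP]_x ((op (Pk sg (harmonic n)) phi x - phi x) ^+ 2)) @[n --> \oo] --> (0 : R).
Proof.
move=> sg1 np; have [c1 mphi phic supp] := np.
have [D hD] := opP_decay_uniform np.
have h0 n : 0 < harmonic n :> R by exact: harmonic_gt0.
pose D2 := c * (1 + c).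
have phiD x : `|phi x| <= decay D2 x by exact: nice_decay np.
have mP n : measurable_fun setT (op (Pk sg (harmonic n)) phi).
  by apply: measurable_op => //; exact: measurable_Pk.
have cae := opP_cvg_ae sg1 np.
have sqr_cvg (u : nat -> R) (l : R) : u n @[n --> \oo] --> l -> u n ^+ 2 @[n --> \oo] --> l ^+ 2.
  by move=> ul; under eq_fun do rewrite expr2; rewrite expr2; exact: cvgM.
have PD n x : `|op (Pk sg (harmonic n)) phi x| <= decay D x by exact: hD.
split.
  apply: (@Rintegral_dominated _ _ _ muP _ _ (fun x => decay D x ^+ 2) _ _ _ _ _).2.
  - by move=> n; apply: measurable_funX; exact: mP.
  - exact: measurable_funX.
  - by apply: filterS cae => x px; exact: sqr_cvg.
  - exact: integrable_decay_sqr.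
  - apply: aeW => x n; rewrite normrX.
    by rewrite ler_pXn2r ?nnegrE// (le_trans _ (PD n x)).
rewrite -[X in _ --> X](_ : \int[muP]_t (fun=> 0) t = 0); last first.
  by rewrite /Rintegral integral0_eq.
apply: (@Rintegral_dominated _ _ _ muP _ _ (fun x => decay (D + D2) x ^+ 2) _ _ _ _ _).2 => //.
- by move=> n; apply: measurable_funX; exact: (measurable_funB (mP n) mphi).
- apply: filterS cae => x px; rewrite -[X in _ --> X](_ : (phi x - phi x) ^+ 2 = 0).
    by apply: sqr_cvg; apply: cvgB => //; exact: cvg_cst.
  by rewrite subrr expr0n.
- exact: integrable_decay_sqr.
- apply: aeW => x n; rewrite normrX.
  have h : `|op (Pk sg (harmonic n)) phi x - phi x| <= decay (D + D2) x.
    by rewrite /decay mulrDl (le_trans (ler_normB _ _))// lerD//; exact: PD.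
  by rewrite ler_pXn2r ?nnegrE// (le_trans _ h).
Qed.

End approximate_identity.

(** * Asymptotic positivity of the regularised operators *)

Section positivity.
Context {R : realType}.
Local Notation muP := (@muP R).
Implicit Types (a b c s t u x sg r e : R) (f g phi psi : R -> R).
Local Notation q := conj_poisson.

Lemma integral_expR_decay k : 0 < k ->
  (\int[muP]_s (expR (- k * s))%:E = (k^-1)%:E :> \bar R)%E.
Proof.
move=> k0.
have cf : continuous (fun s : R => expR (- k * s)).
  move=> s; apply: continuous_cvg; first exact: continuous_expR.
  by apply: cvgM; [exact: cvg_cst|exact: cvg_id].
have df (s : R) : is_derive s 1 (fun s => - k^-1 * expR (- k * s)) (expR (- k * s)).
  have de := is_derive_expR (- k * s).
  have dg : is_derive s 1 (fun s : R => - k * s) (- k).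
    by apply: is_derive_eq; rewrite /GRing.scale/=; ring.
  have dc := @is_derive1_comp _ (@expR R) (fun s => - k * s) s _ _ de dg.
  rewrite /comp in dc.
  by apply: is_derive_eq; rewrite /GRing.scale/=; field; rewrite gt_eqF.
have lf : (- k^-1 * expR (- k * s)) @[s --> +oo] --> - k^-1 * 0.
  apply: cvgM; first exact: cvg_cst.
  under eq_fun do rewrite mulNr.
  apply: (cvg_comp _ _ _ (@cvgr_expR R)).
  by apply: gt0_cvgMry => //; exact: cvg_id.
rewrite (integral_muP_derivative _ cf df lf); last by move=> s; exact: expR_ge0.
by rewrite !mulr0 expR0 mulr1 sub0r opprK.
Qed.

Lemma form_integrable c C (k : R * R -> R) phi : nice c phi -> 0 <= C ->
  measurable_fun setT k ->
  (forall x t, phi x != 0 -> phi t != 0 -> `|k (x, t)| <= C) ->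
  (muP \x muP)%E.-integrable setT (EFin \o (fun z => phi z.1 * (k z * phi z.2))).
Proof.
move=> np C0 mk kC; have [c1 mphi _ _] := np.
have c0 : 0 <= c by rewrite (le_trans _ c1).
apply: (@integrable_prod_dominated _ _ _ _ R muP muP _ (box c) (fun t => C * box c t)).
- apply: measurable_funM; first exact: measurableT_comp.
  by apply: measurable_funM => //; exact: measurableT_comp.
- exact: integrable_box.
- exact: (integrableZl measurableT C (integrable_box c)).
move=> x t /=; have [->|px] := eqVneq (phi x) 0.
  by rewrite mul0r normr0 !mulr_ge0 ?box_ge0.
have [->|pt] := eqVneq (phi t) 0.
  by rewrite !mulr0 normr0 !mulr_ge0 ?box_ge0.
rewrite !normrM ler_pM ?mulr_ge0//; first exact: nice_box.
by rewrite ler_pM//; [exact: kC|exact: nice_box].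
Qed.

Lemma form_sections c C (k : R * R -> R) phi : nice c phi -> 0 <= C ->
  measurable_fun setT k ->
  (forall x t, phi x != 0 -> phi t != 0 -> `|k (x, t)| <= C) ->
  (forall x, muP.-integrable setT (fun t => (phi x * (k (x, t) * phi t))%:E)) /\
  muP.-integrable setT (EFin \o (fun x => \int[muP]_t (phi x * (k (x, t) * phi t)))).
Proof.
move=> np C0 mk kC; have [c1 mphi _ _] := np.
have c0 : 0 <= c by rewrite (le_trans _ c1).
have iF := form_integrable np C0 mk kC.
set F := (fun z : R * R => _) in iF.
have FB x t : `|F (x, t)| <= C * box c x * box c t.
  rewrite /F/=; have [->|px] := eqVneq (phi x) 0.
    by rewrite mul0r normr0 !mulr_ge0 ?box_ge0.
  have [->|pt] := eqVneq (phi t) 0.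
    by rewrite !mulr0 normr0 !mulr_ge0 ?box_ge0.
  rewrite [C * _]mulrC -mulrA !normrM ler_pM ?mulr_ge0//; first exact: nice_box.
  by rewrite ler_pM//; [exact: kC|exact: nice_box].
have mF : measurable_fun setT F by apply/measurable_EFinP; exact: measurable_int iF.
have isec x : muP.-integrable setT (fun t => (F (x, t))%:E).
  apply: (le_integrable measurableT _ _ (integrableZl measurableT (C * box c x) (integrable_box c))).
    by apply/measurable_EFinP; apply: (measurableT_comp mF); exact: measurable_fun_pair.
  by move=> t _; rewrite lee_fin (le_trans (FB x t))// ler_norm.
split; first exact: isec.
have ib := integrableZr measurableT (\int[muP]_t box c t) (integrableZl measurableT C (integrable_box c)).
apply: (le_integrable measurableT _ _ ib).
  by apply/measurable_EFinP; exact: (@measurable_Rintegral1 _ _ _ _ R muP F).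
move=> x _; rewrite lee_fin; apply: le_trans (ler_norm _).
apply: le_trans (le_normr_Rintegral measurableT (isec x)) _.
rewrite -(RintegralZl _ measurableT (integrable_box c)).
apply: le_Rintegral => //.
- exact: integrable_norm (isec x).
- exact: (integrableZl measurableT _ (integrable_box c)).
Qed.

(** Exchanging x and t changes the sign of the form. *)
Lemma form_antisym c C (k : R * R -> R) phi : nice c phi -> 0 <= C ->
  measurable_fun setT k ->
  (forall x t, phi x != 0 -> phi t != 0 -> `|k (x, t)| <= C) ->
  (forall x t, k (x, t) = - k (t, x)) ->
  \int[muP]_x \int[muP]_t (phi x * (k (x, t) * phi t)) = 0.
Proof.
move=> np C0 mk kC anti.
have [isec iH] := form_sections np C0 mk kC.
pose H x := \int[muP]_t (phi x * (k (x, t) * phi t)).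
have I1 : \int[muP]_x H x = -1 * \int[muP]_x H x.
  rewrite -(RintegralZl _ measurableT iH).
  rewrite {1}/H (Rintegral_Fubini (form_integrable np C0 mk kC)).
  apply: eq_Rintegral => x _; rewrite -(RintegralZl _ measurableT (isec x)).
  by apply: eq_Rintegral => t _ /=; rewrite (anti t x); ring.
by move/eqP: I1; rewrite mulN1r -addr_eq0 -mulr2n mulrn_eq0/= => /eqP.
Qed.

(** As 1 / (x + t) is the integral of exp (- s x) exp (- s t) over s > 0, this
    form is the squared norm of the Laplace transform of phi. *)
Lemma form_carleman_ge0 c phi : nice c phi ->
  0 <= \int[muP]_x \int[muP]_t (phi x * ((x + t)^-1 * phi t)).
Proof.
move=> np; have [c1 mphi _ supp] := np.
have c0 : 0 < c by rewrite (lt_le_trans _ c1).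
have sp x : phi x != 0 -> 0 < x.
  by move=> /supp/andP[cx _]; rewrite (lt_le_trans _ cx)// invr_gt0.
have cexp k : continuous (fun s : R => expR (- k * s)).
  move=> s; apply: continuous_cvg; first exact: continuous_expR.
  by apply: cvgM; [exact: cvg_cst|exact: cvg_id].
have iexp k : 0 < k -> muP.-integrable setT (fun s => (expR (- k * s))%:E).
  move=> k0; apply/integrableP; split.
    by apply/measurable_EFinP; exact: continuous_measurable_fun.
  under eq_integral do rewrite /= ger0_norm ?expR_ge0//.
  by rewrite integral_expR_decay// ltry.
pose k (z : R * R) : R := expR (- z.2 * z.1) * phi z.2.
have mk : measurable_fun setT k.
  apply: measurable_funM; last exact: measurableT_comp.
  apply: measurableT_comp; first exact: measurable_expR.
  by apply: measurable_funM => //; exact: measurableT_comp.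
(* Dominates exp (- x s) for 1 / c <= x <= c, whatever the sign of s. *)
pose M (s : R) : R := expR (- c^-1 * s) + expR (- c * s).
have mM : measurable_fun setT M.
  by apply: measurable_funD; apply: continuous_measurable_fun; exact: cexp.
have iM : muP.-integrable setT (fun s => (M s ^+ 2)%:E).
  have i1 := iexp (2 * c^-1) (mulr_gt0 (ltr0Sn R 1) (_ : 0 < c^-1)).
  have i2 := iexp (2 * c) (mulr_gt0 (ltr0Sn R 1) c0).
  rewrite invr_gt0 in i1.
  have i3 := integrableZl measurableT 2 (integrableD measurableT (i1 c0) i2).
  apply: (le_integrable measurableT _ _ i3).
    by apply/measurable_EFinP; exact: measurable_funX.
  move=> s _; rewrite lee_fin; apply: le_trans (ler_norm _).
  rewrite ger0_norm ?sqr_ge0//= /M.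
  have e1 h : expR (- (2 * h) * s) = expR (- h * s) * expR (- h * s).
    by rewrite -expRD; congr expR; ring.
  rewrite !e1; set A := expR _; set B := expR _.
  by have := sqr_ge0 (A - B); rewrite !expr2; lra.
have kB s x : `|k (s, x)| <= M s * box c x.
  rewrite /k/=; have [->|px] := eqVneq (phi x) 0.
    by rewrite mulr0 normr0 mulr_ge0 ?box_ge0 ?(ltW c0)// addr_ge0 ?expR_ge0.
  rewrite normrM ler_pM//; last exact: nice_box.
  have /andP[x1 x2] := supp _ px.
  rewrite ger0_norm ?expR_ge0// /M; have [s0|s0] := leP 0 s.
    by rewrite ler_wpDr ?expR_ge0// ler_expR !mulNr lerN2 ler_wpM2r.
  by rewrite ler_wpDl ?expR_ge0// ler_expR !mulNr lerN2 ler_wnM2r// ltW.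
have := @Rintegral_mul_Rintegral _ _ _ _ R muP muP k k M (box c) mk mk mM iM
  (integrable_box c) kB kB.
have -> : \int[muP]_x \int[muP]_t \int[muP]_s (k (s, x) * k (s, t)) =
    \int[muP]_x \int[muP]_t (phi x * ((x + t)^-1 * phi t)).
  apply: eq_Rintegral => x _; apply: eq_Rintegral => t _; rewrite /k/=.
  have [->|px] := eqVneq (phi x) 0.
    under eq_Rintegral do rewrite mulr0 mul0r.
    by rewrite mul0r /Rintegral integral0.
  have [->|pt] := eqVneq (phi t) 0.
    under eq_Rintegral do rewrite !mulr0.
    by rewrite !mulr0 /Rintegral integral0.
  have xt : 0 < x + t by rewrite addr_gt0// sp.
  transitivity (\int[muP]_s (phi x * phi t * expR (- (x + t) * s))).
    by apply: eq_Rintegral => s _; rewrite opprD mulrDl expRD; ring.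
  rewrite (RintegralZl _ measurableT (iexp _ xt)) {1}/Rintegral integral_expR_decay//=.
  ring.
move=> <-; apply: Rintegral_ge0 => s _; rewrite -expr2; exact: sqr_ge0.
Qed.

(** The part of the kernel in x - t is antisymmetric and contributes 0. The
    part in x + t differs from 1 / (x + t) by at most a^2 c^3 on the support
    of phi, and form_carleman_ge0 bounds the form of 1 / (x + t). *)
Lemma inner_opQ_ge sg c phi : `|sg| = 1 -> nice c phi -> exists C, forall a, 0 < a ->
  - (C * a ^+ 2) <= \int[muP]_x (phi x * op (Qk sg a) phi x).
Proof.
move=> sg1 np; have [c1 mphi phic supp] := np.
have c0 : 0 < c by rewrite (lt_le_trans _ c1).
have pi0 := pi_gt0 R.
pose B := \int[muP]_t box c t.
exists (pi^-1 * (c ^+ 3 * B * B)) => a a0.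
have sp x : phi x != 0 -> c^-1 <= x by move=> /supp/andP[].
have mq (g : R * R -> R) : measurable_fun setT g -> measurable_fun setT (fun z => q a (g z)).
  move=> mg; apply: (measurableT_comp _ mg).
  by apply: continuous_measurable_fun; exact: continuous_conj_poisson.
have qb u : `|q a u| <= 2 / a.
  apply: le_trans (conj_poisson_decay u a0) _.
  by rewrite ler_wpM2l// lef_pV2 ?posrE ?ltr_wpDl// lerDr.
have a20 : 0 <= 2 / a by rewrite divr_ge0// ltW.
pose k1 (z : R * R) := q a (z.1 - z.2).
pose k2 (z : R * R) := q a (z.1 + z.2).
pose k3 (z : R * R) := (z.1 + z.2)^-1.
have mk1 : measurable_fun setT k1 by apply: mq; exact: measurable_funB.
have mk2 : measurable_fun setT k2 by apply: mq; exact: measurable_funD.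
have mk3 : measurable_fun setT k3.
  by apply: (measurableT_comp (@measurable_invr R)); exact: measurable_funD.
have [s1 i1] := form_sections np a20 mk1 (fun x t _ _ => qb (x - t)).
have [s2 i2] := form_sections np a20 mk2 (fun x t _ _ => qb (x + t)).
have k3c x t : phi x != 0 -> phi t != 0 -> `|k3 (x, t)| <= c.
  move=> /sp px /sp pt; rewrite /k3/=.
  have ci : 0 < c^-1 by rewrite invr_gt0.
  have xt : 0 < x + t by rewrite addr_gt0// (lt_le_trans ci).
  rewrite gtr0_norm ?invr_gt0// -[leRHS]invrK lef_pV2 ?posrE//; lra.
have [s3 i3] := form_sections np (ltW c0) mk3 k3c.
pose H (k : R * R -> R) x := \int[muP]_t (phi x * (k (x, t) * phi t)).
have E x : phi x * op (Qk sg a) phi x = pi^-1 * (sg * H k1 x + H k2 x).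
  have ik := integrable_nice_kernel x np (measurable_Qk sg a0)
    (fun x t => @Qk_decay _ sg a c x t sg1 a0 (ltW c0)).
  rewrite /op mulrCA; apply: (congr1 (fun z => pi^-1 * z)).
  rewrite /H -(RintegralZl sg measurableT (s1 x)) -(RintegralZl _ measurableT ik).
  rewrite -(RintegralD measurableT (integrableZl measurableT sg (s1 x)) (s2 x)).
  by apply: eq_Rintegral => t _; rewrite /Qk /k1 /k2/=; ring.
have iH1 := integrableZl measurableT sg i1.
have -> : \int[muP]_x (phi x * op (Qk sg a) phi x) =
    pi^-1 * (sg * \int[muP]_x H k1 x + \int[muP]_x H k2 x).
  rewrite -(RintegralZl sg measurableT i1) -(RintegralD measurableT iH1 i2).
  rewrite -(RintegralZl _ measurableT (integrableD measurableT iH1 i2)).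
  by apply: eq_Rintegral => x _; rewrite E.
have -> : \int[muP]_x H k1 x = 0.
  apply: (form_antisym np a20 mk1) => x t; first by move=> _ _; exact: qb.
  by rewrite /k1/= -(opprB t x) conj_poissonN.
rewrite mulr0 add0r -!mulrA -mulrN ler_wpM2l ?invr_ge0 ?(ltW pi0)//.
have := form_carleman_ge0 np; rewrite -[X in 0 <= X]/(\int[muP]_x H k3 x) => H3.
have ib := integrable_box c.
pose d := a ^+ 2 * c ^+ 3.
have d0 : 0 <= d by rewrite mulr_ge0 ?exprn_ge0// ltW.
have iHd : muP.-integrable setT (EFin \o (fun x => H k3 x - d * B * box c x)).
  exact: (integrableB measurableT i3 (integrableZl measurableT (d * B) ib)).
have : \int[muP]_x (H k3 x - d * B * box c x) <= \int[muP]_x H k2 x.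
  apply: le_Rintegral => // x _.
  rewrite /H /B mulrAC -(RintegralZl _ measurableT ib).
  have iz := integrableZl measurableT (d * box c x) ib.
  rewrite -(RintegralB measurableT (s3 x) iz).
  apply: le_Rintegral => //; [exact: (integrableB measurableT (s3 x) iz)|exact: (s2 x)|].
  move=> t _; have b0 u := box_ge0 u (ltW c0).
  have bb : 0 <= d * box c x * box c t by apply: mulr_ge0 => //; exact: mulr_ge0.
  have [->|px] := eqVneq (phi x) 0; first by rewrite !mul0r sub0r oppr_le0.
  have [->|pt] := eqVneq (phi t) 0.
    by rewrite !(mulr0 (k3 _), mulr0 (k2 _)) !mulr0 sub0r oppr_le0.
  have px' := sp _ px; have pt' := sp _ pt.
  have ci : 0 < c^-1 by rewrite invr_gt0.
  have xt : 0 < x + t by rewrite addr_gt0// (lt_le_trans ci).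
  rewrite /k3 /k2/=; set u := x + t.
  have cu : c^-1 <= u by rewrite /u; lra.
  have h := sqrD_gt0 u a0.
  have kE : u^-1 - q a u = a ^+ 2 / (u * (u ^+ 2 + a ^+ 2)).
    by rewrite /q; field; rewrite !gt_eqF.
  have kd : u^-1 - q a u <= d.
    rewrite kE /d ler_wpM2l ?sqr_ge0// -[leRHS]invrK lef_pV2 ?posrE ?mulr_gt0 ?invr_gt0 ?exprn_gt0//.
    apply: (@le_trans _ _ (u ^+ 3)).
      by rewrite -exprVn ler_pXn2r ?nnegrE// ltW.
    by rewrite exprS ler_wpM2l ?(ltW xt)// lerDl sqr_ge0.
  have k0 : 0 <= u^-1 - q a u by rewrite kE divr_ge0 ?sqr_ge0// mulr_ge0// ltW.
  have : phi x * phi t * (u^-1 - q a u) <= box c x * box c t * d.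
    apply: le_trans (ler_wpM2r k0 (ler_norm _)) _.
    apply: ler_pM => //; rewrite normrM; apply: ler_pM => //; exact: nice_box.
  lra.
rewrite (RintegralB measurableT i3 (integrableZl measurableT (d * B) ib)).
rewrite (RintegralZl _ measurableT ib) -/B.
rewrite /d => h; apply: le_trans h.
rewrite [leLHS](_ : _ = 0 - a ^+ 2 * c ^+ 3 * B * B); last by ring.
exact: lerB.
Qed.

End positivity.

(** * The inversion of the half-line *)

Section inversion.
Context {R : realType}.
Local Notation mu := (@lebesgue_measure R).
Local Notation muP := (@muP R).
Local Notation RR := (measurableTypeR R).

Definition invr_fun (x : RR) : RR := (x : R)^-1.

Lemma measurable_preinv (A : set RR) : measurable A -> measurable (invr_fun @^-1` A).
Proof. by move=> mA; rewrite -[X in measurable X]setTI; exact: measurable_invr. Qed.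

(** The image under inversion of the measure with density x^-2. *)
Definition inv_mass (A : set RR) : \bar R :=
  (\int[muP]_(x in invr_fun @^-1` A) ((x : R) ^- 2)%:E)%E.

Lemma measurable_invr_sqr (D : set RR) : measurable_fun D (fun x : RR => ((x : R) ^- 2)%:E).
Proof.
apply/measurable_EFinP; apply: measurable_funTS.
under eq_fun do rewrite -exprVn.
by apply: measurable_funX; exact: measurable_invr.
Qed.

Let inv_mass0 : inv_mass set0 = 0%E.
Proof. by rewrite /inv_mass preimage_set0 integral_set0. Qed.

Let inv_mass_ge0 A : (0 <= inv_mass A)%E.
Proof. by apply: integral_ge0 => x _; rewrite lee_fin invr_ge0 sqr_ge0. Qed.

Let inv_mass_sigma_additive : semi_sigma_additive inv_mass.
Proof.
move=> F mF tF mUF; rewrite /inv_mass preimage_bigcup.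
rewrite ge0_integral_bigcup//.
- apply: is_cvg_ereal_nneg_natsum_cond => n _ _.
  by apply: integral_ge0 => x _; rewrite lee_fin invr_ge0 sqr_ge0.
- by move=> k; exact: measurable_preinv.
- exact: measurable_invr_sqr.
- by move=> x _; rewrite lee_fin invr_ge0 sqr_ge0.
- apply/trivIsetP => i j _ _ ij; rewrite -preimage_setI; move/trivIsetP : tF => /(_ i j I I ij) ->; exact: preimage_set0.
Qed.

HB.instance Definition _ := isMeasure.Build _ RR R inv_mass
  inv_mass0 inv_mass_ge0 inv_mass_sigma_additive.

Lemma inv_mass_neg (A : set RR) : measurable A -> A `<=` [set x | x <= 0] -> inv_mass A = 0%E.
Proof.
move=> mA A0; apply: null_set_integral.
- exact: measurable_preinv.
- exact: measurable_invr_sqr.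
apply: (etrans (muPE _)).
rewrite (_ : _ `&` _ = set0) ?measure0//.
by apply/seteqP; split => // x /= [/A0/=]; rewrite in_itv/= andbT invr_le0; lra.
Qed.

Lemma inv_mass_oc (c : R) : 0 < c -> inv_mass `]0%R, c] = c%:E.
Proof.
move=> c0; rewrite /inv_mass.
have -> : invr_fun @^-1` `]0%R, c] = `[c^-1, +oo[%classic.
  apply/seteqP; split => x /=; rewrite !in_itv/= andbT /invr_fun invr_gt0.
    by move=> /andP[x0]; rewrite -[X in _ <= X -> _]invrK lef_pV2 ?posrE ?invr_gt0.
  move=> cx; have x0 : 0 < x by rewrite (lt_le_trans _ cx)// invr_gt0.
  by rewrite x0/= -[leRHS]invrK lef_pV2 ?posrE ?invr_gt0.
have ci : 0 < c^-1 by rewrite invr_gt0.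
rewrite (eq_measure_integral (mu : {measure set RR -> \bar R})); last first.
  move=> A mA AD; rewrite [LHS]muPE setIidl// => x /AD/=; rewrite !in_itv/= !andbT.
  exact: lt_le_trans.
have d (x : R) : 0 < x -> is_derive x 1 (fun x : R => - x^-1) (x ^- 2).
  move=> x0; have xn : x != 0 by rewrite gt_eqF.
  have dv := @is_deriveV _ id x _ 1 xn (is_derive_id x 1).
  by apply: is_derive_eq; rewrite /GRing.scale/= mulr1 opprK.
rewrite (@ge0_continuous_FTC2y _ (fun x : R => x ^- 2) (fun x => - x^-1) c^-1 0)//.
- by rewrite invrK -EFinN opprK add0r.
- by move=> x _; rewrite invr_ge0 sqr_ge0.
- apply/subspace_continuousP => x /=; rewrite in_itv/= andbT => cx.
  apply: cvg_within_filter; apply: cvgV.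
    by rewrite expf_neq0// gt_eqF// (lt_le_trans ci).
  exact: exprn_continuous.
- by rewrite -[X in _ --> X]oppr0; apply: cvgN; exact: cvg_pinfty_inv.
- by move=> x cx; have dx := d x (lt_trans ci cx); exact: ex_derive.
- apply: cvg_at_right_filter; apply: cvgN; apply: cvgV; first by rewrite gt_eqF.
  exact: cvg_id.
- move=> x; rewrite in_itv/= andbT => cx; rewrite derive1E.
  by have dx := d x (lt_trans ci cx); exact: derive_val.
Qed.

Let mneg : measurable (`]-oo, 0%R] : set RR).
Proof. exact: measurable_itv. Qed.

(** Lebesgue measure is determined by its values on half-open intervals.
    Completing inv_mass by the Lebesgue measure of the nonpositive half-line
    makes it comparable with Lebesgue measure on all of them. *)
Lemma inv_massE (A : set RR) : measurable A -> muP A = inv_mass A.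
Proof.
have key (B : set RR) : measurable B ->
    mu B = measure_add inv_mass (mrestr mu mneg) B.
  apply: lebesgue_measure_unique => _ [[a b] _ <-] /=.
  rewrite [RHS]measure_addE /= /mrestr.
  have [ab|ba] := ltP a b; last first.
    by rewrite set_itv_ge ?bnd_simp -?leNgt// set0I !measure0 adde0.
  have mc (x y : R) : measurable (`]x, y] : set RR) by exact: measurable_itv.
  have [b0|b0] := leP b 0.
    rewrite [X in (X + _)%E]inv_mass_neg ?add0e//.
      rewrite setIidl// => x /=; rewrite !in_itv/= => /andP[_ xb].
      exact: le_trans b0.
    by move=> x /=; rewrite in_itv/= => /andP[_ xb]; exact: le_trans b0.
  have [a0|a0] := leP 0 a.
    rewrite (_ : _ `&` _ = set0) ?measure0 ?adde0; last first.
      by apply/seteqP; split => // x /=; rewrite !in_itv/=; lra.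
    have := inv_mass_oc b0; rewrite lebesgue_measure_itv/= lte_fin ab.
    move: a0; rewrite le_eqVlt => /predU1P[<- ->|a0]; first by rewrite -EFinD subr0.
    rewrite (_ : [set` `]0%R, b]] = [set` `]0%R, a]] `|` [set` `]a, b]]); last first.
      by rewrite -itv_bndbnd_setU// bnd_simp ltW.
    rewrite [X in X = _ -> _]measureU//=; last first.
      by apply/seteqP; split => // x /=; rewrite !in_itv/=; lra.
    rewrite [X in (X + _)%E = _ -> _]inv_mass_oc// => H.
    by rewrite -H addeAC subee ?add0e.
  rewrite (_ : [set` `]a, b]] `&` [set` `]-oo, 0%R]] = [set` `]a, 0%R]]); last first.
    by apply/seteqP; split => x /=; rewrite !in_itv/=; lra.
  rewrite (_ : inv_mass _ = b%:E).
    by rewrite !lebesgue_measure_itv/= !lte_fin ab a0 -!EFinD sub0r.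
  rewrite (_ : [set` `]a, b]] = [set` `]a, 0%R]] `|` [set` `]0%R, b]]); last first.
    by rewrite -itv_bndbnd_setU// bnd_simp ltW.
  rewrite [LHS]measureU//=; last first.
    by apply/seteqP; split => // x /=; rewrite !in_itv/=; lra.
  rewrite [X in (X + _)%E]inv_mass_neg ?add0e//; first exact: inv_mass_oc.
  by move=> x /=; rewrite in_itv/= => /andP[].
move=> mA; have mpos := @measurable_pos R.
rewrite muPE key; last exact: measurableI.
rewrite measure_addE/= /mrestr (_ : _ `&` _ `&` `]-oo, _] = set0) ?measure0 ?adde0; last first.
  by apply/seteqP; split => // x /=; rewrite !in_itv/=; lra.
have mA0 : measurable (A `&` `]-oo, 0%R]) by exact: measurableI.
have AE : A = (A `&` `]-oo, 0%R]) `|` (A `&` `]0%R, +oo[).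
  by rewrite -setIUr -itv_bndbnd_setU// set_itvNyy setIT.
rewrite [in RHS]AE measureU//; first last.
- by apply/seteqP; split => // x /= [[_ +] [_]]; rewrite !in_itv/=; lra.
- exact: measurableI.
by rewrite [X in (X + _)%E]inv_mass_neg ?add0e.
Qed.

Import HBNNSimple.

(** For indicator functions this is inv_massE; simple functions and monotone
    convergence give the rest. Since g is merely measurable, substitution
    theorems for continuous integrands do not apply. *)
Lemma ge0_integral_inv (g : RR -> \bar R) : measurable_fun setT g ->
  (forall x, 0 <= g x)%E ->
  (\int[muP]_x (((x : R) ^- 2)%:E * g (invr_fun x)) = \int[muP]_x g x)%E.
Proof.
move=> mg g0.
have w0 (x : R) : 0 <= x ^- 2 by rewrite invr_ge0 sqr_ge0.
pose h := nnsfun_approx measurableT mg.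
have mw (f : RR -> R) : measurable_fun setT f ->
    measurable_fun (setT : set RR) (fun x : RR => (((x : R) ^- 2)%:E * (f (invr_fun x))%:E)%E).
  move=> mf; apply: emeasurable_funM; first exact: measurable_invr_sqr.
  apply/measurable_EFinP; apply: measurableT_comp => //; exact: measurable_invr.
have -> : (\int[muP]_x g x = lim (\int[muP]_x (h n x)%:E @[n --> \oo]))%E.
  rewrite -monotone_convergence//.
  - apply: eq_integral => y _; apply/esym/cvg_lim => //.
    exact: cvg_nnsfun_approx.
  - by move=> n; apply/measurable_EFinP; exact: measurable_funP.
  - by move=> n y _; rewrite lee_fin.
  - by move=> y _ m n mn; rewrite lee_fin; exact/lefP/nd_nnsfun_approx.
have -> : (\int[muP]_x (((x : R) ^- 2)%:E * g (invr_fun x)) =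
    lim (\int[muP]_x (((x : R) ^- 2)%:E * (h n (invr_fun x))%:E) @[n --> \oo]))%E.
  rewrite -monotone_convergence//.
  - apply: eq_integral => y _; apply/esym/cvg_lim => //.
    by apply: cvgeZl => //; exact: cvg_nnsfun_approx.
  - by move=> n; apply: mw; exact: measurable_funP.
  - by move=> n y _; rewrite mule_ge0 ?lee_fin.
  - move=> y _ m n mn; rewrite lee_wpmul2l ?lee_fin//.
    exact/lefP/nd_nnsfun_approx.
congr (limn _); apply/funext => n.
have mset r : measurable (h n @^-1` [set r]).
  by rewrite -[X in measurable X]setTI; exact: measurable_funP.
transitivity (\sum_(k \in range (h n))
   \int[muP]_x (((x : R) ^- 2)%:E * (k * \1_(h n @^-1` [set k]) (invr_fun x))%:E))%E.
  rewrite -ge0_integral_fsum//.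
  - apply: eq_integral => x _; rewrite fimfunE -fsumEFin//.
    by rewrite ge0_mule_fsumr// => r; exact: nnfun_muleindic_ge0.
  - move=> r; apply: (mw (fun x => r * \1_(h n @^-1` [set r]) x)).
    exact: measurable_funM.
  - by move=> r x _; rewrite mule_ge0 ?lee_fin//; exact: nnfun_muleindic_ge0.
under [RHS]eq_integral do rewrite fimfunE -fsumEFin//.
rewrite ge0_integral_fsum//; last 2 first.
- by move=> y; apply/measurable_EFinP; exact: measurable_funM.
- by move=> y x _; rewrite nnfun_muleindic_ge0.
apply: eq_fsbigr => r rr.
have r0 : 0 <= r by move: rr; rewrite inE => -[x _ <-].
transitivity (\int[muP]_x (r%:E *
    (((x : R) ^- 2)%:E * (\1_(h n @^-1` [set r]) (invr_fun x))%:E)))%E.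
  by apply: eq_integral => x _; rewrite muleCA -EFinM.
rewrite ge0_integralZl//; last 2 first.
- apply: (mw (\1_(h n @^-1` [set r]))); exact: measurable_indic.
- by move=> x _; rewrite mule_ge0 ?lee_fin.
under [RHS]eq_integral do rewrite EFinM.
rewrite ge0_integralZl//; last by apply/measurable_EFinP; exact: measurable_indic.
congr (_ * _)%E.
rewrite integral_indic// setIT; apply: etrans (esym (inv_massE (mset r))).
rewrite /inv_mass [RHS]integral_mkcond; apply: eq_integral => x _.
rewrite patchE indicE; case: ifPn; rewrite ?inE => hx.
  by rewrite (_ : _ \in _) ?mule1// inE.
by rewrite (_ : _ \in _ = false) ?mule0//; apply: negbTE; move: hx; rewrite !notin_setE.
Qed.

(** A positive density integrates to 0 only over null sets. *)
Lemma null_inv (A : set RR) : measurable A -> muP A = 0%E ->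
  muP (invr_fun @^-1` A) = 0%E.
Proof.
move=> mA A0.
have mi := measurable_preinv mA.
have := inv_massE mA; rewrite A0 => /esym I0.
have /(ae_eq_integral_abs muP mi) [H _] : measurable_fun (invr_fun @^-1` A) (fun x : RR => ((x : R) ^- 2)%:E).
  exact: measurable_invr_sqr.
have {H} H : ae_eq muP (invr_fun @^-1` A) (fun x : RR => ((x : R) ^- 2)%:E) (cst 0%E).
  apply: H; rewrite -{}I0; apply: eq_integral => x _.
  by rewrite gee0_abs// lee_fin invr_ge0 sqr_ge0.
have pos := @muP_pos R.
apply/(@negligibleP _ _ _ muP) => //.
have [N [mN N0 sN]] := filterI H pos.
exists N; split => //.
move=> x Ax; apply: sN => -[/(_ Ax)/= /eqP + x0].
by rewrite eqe invr_eq0 expf_eq0/= gt_eqF.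
Qed.

Lemma ae_inv (P : R -> Prop) : {ae muP, forall x, P x} -> {ae muP, forall x, P x^-1}.
Proof.
move=> [N [mN N0 sN]]; exists (invr_fun @^-1` N); split.
- exact: measurable_preinv.
- exact: null_inv.
- by move=> x nP; apply: sN.
Qed.

Lemma sqn_inv (f : R -> R) : measurable_fun setT f ->
  sqn (fun x => f x^-1 / x) = sqn f.
Proof.
move=> mf; rewrite /sqn -[RHS]ge0_integral_inv.
- by apply: eq_integral => x _; rewrite -EFinM exprMn exprVn mulrC.
- by apply/measurable_EFinP; exact: measurable_funX.
- by move=> x; rewrite lee_fin sqr_ge0.
Qed.

End inversion.

(** * Squared norms *)

Section energy.
Context {R : realType}.
Local Notation muP := (@muP R).
Implicit Types (a b c s t x sg r e : R) (f g h phi u v w : R -> R).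

Lemma measurable_sqrE f : measurable_fun setT f ->
  measurable_fun setT (fun x => (f x ^+ 2)%:E).
Proof. by move=> mf; apply/measurable_EFinP; exact: measurable_funX. Qed.

Lemma sqn_ge0 f : (0 <= sqn f)%E.
Proof. by apply: integral_ge0 => x _; rewrite lee_fin sqr_ge0. Qed.

(** Because (1 + e) u^2 + (1 + 1/e) v^2 - (u + v)^2 = (e u - v)^2 / e. *)
Lemma sqnD u v e : 0 < e -> measurable_fun setT u -> measurable_fun setT v ->
  (sqn (fun x => u x + v x)%R <= (1 + e)%:E * sqn u + (1 + e^-1)%:E * sqn v)%E.
Proof.
move=> e0 hmu hmv.
have e1 : 0 <= 1 + e by rewrite addr_ge0// ltW.
have e2 : 0 <= 1 + e^-1 by rewrite addr_ge0// invr_ge0 ltW.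
have msu := measurable_sqrE hmu; have msv := measurable_sqrE hmv.
rewrite -!ge0_integralZl//; try by move=> x _; rewrite lee_fin sqr_ge0.
rewrite -ge0_integralD//; last 4 first.
- by move=> x _; rewrite -EFinM lee_fin mulr_ge0// sqr_ge0.
- exact: measurable_funeM.
- by move=> x _; rewrite -EFinM lee_fin mulr_ge0// sqr_ge0.
- exact: measurable_funeM.
apply: ge0_le_integral => //.
- by move=> x _; rewrite lee_fin sqr_ge0.
- by apply: measurable_sqrE; exact: measurable_funD.
- by apply: emeasurable_funD; exact: measurable_funeM.
move=> x _; rewrite -!EFinM -EFinD lee_fin -subr_ge0.
rewrite [X in 0 <= X](_ : _ = e^-1 * (e * u x - v x) ^+ 2); last by field; rewrite gt_eqF.
by rewrite mulr_ge0 ?sqr_ge0// invr_ge0 ltW.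
Qed.

Lemma sqnD3 u v w (A B C : R) : measurable_fun setT u -> measurable_fun setT v ->
  measurable_fun setT w -> (sqn u <= A%:E)%E -> (sqn v <= B%:E)%E -> (sqn w <= C%:E)%E ->
  (sqn (fun x => u x + (v x + w x))%R <= (2 * A + 4 * B + 4 * C)%:E)%E.
Proof.
move=> hmu hmv hmw uA vB wC.
apply: le_trans (sqnD ltr01 hmu (measurable_funD hmv hmw)) _.
have h := sqnD ltr01 hmv hmw.
rewrite (_ : 2 * A + 4 * B + 4 * C = (1 + 1) * A + (1 + 1^-1) * ((1 + 1) * B + (1 + 1^-1) * C)); last first.
  by rewrite invr1; ring.
rewrite invr1 in h *; rewrite [leRHS]EFinD; apply: leeD.
  by rewrite [leRHS]EFinM lee_pmul2l// lte_fin addr_gt0.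
rewrite [leRHS]EFinM lee_pmul2l ?lte_fin ?addr_gt0//.
apply: le_trans h _; rewrite [leRHS]EFinD.
by apply: leeD; rewrite [leRHS]EFinM lee_pmul2l// lte_fin addr_gt0.
Qed.

Lemma sqnN f : sqn (fun x => - f x) = sqn f.
Proof. by rewrite /sqn; apply: eq_integral => x _; rewrite sqrrN. Qed.

Lemma sqn_Rintegral f : muP.-integrable setT (fun x => (f x ^+ 2)%:E) ->
  sqn f = (\int[muP]_x (f x ^+ 2))%:E.
Proof. by move=> fi; rewrite /Rintegral fineK//; exact: integrable_fin_num. Qed.

Lemma limn_einf_ge0 (z : nat -> \bar R) : (forall n, 0 <= z n)%E -> (0 <= limn_einf z)%E.
Proof.
move=> z0; rewrite limn_einf_lim; apply: lime_ge; first exact: is_cvg_einfs.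
by apply: nearW => n; apply: le_ereal_inf_tmp => _ [m _ <-].
Qed.

Lemma limn_einf_le (z : nat -> \bar R) (M : \bar R) :
  (\forall n \near \oo, z n <= M)%E -> (limn_einf z <= M)%E.
Proof.
move=> zM; rewrite limn_einf_lim; apply: lime_le; first exact: is_cvg_einfs.
apply: filterS zM => n; apply: le_trans.
by apply: ereal_inf_lbound; exists n => /=.
Qed.

Lemma sqn_fatou (g_ : nat -> R -> R) g (M : R) :
  (forall n, measurable_fun setT (g_ n)) -> measurable_fun setT g ->
  {ae muP, forall x, g_ n x @[n --> \oo] --> g x} ->
  (\forall n \near \oo, sqn (g_ n) <= M%:E)%E -> (sqn g <= M%:E)%E.
Proof.
move=> mg_ mg gg bd.
have mg2 n : measurable_fun setT (fun x => (g_ n x ^+ 2)%:E) by exact: measurable_sqrE.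
have -> : sqn g = (\int[muP]_x limn_einf (fun n => (g_ n x ^+ 2)%:E))%E.
  apply: ge0_ae_eq_integral => //.
  - exact: measurable_sqrE.
  - rewrite /limn_einf; apply: measurableT_comp => //.
    apply: (measurable_fun_limn_esup (f := fun n x => (- (g_ n x ^+ 2)%:E)%E)).
    by move=> n; exact: measurableT_comp.
  - by move=> x _; rewrite lee_fin sqr_ge0.
  - by move=> x _; apply: limn_einf_ge0 => n; rewrite lee_fin sqr_ge0.
  - apply: filterS gg => x gx _.
    have H : (g_ n x ^+ 2)%:E @[n --> \oo] --> (g x ^+ 2)%:E.
      apply: cvg_EFin; first by apply: nearW.
      by under eq_fun do rewrite /= expr2; rewrite expr2; exact: cvgM.
    by rewrite (cvg_limn_einf_sup H).1.
apply: le_trans (fatou _ _ _ _) _ => //.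
- by move=> n x _; rewrite lee_fin sqr_ge0.
- exact: limn_einf_le.
Qed.

End energy.

(** * Extension of the operators to square integrable functions *)

Section contraction.
Context {R : realType}.
Local Notation muP := (@muP R).
Implicit Types (a b c s t x sg r e : R) (f g h phi u v w : R -> R).

Lemma nice_L2p c phi : nice c phi -> L2p phi.
Proof.
move=> np; have [c1 mphi phic _] := np.
split => //; last by move=> t; exact: nice_supp np.
have i2 : muP.-integrable setT (fun x => (phi x ^+ 2)%:E).
  apply: (le_integrable measurableT _ _ (integrableZl measurableT c (integrable_box c))).
    by apply/measurable_EFinP; exact: measurable_funX.
  move=> x _ /=; rewrite lee_fin normrX expr2 normrM.
  have bx := nice_box x np.
  rewrite (ger0_norm (x := c)) ?(le_trans _ c1)//.
  by apply: ler_pM => //; exact: le_trans bx (ler_norm _).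
by rewrite sqn_Rintegral// ltry.
Qed.

Definition trunc f k : R -> R :=
  f \_ (`[k.+1%:R^-1, k.+1%:R] `&` f @^-1` `[- k.+1%:R, k.+1%:R]).

Lemma trunc_nice f k : measurable_fun setT f -> nice k.+1%:R (trunc f k).
Proof.
move=> mf; split.
- by rewrite ler1n.
- have mA : measurable ((`[k.+1%:R^-1, k.+1%:R] `&`
      f @^-1` `[- k.+1%:R, k.+1%:R]) : set (measurableTypeR R)).
    apply: measurableI; first exact: measurable_itv.
    by rewrite -[X in measurable X]setTI; apply: mf => //; exact: measurable_itv.
  by apply: (proj1 (measurable_restrictT f mA)); exact: measurable_funTS.
- move=> x; rewrite /trunc patchE; case: ifPn; rewrite ?normr0 ?ler0n// inE => -[_ /=].
  by rewrite in_itv/= -ler_norml.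
- move=> x; rewrite /trunc patchE; case: ifPn; rewrite ?eqxx// inE => -[+ _].
  by rewrite /= in_itv.
Qed.

Lemma trunc_le f k x : `|trunc f k x| <= `|f x|.
Proof. by rewrite /trunc patchE; case: ifPn; rewrite ?normr0. Qed.

Lemma trunc_cvg f x : L2p f -> trunc f k x @[k --> \oo] --> f x.
Proof.
move=> Lf; have [x0|x0] := leP x 0.
  rewrite (_ : (fun k => _) = (fun=> f x)); first exact: cvg_cst.
  apply/funext => k; rewrite /trunc patchE; case: ifPn => //.
  by rewrite (L2_supp Lf).
have large (r : R) : \forall k \near \oo, r <= k.+1%:R.
  by apply: filterS (nbhs_infty_ger r) => k kr; rewrite (le_trans kr)// ler_nat.
apply: cvg_near_cst; near=> k.
rewrite /trunc patchE ifT// inE; split; rewrite /= in_itv/=.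
  apply/andP; split; last by near: k; exact: large.
  rewrite -[leRHS]invrK lef_pV2 ?posrE ?invr_gt0//.
  by near: k; exact: large.
by rewrite -ler_norml; near: k; exact: large.
Unshelve. all: by end_near. Qed.

(** Domination by f^2. *)
Lemma trunc_approx f : L2p f -> sqn (fun x => f x - trunc f k x) @[k --> \oo] --> (0 : \bar R).
Proof.
move=> Lf; have [mf _ _] := Lf; have i2 := L2_integrable_sqr Lf.
have mt k : measurable_fun setT (trunc f k) by have [] := trunc_nice k mf.
have bd k x : (f x - trunc f k x) ^+ 2 <= f x ^+ 2.
  rewrite /trunc patchE; case: ifPn => _; last by rewrite subr0.
  by rewrite subrr expr0n sqr_ge0.
have md k : measurable_fun setT (fun x => (f x - trunc f k x) ^+ 2).
  by apply: measurable_funX; exact: (measurable_funB mf (mt k)).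
have idk k : muP.-integrable setT (fun x => ((f x - trunc f k x) ^+ 2)%:E).
  apply: (le_integrable measurableT _ _ i2); first by apply/measurable_EFinP; exact: md.
  by move=> x _; rewrite lee_fin ger0_norm ?sqr_ge0// ger0_norm ?sqr_ge0.
under eq_fun do rewrite sqn_Rintegral//.
apply: cvg_EFin; first exact: nearW.
rewrite -[X in _ --> X](_ : \int[muP]_t (fun=> 0) t = 0); last first.
  by rewrite /Rintegral integral0_eq.
apply: (@Rintegral_dominated _ _ _ muP _ _ (fun x => f x ^+ 2) _ _ _ _ _).2 => //.
- apply: aeW => x; rewrite -[X in _ --> X](_ : (f x - f x) * (f x - f x) = 0); last first.
    by rewrite subrr mul0r.
  under eq_fun do rewrite expr2.
  by apply: cvgM; apply: cvgB; by [exact: cvg_cst|exact: trunc_cvg].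
- by apply: aeW => x k; rewrite ger0_norm ?sqr_ge0.
Qed.

Lemma opB (K : R -> R -> R) f g x :
  muP.-integrable setT (fun t => (K x t * f t)%:E) ->
  muP.-integrable setT (fun t => (K x t * g t)%:E) ->
  op K (fun t => f t - g t) x = op K f x - op K g x.
Proof.
move=> i1 i2; rewrite /op -mulrBr -(RintegralB measurableT i1 i2).
by apply: (congr1 (fun z => pi^-1 * z)); apply: eq_Rintegral => t _; rewrite mulrBr.
Qed.

Lemma measurable_opQ sg a f : 0 < a -> measurable_fun setT f ->
  measurable_fun setT (op (Qk sg a) f).
Proof. by move=> a0 mf; apply: measurable_op => //; exact: measurable_Qk. Qed.

Lemma measurable_opP sg a f : 0 < a -> measurable_fun setT f ->
  measurable_fun setT (op (Pk sg a) f).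
Proof. by move=> a0 mf; apply: measurable_op => //; exact: measurable_Pk. Qed.

Lemma opQ_decay sg a c phi : `|sg| = 1 -> 0 < a -> nice c phi ->
  exists D, forall x, `|op (Qk sg a) phi x| <= decay D x.
Proof.
move=> sg1 a0 np; have [c1 _ _ _] := np; have c0 : 0 <= c by rewrite (le_trans _ c1).
eexists => x; apply: (op_decay x np (measurable_Qk sg a0) (D := 2 * decay_cst a c)).
by move=> {}x t; exact: Qk_decay.
Qed.

Lemma opP_decay sg a c phi : `|sg| = 1 -> 0 < a -> nice c phi ->
  exists D, forall x, `|op (Pk sg a) phi x| <= decay D x.
Proof.
by move=> sg1 a0 np; have [D hD] := opP_decay_uniform np; exists D => x; exact: hD.
Qed.

Definition decaying u := measurable_fun setT u /\ exists D, forall x, `|u x| <= decay D x.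

Lemma integrableM_decaying u v : decaying u -> decaying v ->
  muP.-integrable setT (fun x => (u x * v x)%:E).
Proof.
move=> [hmu [D uD]] [hmv [D' vD]].
apply: (@integrableM_decay _ _ _ (Num.max D D')) => // x.
- by apply: le_trans (uD x) _; apply: decay_le; rewrite le_max lexx.
- by apply: le_trans (vD x) _; apply: decay_le; rewrite le_max lexx orbT.
Qed.

Lemma sqnB_decaying u v : decaying u -> decaying v ->
  sqn (fun x => u x - v x) =
  (\int[muP]_x (u x * u x) - 2 * \int[muP]_x (u x * v x) + \int[muP]_x (v x * v x))%:E.
Proof.
move=> du dv; have iu := integrableM_decaying du du; have iv := integrableM_decaying dv dv.
have iuv := integrableZl measurableT 2 (integrableM_decaying du dv).
have iB := integrableB measurableT iu iuv.
have E : (fun x => (u x - v x) ^+ 2) = (fun x => (u x * u x - 2 * (u x * v x)) + v x * v x).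
  by apply/funext => x; ring.
rewrite sqn_Rintegral; last first.
  by rewrite (_ : (fun x => _) = EFin \o (fun x => (u x - v x) ^+ 2))// E; exact: (integrableD measurableT iB iv).
rewrite E (RintegralD measurableT iB iv) (RintegralB measurableT iu iuv).
by rewrite (RintegralZl 2 measurableT (integrableM_decaying du dv)).
Qed.

(** This trades a Cauchy estimate for the Q_a against one for the P_a, whose
    limit is known. *)
Lemma opQ_isometry sg a b c phi : `|sg| = 1 -> 0 < a -> 0 < b -> nice c phi ->
  sqn (fun x => op (Qk sg a) phi x - op (Qk sg b) phi x) =
  sqn (fun x => op (Pk sg a) phi x - op (Pk sg b) phi x).
Proof.
move=> sg1 a0 b0 np; have [_ mphi _ _] := np.
have sg2 : sg ^+ 2 = 1 by rewrite -real_normK ?num_real// sg1 expr1n.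
have dQ e : 0 < e -> decaying (op (Qk sg e) phi).
  by move=> e0; split; [exact: measurable_opQ|exact: opQ_decay np].
have dP e : 0 < e -> decaying (op (Pk sg e) phi).
  by move=> e0; split; [exact: measurable_opP|exact: opP_decay np].
rewrite (sqnB_decaying (dQ a a0) (dQ b b0)) (sqnB_decaying (dP a a0) (dP b b0)).
by rewrite (op_isometry sg2 a0 a0 np) (op_isometry sg2 a0 b0 np) (op_isometry sg2 b0 b0 np).
Qed.

Lemma opQ_nice_contraction sg a c phi : `|sg| = 1 -> 0 < a -> nice c phi ->
  (sqn (op (Qk sg a) phi) <= sqn phi)%E.
Proof.
move=> sg1 a0 np; apply: le_trans (opP_contraction sg1 a0 np).
have [_ mphi _ _] := np.
have sg2 : sg ^+ 2 = 1 by rewrite -real_normK ?num_real// sg1 expr1n.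
rewrite /sqn; under eq_integral do rewrite expr2; under [leRHS]eq_integral do rewrite expr2.
have dQ : decaying (op (Qk sg a) phi).
  by split; [exact: measurable_opQ|exact: opQ_decay np].
have dP : decaying (op (Pk sg a) phi).
  by split; [exact: measurable_opP|exact: opP_decay np].
have := op_isometry sg2 a0 a0 np; rewrite /Rintegral => H.
rewrite -[leLHS]fineK; last exact: (integrable_fin_num measurableT (integrableM_decaying dQ dQ)).
by rewrite H fineK//; exact: (integrable_fin_num measurableT (integrableM_decaying dP dP)).
Qed.

Lemma opQ_trunc_cvg sg a f x : `|sg| = 1 -> 0 < a -> L2p f ->
  op (Qk sg a) (trunc f k) x @[k --> \oo] --> op (Qk sg a) f x.
Proof.
move=> sg1 a0 Lf; have [mf _ _] := Lf; have iQ := integrable_Qk_L2 x sg1 a0 Lf.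
have mt k : measurable_fun setT (trunc f k) by have [] := trunc_nice k mf.
have mQ : measurable_fun setT (Qk sg a x) by apply: measurable_section; exact: measurable_Qk.
apply: cvgM; first exact: cvg_cst.
apply: (@Rintegral_dominated _ _ _ muP _ _ (fun t => `|Qk sg a x t * f t|) _ _ _ _ _).2.
- by move=> k; exact: (measurable_funM mQ (mt k)).
- exact: measurable_funM.
- by apply: aeW => t; apply: cvgM; [exact: cvg_cst|exact: trunc_cvg].
- exact: (integrable_norm iQ).
- by apply: aeW => t k; rewrite !normrM ler_wpM2l// trunc_le.
Qed.

Lemma sqn_trunc_le f k : L2p f -> (sqn (trunc f k) <= sqn f)%E.
Proof.
move=> [mf _ _]; have [_ mt _ _] := trunc_nice k mf.
apply: ge0_le_integral => //.
- by move=> x _; rewrite lee_fin sqr_ge0.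
- exact: measurable_sqrE.
- exact: measurable_sqrE.
- move=> x _; rewrite lee_fin -real_normK ?num_real// -[leRHS]real_normK ?num_real//.
  by rewrite ler_pXn2r ?nnegrE// trunc_le.
Qed.

Lemma L2_sqnE f : L2p f -> sqn f = (\int[muP]_x (f x ^+ 2))%:E.
Proof. by move=> Lf; rewrite sqn_Rintegral//; exact: L2_integrable_sqr. Qed.

(** On truncations this is the isometry followed by opP_contraction; at every
    point the operators converge along the truncations, so that Fatou's lemma
    applies. *)
Lemma opQ_contraction sg a f : `|sg| = 1 -> 0 < a -> L2p f ->
  (sqn (op (Qk sg a) f) <= sqn f)%E.
Proof.
move=> sg1 a0 Lf; have [mf _ _] := Lf.
rewrite [leRHS]L2_sqnE//; apply: (sqn_fatou (g_ := fun k => op (Qk sg a) (trunc f k))).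
- by move=> k; apply: measurable_opQ => //; have [] := trunc_nice k mf.
- exact: measurable_opQ.
- by apply: aeW => x; exact: opQ_trunc_cvg.
- apply: nearW => k; rewrite -L2_sqnE//.
  by apply: le_trans (sqn_trunc_le k Lf); apply: opQ_nice_contraction => //; exact: trunc_nice.
Qed.

End contraction.

(** * The energy inequality *)

Section energy_inequality.
Context {R : realType}.
Local Notation muP := (@muP R).
Implicit Types (a b c s t x sg r e : R) (f g h phi u v w : R -> R).

Lemma sqnD_decaying u v : decaying u -> decaying v ->
  sqn (fun x => u x + v x) =
  (\int[muP]_x (u x * u x) + 2 * \int[muP]_x (u x * v x) + \int[muP]_x (v x * v x))%:E.
Proof.
move=> du [mv [D vD]].
have dv : decaying (fun x => - v x).
  by split; [exact: measurableT_comp|exists D => x; rewrite normrN].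
have := sqnB_decaying du dv.
rewrite (_ : sqn _ = sqn (fun x => u x + v x)); last first.
  by congr sqn; apply/funext => x; rewrite opprK.
move=> ->; congr (_ + _ + _)%:E; last first.
  by apply: eq_Rintegral => x _; rewrite mulrNN.
rewrite (_ : \int[muP]_x (u x * - v x) = - \int[muP]_x (u x * v x)) ?mulrN ?opprK//.
rewrite -mulN1r -(RintegralZl (-1) measurableT (integrableM_decaying du (conj mv (ex_intro _ D vD)))).
by apply: eq_Rintegral => x _; rewrite mulrN mulN1r.
Qed.

(** Expand the square: the cross term is asymptotically nonnegative, and the
    squared norm of Q_n phi is that of P_n phi, which tends to that of phi. *)
Lemma nice_energy sg c phi e : `|sg| = 1 -> nice c phi -> 0 < e ->
  \forall n \near \oo,
    ((2 * \int[muP]_x (phi x ^+ 2) - 3 * e)%R%:E <=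
    sqn (fun x => phi x + op (Qk sg (harmonic n)) phi x)%R)%E.
Proof.
move=> sg1 np e0; have [_ mphi _ _] := np.
have sg2 : sg ^+ 2 = 1 by rewrite -real_normK ?num_real// sg1 expr1n.
have h0 n : 0 < harmonic n :> R by exact: harmonic_gt0.
have dphi : decaying phi by split => //; exists (c * (1 + c)) => x; exact: nice_decay.
have dQ n : decaying (op (Qk sg (harmonic n)) phi).
  by split; [exact: measurable_opQ|exact: opQ_decay np].
have [C hC] := inner_opQ_ge sg1 np.
have Ch : C * harmonic n ^+ 2 @[n --> \oo] --> (0 : R).
  rewrite [X in _ --> X](_ : 0 = C * (0 * 0)); last by rewrite !mulr0.
  under eq_fun do rewrite expr2.
  by apply: cvgM; [exact: cvg_cst|apply: cvgM; exact: cvg_harmonic].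
have [cP _] := opP_cvg_L2 sg1 np.
near=> n.
rewrite (sqnD_decaying dphi (dQ n)) lee_fin (op_isometry sg2 (h0 n) (h0 n) np).
have -> : \int[muP]_x (phi x * phi x) = \int[muP]_x (phi x ^+ 2) by [].
have -> : \int[muP]_x (op (Pk sg (harmonic n)) phi x * op (Pk sg (harmonic n)) phi x) =
  \int[muP]_x (op (Pk sg (harmonic n)) phi x ^+ 2) by [].
have H1 : \int[muP]_x (phi x ^+ 2) - e <= \int[muP]_x (op (Pk sg (harmonic n)) phi x ^+ 2).
  have : `|\int[muP]_x (phi x ^+ 2) - \int[muP]_x (op (Pk sg (harmonic n)) phi x ^+ 2)| < e.
    by near: n; move/cvgrPdist_lt : cP; exact.
  by move=> /ltr_normlW; lra.
have H2 : C * harmonic n ^+ 2 < e.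
  have : `|0 - C * harmonic n ^+ 2| < e by near: n; move/cvgrPdist_lt : Ch; exact.
  by rewrite sub0r normrN => /ltr_normlW.
move: H1 H2 (hC _ (h0 n)).
move: (\int[muP]_x (op (Pk sg (harmonic n)) phi x ^+ 2)) (C * harmonic n ^+ 2)
  (\int[muP]_x (phi x * op (Qk sg (harmonic n)) phi x)) (\int[muP]_x (phi x ^+ 2)).
by move=> A B F K; lra.
Unshelve. all: by end_near. Qed.

(** By opQ_isometry and the triangle inequality through phi. *)
Lemma opQ_cauchy sg c phi e : `|sg| = 1 -> nice c phi -> 0 < e ->
  exists N, forall m n, (N <= m)%N -> (N <= n)%N ->
    (sqn (fun x => op (Qk sg (harmonic m)) phi x - op (Qk sg (harmonic n)) phi x)%R
       <= (4 * e)%:E)%E.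
Proof.
move=> sg1 np e0; have [_ mphi _ _] := np.
have h0 n : 0 < harmonic n :> R by exact: harmonic_gt0.
have mP n : measurable_fun setT (op (Pk sg (harmonic n)) phi) by exact: measurable_opP.
have dphi : decaying phi by split => //; exists (c * (1 + c)) => x; exact: nice_decay.
have dP n : decaying (op (Pk sg (harmonic n)) phi).
  by split; [exact: measurable_opP|exact: opP_decay np].
have [_ /cvgrPdist_lt/(_ _ e0) [N _ hN]] := opP_cvg_L2 sg1 np.
have md n : measurable_fun setT (fun x => op (Pk sg (harmonic n)) phi x - phi x).
  exact: measurable_funB.
have close n : (N <= n)%N ->
    (sqn (fun x => op (Pk sg (harmonic n)) phi x - phi x)%R <= e%:E)%E.
  move=> /hN /=; rewrite sub0r normrN => /ltr_normlW h.
  have fin := sqnB_decaying (dP n) dphi.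
  rewrite -[leLHS]fineK; last by rewrite fin.
  by rewrite lee_fin; exact: ltW.
exists N => m n Nm Nn.
rewrite (opQ_isometry sg1 (h0 m) (h0 n) np).
rewrite (_ : sqn _ = sqn (fun x => (op (Pk sg (harmonic m)) phi x - phi x) +
    (- (op (Pk sg (harmonic n)) phi x - phi x)))); last first.
  by congr sqn; apply/funext => x; ring.
apply: le_trans (sqnD ltr01 (md m) _) _; first exact: measurableT_comp.
rewrite sqnN invr1 (_ : 4 * e = (1 + 1) * e + (1 + 1) * e); last by ring.
rewrite [leRHS]EFinD [((1 + 1) * e)%:E]EFinM.
by apply: leeD; rewrite lee_pmul2l ?lte_fin ?addr_gt0//; exact: close.
Qed.

(** Let phi be a truncation of f and r = f - phi, with squared norm at most e.
    For a large fixed n, h - (phi + Q_n phi) is the limit in m of r + Q_m r +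
    (Q_m phi - Q_n phi), whose squared norm is at most 2 e + 4 e + 4 (4 e) =
    22 e. The parameter d balances the two triangle inequalities that compare
    f with phi and phi + Q_n phi with h. *)
Lemma energy_inequality_eps sg f h d e : `|sg| = 1 -> L2p f -> measurable_fun setT h ->
  (sqn h < +oo)%E ->
  {ae muP, forall x, (f x + op (Qk sg (harmonic n)) f x) @[n --> \oo] --> h x} ->
  0 < d -> 0 < e ->
  2 * \int[muP]_x (f x ^+ 2) <=
  (1 + d) * ((1 + d) * fine (sqn h) + (1 + d^-1) * (22 * e) + 3 * e) + 2 * ((1 + d^-1) * e).
Proof.
move=> sg1 Lf mh hfin cvh d0 e0; have [mf _ f0] := Lf.
have h0 n : 0 < harmonic n :> R by exact: harmonic_gt0.
have di0 : 0 < d^-1 by rewrite invr_gt0.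
have [k fk] : exists k, (sqn (fun x => f x - trunc f k x)%R <= e%:E)%E.
  have /fine_cvgP[fin /cvgrPdist_lt/(_ _ e0) cl] := trunc_approx Lf.
  have [k [kfin kcl]] := filter_ex (filterI fin cl); exists k.
  rewrite -[leLHS]fineK// lee_fin.
  by move: kcl; rewrite /= sub0r normrN => /ltr_normlW/ltW.
pose phi := trunc f k; pose r x := f x - phi x.
have np : nice k.+1%:R phi by exact: trunc_nice.
have [_ mphi _ _] := np; have Lphi := nice_L2p np.
have mr : measurable_fun setT r by exact: measurable_funB.
have Lr : L2p r.
  split => //; first by apply: le_lt_trans fk _; rewrite ltry.
  by move=> t t0; rewrite /r f0// (nice_supp np)// subrr.
have [N hN] := opQ_cauchy sg1 np e0.
have [n [nge en]] := filter_ex (filterI (nbhs_infty_ge N) (nice_energy sg1 np e0)).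
pose S x := phi x + op (Qk sg (harmonic n)) phi x.
have mS : measurable_fun setT S by apply: measurable_funD => //; exact: measurable_opQ.
have hS : (sqn (fun x => h x - S x)%R <= (22 * e)%:E)%E.
  apply: (sqn_fatou (g_ := fun m x => r x + (op (Qk sg (harmonic m)) r x +
      (op (Qk sg (harmonic m)) phi x - op (Qk sg (harmonic n)) phi x)))).
  - move=> m; apply: measurable_funD => //; apply: measurable_funD; first exact: measurable_opQ.
    by apply: measurable_funB; exact: measurable_opQ.
  - exact: measurable_funB.
  - apply: filterS cvh => x cx.
    rewrite (_ : (fun m => _) = (fun m => (f x + op (Qk sg (harmonic m)) f x) - S x)).
      by apply: cvgB => //; exact: cvg_cst.
    apply/funext => m; rewrite /r opB; [|exact: integrable_Qk_L2..].
    by rewrite /S; ring.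
  - near=> m; rewrite (_ : 22 * e = 2 * e + 4 * e + 4 * (4 * e)); last by ring.
    have mQ j : measurable_fun setT (op (Qk sg (harmonic j)) phi) by exact: measurable_opQ.
    apply: sqnD3 => //.
    + exact: measurable_opQ.
    + exact: measurable_funB.
    + by apply: le_trans fk; exact: opQ_contraction.
    + by apply: hN => //; near: m; exact: nbhs_infty_ge.
have [H hH] : exists H : R, sqn h = H%:E.
  by exists (fine (sqn h)); rewrite fineK// ge0_fin_numE// sqn_ge0.
have S_le : (sqn S <= ((1 + d) * H + (1 + d^-1) * (22 * e))%:E)%E.
  rewrite (_ : sqn S = sqn (fun x => h x + - (h x - S x))); last first.
    by congr sqn; apply/funext => x; ring.
  apply: le_trans (sqnD d0 mh _) _.
    by apply: measurableT_comp => //; exact: measurable_funB.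
  rewrite sqnN hH [leRHS]EFinD; apply: leeD; first by rewrite -EFinM.
  by rewrite [leRHS]EFinM lee_pmul2l// lte_fin addr_gt0.
have f_le : (sqn f <= ((1 + d) * \int[muP]_x (phi x ^+ 2) + (1 + d^-1) * e)%:E)%E.
  rewrite (_ : sqn f = sqn (fun x => phi x + r x)); last first.
    by congr sqn; apply/funext => x; rewrite /r; ring.
  apply: le_trans (sqnD d0 mphi mr) _.
  rewrite (L2_sqnE Lphi) [leRHS]EFinD; apply: leeD; first by rewrite -EFinM.
  by rewrite [leRHS]EFinM lee_pmul2l// lte_fin addr_gt0.
have := le_trans en S_le; rewrite lee_fin => h1.
move: f_le; rewrite (L2_sqnE Lf) lee_fin => h2.
rewrite hH /=.
apply: (@le_trans _ _ (2 * ((1 + d) * \int[muP]_x phi x ^+ 2 + (1 + d^-1) * e))).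
  by rewrite ler_pM2l.
rewrite mulrDr lerD2r mulrCA ler_pM2l ?addr_gt0//.
by move: h1; rewrite lerBlDr.
Unshelve. all: by end_near. Qed.

Lemma ler_scaled_eps (x y K : R) : 0 < K -> (forall e, 0 < e -> x <= y + K * e) -> x <= y.
Proof.
move=> K0 H; apply/ler_addgt0Pr => e e0.
by have := H (e / K) (divr_gt0 e0 K0); rewrite mulrCA mulfV ?mulr1// gt_eqF.
Qed.

(** Let e and then d tend to 0. *)
Lemma energy_inequality sg f h : `|sg| = 1 -> L2p f -> measurable_fun setT h ->
  (sqn h < +oo)%E ->
  {ae muP, forall x, (f x + op (Qk sg (harmonic n)) f x) @[n --> \oo] --> h x} ->
  2 * \int[muP]_x (f x ^+ 2) <= fine (sqn h).
Proof.
move=> sg1 Lf mh hfin cvh.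
have H0 : 0 <= fine (sqn h) by rewrite fine_ge0// sqn_ge0.
set H := fine (sqn h) in H0 *; set F := \int[muP]_x _.
have step d : 0 < d -> 2 * F <= (1 + d) ^+ 2 * H.
  move=> d0; have di0 : 0 < d^-1 by rewrite invr_gt0.
  apply: (@ler_scaled_eps _ _ ((1 + d) * ((1 + d^-1) * 22 + 3) + 2 * (1 + d^-1))).
    by rewrite addr_gt0// mulr_gt0// addr_gt0// mulr_gt0// addr_gt0.
  move=> e e0; apply: le_trans (energy_inequality_eps sg1 Lf mh hfin cvh d0 e0) _.
  by rewrite le_eqVlt; apply/orP; left; apply/eqP; rewrite -/H; ring.
apply: (@ler_scaled_eps _ _ (3 * H + 1)); first by rewrite ltr_wpDl// mulr_ge0.
move=> e e0; pose d := Num.min 1 e.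
have d0 : 0 < d by rewrite lt_min ltr01.
have d1 : d <= 1 by rewrite ge_min lexx.
have de : d <= e by rewrite ge_min lexx orbT.
apply: le_trans (step _ d0) _.
have d2 : d ^+ 2 <= d by rewrite expr2 ler_piMr// ltW.
have : (1 + d) ^+ 2 <= 1 + 3 * e by rewrite expr2 mulrDl mulrDr -expr2; lra.
move=> /(ler_wpM2r H0); rewrite mulrDl mul1r => hh.
by apply: le_trans hh _; nra.
Qed.

End energy_inequality.

(** * Real equations *)

Section real_equation.
Context {R : realType}.
Local Notation mu := (@lebesgue_measure R).
Local Notation muP := (@muP R).
Implicit Types (a b c s t x sg r e : R) (f g h phi u v w : R -> R).

Lemma sqnZ (k : R) f : measurable_fun setT f ->
  sqn (fun x => k * f x) = ((k ^+ 2)%:E * sqn f)%E.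
Proof.
move=> mf; rewrite /sqn -ge0_integralZl//.
- by apply: eq_integral => x _; rewrite exprMn EFinM.
- exact: measurable_sqrE.
- by move=> x _; rewrite lee_fin sqr_ge0.
- by rewrite lee_fin sqr_ge0.
Qed.

Lemma sqn_eq0 f : measurable_fun setT f -> sqn f = 0%E -> {ae muP, forall x, f x = 0}.
Proof.
move=> mf f0.
have /(ae_eq_integral_abs muP measurableT) [H _] := measurable_sqrE mf.
have {H} : ae_eq muP setT (fun x => (f x ^+ 2)%:E) (cst 0%E).
  apply: H; rewrite -[RHS]f0; apply: eq_integral => x _.
  by rewrite gee0_abs// lee_fin sqr_ge0.
apply: filterS => x /(_ I)/= /eqP; rewrite eqe sqrf_eq0 => /eqP; exact.
Qed.

(** The right-hand side has squared norm lambda^2 |f|^2 by sqn_inv, and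
    energy_inequality bounds it below by 2 |f|^2. *)
Lemma pv_uniqueness sg (lambda : R) f : `|sg| = 1 -> L2p f -> lambda ^+ 2 < 2 ->
  {ae muP, forall x, exists2 v : R, is_PV x (fun t => pv_kernel sg x t * f t) v &
     f x + 2 / pi * v = lambda / x * f x^-1} ->
  {ae muP, forall x, f x = 0}.
Proof.
move=> sg1 Lf lam eqn; have [mf _ _] := Lf.
pose h x := lambda * (f x^-1 / x).
have mg : measurable_fun setT (fun x : R => f x^-1 / x).
  apply: measurable_funM; last exact: measurable_invr.
  by apply: measurableT_comp => //; exact: measurable_invr.
have mh : measurable_fun setT h by exact: measurable_funM.
have hE : sqn h = (lambda ^+ 2 * \int[muP]_x (f x ^+ 2))%:E.
  by rewrite /h sqnZ// (sqn_inv mf) (L2_sqnE Lf) EFinM.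
apply: sqn_eq0 => //; rewrite (L2_sqnE Lf); congr EFin.
have F0 : 0 <= \int[muP]_x (f x ^+ 2).
  by rewrite -lee_fin -(L2_sqnE Lf) sqn_ge0.
have : 2 * \int[muP]_x (f x ^+ 2) <= fine (sqn h).
  apply: (energy_inequality sg1 Lf mh); first by rewrite hE ltry.
  apply: filterS2 eqn (@muP_pos R) => x [v pv e] x0.
  rewrite (_ : h x = f x + 2 / pi * v).
    by apply: cvgD; [exact: cvg_cst|exact: PV_op pv].
  by rewrite e /h; ring.
rewrite hE /=; move: F0; set F := Rintegral _ _ _ => F0 hF.
by apply/eqP; rewrite eq_le F0 andbT; nra.
Qed.

(** No truncation contains the singular point. *)
Lemma is_PV_eq x g h (v : R) : (forall t, 0 < t -> t != x -> g t = h t) ->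
  is_PV x g v -> is_PV x h v.
Proof.
move=> gh [ig cg].
have E e t : 0 < e -> punctured_pos x e t -> g t = h t.
  move=> e0 [t0 et]; apply: gh => //; apply: contraTneq et => ->.
  by rewrite subrr normr0 -leNgt ltW.
split.
  move=> e e0; apply: eq_integrable (ig e e0); first exact: measurable_punctured.
  by move=> t; rewrite inE /= => /(E _ _ e0) ->.
apply: cvg_trans cg; apply: near_eq_cvg; near=> e.
apply: eq_Rintegral => t; rewrite inE => /E ->//.
Unshelve. all: by end_near. Qed.

Lemma is_PV_ae0 x (K : R -> R) g : measurable_fun setT K -> measurable_fun setT g ->
  {ae mu, forall t, 0 < t -> g t = 0} -> is_PV x (fun t => K t * g t) 0.
Proof.
move=> mK mg g0.
have mD e := @measurable_punctured R x e.
have mKg : measurable_fun setT (fun t => K t * g t) by exact: measurable_funM.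
have ae0 e : ae_eq mu (punctured_pos x e) (fun t => (K t * g t)%:E) (cst 0%E).
  have : {ae mu, forall t, punctured_pos x e t -> g t = 0}.
    case: g0 => N [mN N0 sN]; exists N; split => // t /= H; apply: sN => /= H'.
    by apply: H => -[t0 _]; exact: H'.
  case => N [mN N0 sN]; exists N; split => // t /= H; apply: sN => /= H'.
  by apply: H => tD; rewrite H'// mulr0.
split.
  move=> e e0; apply/integrableP; split.
    by apply/measurable_EFinP; exact: measurable_funTS.
  have -> : (\int[mu]_(t in punctured_pos x e) `|(EFin \o (fun t => K t * g t)%R) t| = 0)%E.
    apply/(ae_eq_integral_abs mu (mD e)) => //.
    by apply/measurable_EFinP; exact: measurable_funTS.
  by rewrite ltry.
rewrite (_ : (fun e => _) = (fun=> 0)); first exact: cvg_cst.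
apply/funext => e; rewrite /Rintegral (ae_eq_integral (cst 0%E))//.
- by rewrite integral0.
- by apply/measurable_EFinP; exact: measurable_funTS.
Qed.

End real_equation.

(** * Complex equations *)

Section complex_equation.
Context {R : realType}.
Local Notation mu := (@lebesgue_measure R).
Local Notation muP := (@muP R).
Local Open Scope complex_scope.
Implicit Types (f : R -> R[i]) (g : R -> R) (x t sg lambda : R).

Definition zero_ext g : R -> R := g \_ `]0, +oo[.

Lemma zero_extE g x : 0 < x -> zero_ext g x = g x.
Proof. by move=> x0; rewrite /zero_ext patchE ifT// inE/= in_itv/= x0. Qed.

Lemma zero_ext_L2p g g' : measurable_fun (`]0, +oo[ : set R) g -> measurable_fun (`]0, +oo[ : set R) g' ->
  (\int[mu]_(x in `]0%R, +oo[) (g x ^+ 2 + g' x ^+ 2)%:E < +oo)%E -> L2p (zero_ext g).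
Proof.
move=> mg mg' gi.
have mh : measurable_fun setT (zero_ext g).
  exact: (proj1 (measurable_restrictT g (@measurable_pos R))).
split => //.
  rewrite /sqn ge0_integral_muP; last 2 first.
  - exact: measurable_sqrE.
  - by move=> x; rewrite lee_fin sqr_ge0.
  apply: le_lt_trans gi; apply: ge0_le_integral => //.
  - by move=> x _; rewrite lee_fin sqr_ge0.
  - by apply: measurable_funTS; exact: measurable_sqrE.
  - by apply/measurable_EFinP; apply: measurable_funD; exact: measurable_funX.
  - move=> x; rewrite /= in_itv/= andbT => x0.
    by rewrite zero_extE// lee_fin lerDl sqr_ge0.
by move=> t t0; rewrite /zero_ext patchE ifF// memNset//= in_itv/= andbT; apply/negP; rewrite -leNgt.
Qed.

Lemma Re_real_mul (k : R) (z : R[i]) : complex.Re (k%:C * z) = k * complex.Re z.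
Proof. by case: z => a b /=; rewrite mul0r subr0. Qed.

Lemma Im_real_mul (k : R) (z : R[i]) : complex.Im (k%:C * z) = k * complex.Im z.
Proof. by case: z => a b /=; rewrite mul0r addr0. Qed.

(** A solution splits into its real and imaginary parts, to which
    pv_uniqueness applies. Conversely, if f vanishes almost everywhere then so
    does f (1 / x), because inversion preserves null sets. *)
Lemma pv_equation_trivial sg lambda (k : R -> R -> R) f : `|sg| = 1 -> lambda ^+ 2 < 2 ->
  (forall x t, 0 < x -> 0 < t -> t != x -> k x t = pv_kernel sg x t) -> L2pos f ->
  solves_PV_eq k lambda f <-> ae_zero_pos f.
Proof.
move=> sg1 lam kE [mRe mIm fi].
pose u := zero_ext (fun x => complex.Re (f x)); pose v := zero_ext (fun x => complex.Im (f x)).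
have Lu : L2p u by exact: zero_ext_L2p fi.
have Lv : L2p v.
  by apply: (zero_ext_L2p mIm mRe); under eq_integral do rewrite addrC.
split.
  move=> sol.
  have {}sol : {ae muP, forall x, 0 < x /\ exists2 z : R[i],
      is_PVC x (fun t => (k x t)%:C * f t) z &
      f x + (2 / pi)%:C * z = (lambda / x)%:C * f (1 / x)}.
    by move/muP_ae: sol; apply: filterS2 (@muP_pos R) => x x0 ?.
  have u0 : {ae muP, forall x, u x = 0}.
    apply: (pv_uniqueness sg1 Lu lam); apply: filterS sol => x [x0 [z [pv _] e]].
    exists (complex.Re z).
      apply: is_PV_eq pv => t t0 tx.
      by rewrite Re_real_mul /u zero_extE//= kE.
    move/(congr1 (@complex.Re R)) : e.
    rewrite raddfD /= !Re_real_mul div1r /u !zero_extE// invr_gt0//.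
  have v0 : {ae muP, forall x, v x = 0}.
    apply: (pv_uniqueness sg1 Lv lam); apply: filterS sol => x [x0 [z [_ pv] e]].
    exists (complex.Im z).
      apply: is_PV_eq pv => t t0 tx.
      by rewrite Im_real_mul /v zero_extE//= kE.
    move/(congr1 (@complex.Im R)) : e.
    rewrite raddfD /= !Im_real_mul div1r /v !zero_extE// invr_gt0//.
  apply/muP_ae; apply: filterS3 (@muP_pos R) u0 v0 => x x0.
  by rewrite /u /v !zero_extE//=; case: (f x) => a b /= -> ->.
move=> f0; have := f0 => /muP_ae fP.
have u0 : {ae mu, forall t, 0 < t -> u t = 0}.
  by apply/muP_ae; apply: filterS2 (@muP_pos R) fP => t t0 ft; rewrite /u zero_extE//= ft.
have v0 : {ae mu, forall t, 0 < t -> v t = 0}.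
  by apply/muP_ae; apply: filterS2 (@muP_pos R) fP => t t0 ft; rewrite /v zero_extE//= ft.
have mpv x := measurable_pv_kernel sg x.
apply/muP_ae; apply: filterS3 (@muP_pos R) fP (ae_inv fP) => x x0 fx fxi.
exists 0; last by rewrite fx div1r fxi !mulr0 addr0.
split.
- apply: is_PV_eq (is_PV_ae0 x (mpv x) (L2_measurable Lu) u0) => t t0 tx.
  by rewrite Re_real_mul kE// /u zero_extE.
- apply: is_PV_eq (is_PV_ae0 x (mpv x) (L2_measurable Lv) v0) => t t0 tx.
  by rewrite Im_real_mul kE// /v zero_extE.
Qed.

End complex_equation.

Local Open Scope complex_scope.

Theorem corollary4 (R : realType) (lambda : R)
    (hlambda : - Num.sqrt 2 < lambda < Num.sqrt 2) :
  (forall f : R -> R[i], L2pos f ->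
     (solves_PV_eq (fun x t : R => x / (x ^+ 2 - t ^+ 2)) lambda f
      <-> ae_zero_pos f)) /\
  (forall f : R -> R[i], L2pos f ->
     (solves_PV_eq (fun x t : R => t / (t ^+ 2 - x ^+ 2)) lambda f
      <-> ae_zero_pos f)).
Proof.
have lam : lambda ^+ 2 < 2.
  by rewrite -ltr_sqrt// sqrtr_sqr ltr_norml.
split => f Lf.
- apply: (@pv_equation_trivial R 1) => //; first by rewrite normr1.
  move=> x t x0 t0 tx; rewrite /pv_kernel.
  have xt : x - t != 0 by rewrite subr_eq0 eq_sym.
  have xt' : x + t != 0 by rewrite gt_eqF// addr_gt0.
  by rewrite subr_sqr; field; rewrite xt xt'.
- apply: (@pv_equation_trivial R (-1)) => //; first by rewrite normrN1.
  move=> x t x0 t0 tx; rewrite /pv_kernel.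
  have xt : x - t != 0 by rewrite subr_eq0 eq_sym.
  have xt' : x + t != 0 by rewrite gt_eqF// addr_gt0.
  rewrite -(opprB (x ^+ 2)) subr_sqr; field.
  by rewrite ?xt ?xt'.
Qed.
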